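(* Let $\Omega\in\mathbb{R}^{(2n+m)\times n_w}$, $C\in\mathbb{R}^{n_z\times n}$, $D\in\mathbb{R}^{n_z\times m}$ be given, and let $E=0_{n_z\times n_w}$. Suppose that the data $\mathfrak{D}=(x_k,u_k)_{k=1}^N$, with $x_k\in \mathrm{H}^1([0,\tau_k];\mathbb{R}^n)$ and $u_k\in \mathrm{L}^2([0,\tau_k];\mathbb{R}^m)$, and the matrix $\Theta\in\mathbb{S}_+^{2n+m}$, partitioned as $\Theta=\begin{bmatrix}\Theta_{11}&\Theta_{12}\\ \Theta_{12}^\top&\Theta_{22}\end{bmatrix}$ with $\Theta_{11}\in\mathbb{S}^n$, $\Theta_{22}\in\mathbb{S}^{n+m}$, satisfy: (a) there exist $(A_s,B_s)\in\mathbb{R}^{n\times n}\times\mathbb{R}^{n\times m}$ and $(p_k,q_k,r_k)_{k=1}^N\in\Delta_{\tau,\Theta}$ with $x_k'-p_k=A_s(x_k-q_k)+B_s(u_k-r_k)$ a.e. on $[0,\tau_k]$ for all $k$; (b) $\Theta_{22}\prec\sum_{k=1}^N\begin{bmatrix} X_kX_k^* & X_kU_k^* \\ U_kX_k^* & U_kU_k^* \end{bmatrix}$; (c) $\Theta_{11}-\Theta_{12}\Theta_{22}^+\Theta_{12}^\top\succ0$. Then for a fixed $\gamma>0$ the following statements are equivalent: (i) The data $\mathfrak{D}$ are informative for $H_2$-control with performance $\gamma$ under the noise class $\Delta_{\tau,\Theta}$. (ii) There exist $\Phi\in\mathbb{S}_{++}^n$, $\Psi\in\mathbb{S}_{++}^{n_z}$,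 $L\in\mathbb{R}^{m\times n}$, and a scalar $\alpha>0$ such that $$\begin{bmatrix} 0_{n\times n} & -\Phi & -L^\top \\ -\Phi & 0_{n\times n} & 0_{n\times m} \\ -L & 0_{m\times n} & 0_{m\times m} \end{bmatrix}-\Omega\Omega^\top+\alpha(ZZ^*-\Theta)\succ0,$$ $$\begin{bmatrix} \Psi & C\Phi+DL \\ L^\top D^\top+\Phi C^\top & \Phi \end{bmatrix}\succ0,\qquad \operatorname{trace}(\Psi)<\gamma^2.$$ Moreover, if (ii) holds (with such $\Phi$, $\Psi$, $L$, $\alpha$), then $K:=L\Phi^{-1}$ is such that $A+BK$ is Hurwitz and $\|G_K\|_{H_2}<\gamma$ for all $(A,B)\in\Sigma_{\mathfrak{D},\Theta}$.
   Context: Notation: $n,m,N,n_w,n_z$ are positive integers and $\tau_1,\dots,\tau_N>0$, $\tau=(\tau_k)_{k=1}^N$. $\mathbb{S}^n$, $\mathbb{S}^n_+$, $\mathbb{S}^n_{++}$ are the real symmetric, nonnegative definite, positive definite $n\times n$ matrices; $\succ,\succeq,\prec,\preceq$ denote the definiteness order; $\Theta^+$ is the Moore--Penrose inverse. $\mathrm{H}^1([a,b];\mathbb{R}^n)$ is the space of absolutely continuous $\phi:[a,b]\to\mathbb{R}^n$ with $\phi'\in \mathrm{L}^2([a,b];\mathbb{R}^n)$. $\mathrm{H}^1_0[a,b]$ is the space of real-valued $\phi\in\mathrm{H}^1([a,b];\mathbb{R})$ with $\phi(a)=\phi(b)=0$, a Hilbert space with inner product $\langle\phi,\psi\rangle=\int_a^b\phi'(t)\psi'(t)\,dt$.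 $\mathcal{H}_\tau$ is the orthogonal direct sum of the Hilbert spaces $\mathrm{H}^1_0[0,\tau_k]$, $k=1,\dots,N$, i.e. tuples $\phi=(\phi_k)_{k=1}^N$ with the sum of the componentwise inner products. Data operators: $X_k:\mathrm{H}^1_0[0,\tau_k]\to\mathbb{R}^n$, $X_k\phi=\int_0^{\tau_k}\phi(t)x_k(t)\,dt$; $U_k:\mathrm{H}^1_0[0,\tau_k]\to\mathbb{R}^m$, $U_k\phi=\int_0^{\tau_k}\phi(t)u_k(t)\,dt$; $X_{\mathrm d,k}\phi=-\int_0^{\tau_k}\phi'(t)x_k(t)\,dt$. Adjoints are Hilbert space adjoints; products such as $X_kU_k^*$ are identified with matrices. $Z:\mathcal{H}_\tau\to\mathbb{R}^{2n+m}$ is $Z\phi=\sum_{k=1}^N\begin{bmatrix} X_{\mathrm d,k}\phi_k \\ -X_k\phi_k \\ -U_k\phi_k \end{bmatrix}$, and $ZZ^*$ is identified with a matrix in $\mathbb{S}_+^{2n+m}$. Noise class: for $p_k,q_k\in \mathrm{L}^2([0,\tau_k];\mathbb{R}^n)$, $r_k\in \mathrm{L}^2([0,\tau_k];\mathbb{R}^m)$ $(k=1,\dots,N)$, define $W:\mathcal{H}_\tau\to\mathbb{R}^{2n+m}$ by $W\phi=\sum_{k=1}^N\int_0^{\tau_k}\phi_k(t)\begin{bmatrix} p_k(t) \\ -q_k(t) \\ -r_k(t) \end{bmatrix}dt$. $\Delta_{\tau,\Theta}$ is the set of all such tuples with $WW^*\preceq\Theta$. Data-consistent systems: $\Sigma_{\mathfrak{D},\Theta}$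 is the set of all $(A,B)\in\mathbb{R}^{n\times n}\times\mathbb{R}^{n\times m}$ for which there exists $(p_k,q_k,r_k)_{k=1}^N\in\Delta_{\tau,\Theta}$ such that $x_k'-p_k=A(x_k-q_k)+B(u_k-r_k)$ a.e. on $[0,\tau_k]$ for all $k=1,\dots,N$. Performance: for $(A,B)$ put $B_\Omega=\begin{bmatrix}I_n&A&B\end{bmatrix}\Omega$, and for $K\in\mathbb{R}^{m\times n}$ let $G_K(s)=(C+DK)(sI_n-(A+BK))^{-1}B_\Omega+E$ (here $E=0$). $\|G_K\|_{H_2}$ is the usual $H_2$-norm (defined when $A+BK$ is Hurwitz, i.e. has all eigenvalues in the open left half-plane, and $E=0$). Informativity: $\mathfrak{D}$ are informative for $H_2$-control with performance $\gamma>0$ under $\Delta_{\tau,\Theta}$ if there exist $\Phi\in\mathbb{S}^n_{++}$, $\Psi\in\mathbb{S}^{n_z}_{++}$, $K\in\mathbb{R}^{m\times n}$ such that for all $(A,B)\in\Sigma_{\mathfrak{D},\Theta}$: $(A+BK)\Phi+\Phi(A+BK)^\top+B_\Omega B_\Omega^\top\prec0$, $\Psi-(C+DK)\Phi(C+DK)^\top\succ0$, and $\operatorname{trace}(\Psi)<\gamma^2$. *)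

(* Defs.v *)
From HB Require Import structures.
From mathcomp Require Import all_boot all_order all_algebra.
From mathcomp Require Import all_classical all_reals all_analysis.
From mathcomp Require Import complex.

Set Implicit Arguments.
Unset Strict Implicit.
Unset Printing Implicit Defensive.

Import Order.TTheory GRing.Theory Num.Theory.
Import numFieldNormedType.Exports.

Local Open Scope classical_set_scope.
Local Open Scope ring_scope.

Section Matrices.
Context {R : realType}.

Definition posdefmx p (A : 'M[R]_p) : Prop :=
  A^T = A /\ forall v : 'cV[R]_p, v != 0 -> 0 < (v^T *m A *m v) 0 0.

Definition psdmx p (A : 'M[R]_p) : Prop :=
  A^T = A /\ forall v : 'cV[R]_p, 0 <= (v^T *m A *m v) 0 0.

Definition loewner_lt p (A B : 'M[R]_p) : Prop := posdefmx (B - A).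

Definition loewner_le p (A B : 'M[R]_p) : Prop := psdmx (B - A).

(* The four Penrose equations; they have exactly one solution. *)
Definition penrose p q (A : 'M[R]_(p, q)) (P : 'M[R]_(q, p)) : Prop :=
  [/\ A *m P *m A = A, P *m A *m P = P,
      (A *m P)^T = A *m P & (P *m A)^T = P *m A].

Definition mpinv p q (A : 'M[R]_(p, q)) : 'M[R]_(q, p) :=
  xget 0 (penrose A).

End Matrices.

Section FunctionSpaces.
Context {R : realType}.

(* A function on [a, b] is represented by a function on R; its values outside
   [a, b] are irrelevant, except in H10 below. *)

Definition abs_continuous (a b : R) (f : R -> R) : Prop :=
  forall e : R, 0 < e -> exists2 d : R, 0 < d &
  forall (l : nat) (s t : 'I_l -> R),
    (forall i, [/\ a <= s i, s i <= t i & t i <= b]) ->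
    trivIset setT (fun i => `]s i, t i[%classic) ->
    \sum_i (t i - s i) < d -> \sum_i `|f (t i) - f (s i)| < e.

(* Functions, not classes modulo a.e. equality: everything below is invariant
   under modification on null sets, and every class has a Borel representative. *)
Definition L2 (a b : R) (f : R -> R) : Prop :=
  measurable_fun `[a, b] f /\
  (@lebesgue_measure R).-integrable `[a, b] (fun t => (f t ^+ 2)%:E).

(* An absolutely continuous function is derivable a.e., and derive1 is the
   classical derivative at the points where it exists. *)
Definition H1 (a b : R) (f : R -> R) : Prop :=
  abs_continuous a b f /\ L2 a b (derive1 f).

Definition L2v p (a b : R) (f : R -> 'cV[R]_p) : Prop :=
  forall i, L2 a b (fun t => f t i 0).

Definition H1v p (a b : R) (f : R -> 'cV[R]_p) : Prop :=
  forall i, H1 a b (fun t => f t i 0).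

Definition derivv p (f : R -> 'cV[R]_p) (t : R) : 'cV[R]_p :=
  \col_i derive1 (fun s => f s i 0) t.

Definition integralv p (a b : R) (f : R -> 'cV[R]_p) : 'cV[R]_p :=
  \col_i Rintegral lebesgue_measure `[a, b] (fun t => f t i 0).

(* Extension by zero, so that each element of the Hilbert space H^1_0[a, b] is
   represented by exactly one function on R. *)
Definition H10 (a b : R) : set (R -> R) :=
  [set phi | [/\ H1 a b phi, phi a = 0, phi b = 0 &
                 forall t, ~ `[a, b]%classic t -> phi t = 0]].

Definition ipH10 (a b : R) (phi psi : R -> R) : R :=
  Rintegral lebesgue_measure `[a, b] (fun t => derive1 phi t * derive1 psi t).

Definition Htau N (tau : 'I_N -> R) : set ('I_N -> R -> R) :=
  [set phi | forall k, H10 0 (tau k) (phi k)].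

Definition ipHtau N (tau : 'I_N -> R) (phi psi : 'I_N -> R -> R) : R :=
  \sum_k ipH10 0 (tau k) (phi k) (psi k).

End FunctionSpaces.

Section Adjoint.
Context {R : realType} {V : pointedType}.

(* H is the carrier of a Hilbert space with inner product ip; for a bounded
   linear T, Riesz gives existence and uniqueness of the element selected. *)
Definition adjoint (H : set V) (ip : V -> V -> R) p (T : V -> 'cV[R]_p)
    (v : 'cV[R]_p) : V :=
  get [set psi | H psi /\
         forall phi, H phi -> ip phi psi = ((T phi)^T *m v) 0 0].

(* The matrix of the linear map T S^* from R^q to R^p. *)
Definition mul_adjoint (H : set V) (ip : V -> V -> R) p q
    (T : V -> 'cV[R]_p) (S : V -> 'cV[R]_q) : 'M[R]_(p, q) :=
  \matrix_(i, j) T (adjoint H ip S (delta_mx j 0)) i 0.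

End Adjoint.

Section Data.
Context {R : realType}.

(* X_k and U_k, according to whether f is x_k or u_k. *)
Definition intop p (tau : R) (f : R -> 'cV[R]_p) (phi : R -> R) : 'cV[R]_p :=
  integralv 0 tau (fun t => phi t *: f t).

Definition dintop p (tau : R) (f : R -> 'cV[R]_p) (phi : R -> R) : 'cV[R]_p :=
  - integralv 0 tau (fun t => derive1 phi t *: f t).

Definition gram p q (tau : R) (f : R -> 'cV[R]_p) (g : R -> 'cV[R]_q) :
    'M[R]_(p, q) :=
  mul_adjoint (H10 0 tau) (ipH10 0 tau) (intop tau f) (intop tau g).

Variables (n m N : nat) (tau : 'I_N -> R).

Definition Zop (x : 'I_N -> R -> 'cV[R]_n) (u : 'I_N -> R -> 'cV[R]_m)
    (phi : 'I_N -> R -> R) : 'cV[R]_(n + (n + m)) :=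
  \sum_k col_mx (dintop (tau k) (x k) (phi k))
           (col_mx (- intop (tau k) (x k) (phi k))
                   (- intop (tau k) (u k) (phi k))).

Definition ZZ (x : 'I_N -> R -> 'cV[R]_n) (u : 'I_N -> R -> 'cV[R]_m) :
    'M[R]_(n + (n + m)) :=
  mul_adjoint (Htau tau) (ipHtau tau) (Zop x u) (Zop x u).

Definition Wop (p q : 'I_N -> R -> 'cV[R]_n) (r : 'I_N -> R -> 'cV[R]_m)
    (phi : 'I_N -> R -> R) : 'cV[R]_(n + (n + m)) :=
  \sum_k integralv 0 (tau k) (fun t =>
           phi k t *: col_mx (p k t) (col_mx (- q k t) (- r k t))).

Definition WW (p q : 'I_N -> R -> 'cV[R]_n) (r : 'I_N -> R -> 'cV[R]_m) :
    'M[R]_(n + (n + m)) :=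
  mul_adjoint (Htau tau) (ipHtau tau) (Wop p q r) (Wop p q r).

Definition noise_class (Theta : 'M[R]_(n + (n + m)))
    (p q : 'I_N -> R -> 'cV[R]_n) (r : 'I_N -> R -> 'cV[R]_m) : Prop :=
  (forall k, [/\ L2v 0 (tau k) (p k), L2v 0 (tau k) (q k)
               & L2v 0 (tau k) (r k)]) /\
  loewner_le (WW p q r) Theta.

Definition noisy_system (x : 'I_N -> R -> 'cV[R]_n)
    (u : 'I_N -> R -> 'cV[R]_m) (p q : 'I_N -> R -> 'cV[R]_n)
    (r : 'I_N -> R -> 'cV[R]_m) (A : 'M[R]_n) (B : 'M[R]_(n, m)) : Prop :=
  forall k, {ae (@lebesgue_measure R), forall t, `[0, tau k]%classic t ->
    derivv (x k) t - p k t =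
      A *m (x k t - q k t) + B *m (u k t - r k t)}.

Definition consistent (Theta : 'M[R]_(n + (n + m)))
    (x : 'I_N -> R -> 'cV[R]_n) (u : 'I_N -> R -> 'cV[R]_m)
    (A : 'M[R]_n) (B : 'M[R]_(n, m)) : Prop :=
  exists (p q : 'I_N -> R -> 'cV[R]_n) (r : 'I_N -> R -> 'cV[R]_m),
    noise_class Theta p q r /\ noisy_system x u p q r A B.

Definition BOmega nw (Omega : 'M[R]_(n + (n + m), nw)) (A : 'M[R]_n)
    (B : 'M[R]_(n, m)) : 'M[R]_(n, nw) :=
  row_mx 1%:M (row_mx A B) *m Omega.

Definition informative_H2 nw nz (Theta : 'M[R]_(n + (n + m)))
    (Omega : 'M[R]_(n + (n + m), nw)) (C : 'M[R]_(nz, n)) (D : 'M[R]_(nz, m))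
    (x : 'I_N -> R -> 'cV[R]_n) (u : 'I_N -> R -> 'cV[R]_m) (gamma : R) :
    Prop :=
  exists (Phi : 'M[R]_n) (Psi : 'M[R]_nz) (K : 'M[R]_(m, n)),
  [/\ posdefmx Phi, posdefmx Psi &
   forall (A : 'M[R]_n) (B : 'M[R]_(n, m)), consistent Theta x u A B ->
   [/\ loewner_lt ((A + B *m K) *m Phi + Phi *m (A + B *m K)^T
             + BOmega Omega A B *m (BOmega Omega A B)^T) 0,
       loewner_lt 0 (Psi - (C + D *m K) *m Phi *m (C + D *m K)^T)
     & \tr Psi < gamma ^+ 2]].

Definition H2_LMI nw nz (Theta : 'M[R]_(n + (n + m)))
    (Omega : 'M[R]_(n + (n + m), nw)) (C : 'M[R]_(nz, n)) (D : 'M[R]_(nz, m))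
    (x : 'I_N -> R -> 'cV[R]_n) (u : 'I_N -> R -> 'cV[R]_m) (gamma : R)
    (Phi : 'M[R]_n) (Psi : 'M[R]_nz) (L : 'M[R]_(m, n)) (alpha : R) : Prop :=
  [/\ loewner_lt 0 (block_mx (0 : 'M[R]_n) (row_mx (- Phi) (- L^T))
                       (col_mx (- Phi) (- L)) (block_mx 0 0 0 0)
              - Omega *m Omega^T + alpha *: (ZZ x u - Theta)),
      loewner_lt 0 (block_mx Psi (C *m Phi + D *m L)
                       (L^T *m D^T + Phi *m C^T) Phi)
    & \tr Psi < gamma ^+ 2].

End Data.

Section TransferFunctions.
Context {R : realType}.

Definition complexmx p q (A : 'M[R]_(p, q)) : 'M[R[i]]_(p, q) :=
  map_mx (real_complex R) A.

Definition hurwitz n (A : 'M[R]_n) : Prop :=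
  forall z : R[i], eigenvalue (complexmx A) z -> complex.Re z < 0.

Definition transfer n m nw nz (Omega : 'M[R]_(n + (n + m), nw))
    (C : 'M[R]_(nz, n)) (D : 'M[R]_(nz, m)) (E : 'M[R]_(nz, nw))
    (A : 'M[R]_n) (B : 'M[R]_(n, m)) (K : 'M[R]_(m, n)) (s : R[i]) :
    'M[R[i]]_(nz, nw) :=
  complexmx (C + D *m K) *m invmx (s%:M - complexmx (A + B *m K))
    *m complexmx (BOmega Omega A B) + complexmx E.

(* ((2 pi)^-1 * \int tr (G(i w)^* G(i w)) dw)^(1/2), with value +oo if the
   integral diverges. *)
Definition H2norm p q (G : R[i] -> 'M[R[i]]_(p, q)) : \bar R :=
  poweR (((2 * pi)^-1)%:E *
    \int[@lebesgue_measure R]_w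
      (complex.Re (\tr ((map_mx conjc (G (Complex 0 w)))^T
                          *m G (Complex 0 w))))%:E)%E 2^-1.

End TransferFunctions.

(* Main.v *)
(* Write S = [I A B].  Integration by parts turns the data operator Z into an
   operator of the same form as the noise operator W, with (x', x, u) in place
   of (p, q, r).  Hence (A, B) is consistent with the data exactly when
   S Z Z^* S^T <= S Theta S^T: one direction is S Z = S W, and conversely the
   noise Theta S^T (S Theta S^T)^-1 S z explains the data z.  The Lyapunov
   inequality is a strict quadratic inequality in S, so that (i) => (ii) is a
   matrix S-lemma; it reduces to the S-lemma for vectors because every vector
   feasible for the constraint is S^T v for a feasible S that is a rank-one
   perturbation of the centre.

   Since noise and states are only square integrable or absolutely continuous,
   integration by parts rests on the fundamental theorem of calculus for
   absolutely continuous functions: their total variation is absolutely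
   continuous, so its Stieltjes measure has a Radon-Nikodym density.

   For the H2 norm, the Cayley transform z = (1 - iw) / (1 + iw) expands the
   resolvent (iw - A)^-1 into a power series in z whose terms are orthogonal for
   dw / (1 + w^2).  Fatou's lemma and the Stein inequality satisfied by the
   transformed matrices bound the norm by tr (C Phi C^T). *)
Require Import Defs.
From HB Require Import structures.
From mathcomp Require Import all_boot all_order all_algebra.
From mathcomp Require Import all_classical all_reals all_analysis.
From mathcomp Require Import measurable_realfun complex ring lra.

Set Implicit Arguments.
Unset Strict Implicit.
Unset Printing Implicit Defensive.

Import Order.TTheory GRing.Theory Num.Theory.
Import numFieldNormedType.Exports.

Local Open Scope classical_set_scope.
Local Open Scope ring_scope.

(** * Quadratic forms and the strict S-lemma *)

Section QuadraticForms.
Context {R : realType}.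

(** Each hypothesis of the theorem has one main task. Write N = Theta - Z Z^*. By (b) the lower
    right block of N is negative definite, so the square can be completed and the feasible S form an
    ellipsoid around a centre. By (a) this ellipsoid is nonempty, which makes the Schur complement
    of N nonnegative. By (c) the matrix S Theta S^T is invertible for every S = [I A B], as the
    formula for the explaining noise demands.

    Adjoints are given by a choice operator, hence say nothing until a representer is exhibited.
    Therefore the Riesz representers of the integral functionals on H^1_0 are written down
    explicitly, and every product of an operator with an adjoint becomes a matrix of integrals over
    these representers.

    The S-lemma only yields alpha >= 0. Strict positivity of alpha is recovered afterwards from the
    zero block of the matrix inequality. *)

Definition qf p (A : 'M[R]_p) (v : 'cV[R]_p) : R := (v^T *m A *m v) 0 0.

Lemma qfE p (A : 'M[R]_p) v : qf A v = \sum_i \sum_j v i 0 * A i j * v j 0.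
Proof.
rewrite /qf mxE exchange_big/=; apply: eq_bigr => j _.
by rewrite mxE mulr_suml; apply: eq_bigr => i _; rewrite !mxE.
Qed.

Lemma qfD p (A B : 'M[R]_p) v : qf (A + B) v = qf A v + qf B v.
Proof. by rewrite /qf mulmxDr mulmxDl mxE. Qed.

Lemma qfN p (A : 'M[R]_p) v : qf (- A) v = - qf A v.
Proof. by rewrite /qf mulmxN mulNmx mxE. Qed.

Lemma qfB p (A B : 'M[R]_p) v : qf (A - B) v = qf A v - qf B v.
Proof. by rewrite qfD qfN. Qed.

Lemma qfZ p c (A : 'M[R]_p) v : qf (c *: A) v = c * qf A v.
Proof. by rewrite /qf -scalemxAr -scalemxAl mxE. Qed.

Lemma qf0 p (A : 'M[R]_p) : qf A 0 = 0.
Proof. by rewrite /qf mulmx0 mxE. Qed.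

Lemma qfZv p c (A : 'M[R]_p) v : qf A (c *: v) = c ^+ 2 * qf A v.
Proof.
rewrite /qf; have -> : (c *: v)^T = c *: v^T by rewrite linearZ.
by rewrite -scalemxAr -!scalemxAl !mxE mulrA expr2.
Qed.

Lemma qf_congr p q (A : 'M[R]_p) (S : 'M[R]_(q, p)) v :
  qf (S *m A *m S^T) v = qf A (S^T *m v).
Proof. by rewrite /qf trmx_mul trmxK !mulmxA. Qed.

Definition bf p (A : 'M[R]_p) (v w : 'cV[R]_p) : R := (v^T *m A *m w) 0 0.

Lemma bfC p (A : 'M[R]_p) v w : A^T = A -> bf A v w = bf A w v.
Proof.
move=> sA; rewrite /bf -[in LHS](trmxK (v^T *m A *m w)) mxE.
by rewrite !trmx_mul trmxK sA mulmxA.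
Qed.

Lemma qf_comb p (A : 'M[R]_p) v w s t : A^T = A ->
  qf A (s *: v + t *: w) =
  s ^+ 2 * qf A v + 2 * s * t * bf A v w + t ^+ 2 * qf A w.
Proof.
move=> sA; rewrite -!qfZv.
have -> : 2 * s * t * bf A v w = bf A (s *: v) (t *: w) + bf A (t *: w) (s *: v).
  rewrite [X in _ = _ + X]bfC// /bf; have -> : (s *: v)^T = s *: v^T by rewrite linearZ.
  by rewrite -scalemxAr -!scalemxAl !mxE; ring.
rewrite /qf /bf; have -> : (s *: v + t *: w)^T = (s *: v)^T + (t *: w)^T by rewrite linearD.
by rewrite !mulmxDl !mulmxDr !mxE; ring.
Qed.

Definition sqn p (v : 'cV[R]_p) : R := qf 1%:M v.

Lemma sqnE p (v : 'cV[R]_p) : sqn v = \sum_i v i 0 ^+ 2.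
Proof.
rewrite /sqn /qf mulmx1 mxE; apply: eq_bigr => i _; rewrite mxE expr2//.
Qed.

Lemma sqn_gt0 p (v : 'cV[R]_p) : v != 0 -> 0 < sqn v.
Proof.
move=> v0; rewrite sqnE lt_neqAle eq_sym sumr_ge0 ?andbT; last first.
  by move=> i _; exact: sqr_ge0.
apply: contra v0 => /eqP/psumr_eq0P v0; apply/eqP/matrixP => i j.
rewrite !mxE ord1; apply/eqP; rewrite -sqrf_eq0; apply/eqP/v0 => // k _.
exact: sqr_ge0.
Qed.

Lemma qf_rV_continuous p (A : 'M[R]_p) : continuous (fun v : 'rV[R]_p => qf A v^T).
Proof.
rewrite (_ : (fun v => _) = (fun v : 'rV[R]_p => \sum_i \sum_j v 0 i * A i j * v 0 j)).
  apply: continuous_big => [|i _]; first exact: add_continuous.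
  apply: continuous_big => [|j _ v]; first exact: add_continuous.
  have cc (k : 'I_p) : (fun w : 'rV[R]_p => w 0 k) w @[w --> v] --> v 0 k.
    exact: coord_continuous.
  by apply: cvgM (cvgM (cc i) (cvg_cst _)) (cc j).
by apply/funext => v; rewrite qfE; do 2 (apply: eq_bigr => ? _); rewrite !mxE.
Qed.

(** Both sides are homogeneous of degree two, so a minimum over the compact unit sphere controls all
    vectors. The maximum of two forms is what [qf_gap] minimizes; F = G gives a lower bound for one
    form. *)
Lemma sphere_min p (F G : 'M[R]_p.+1) : exists2 u : 'cV[R]_p.+1, sqn u = 1 &
  forall v, Num.max (qf F u) (qf G u) * sqn v <= Num.max (qf F v) (qf G v).
Proof.
pose S : set 'rV[R]_p.+1 := [set v | sqn v^T = 1].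
pose h : 'rV[R]_p.+1 -> R := (fun v => qf F v^T) \max (fun v => qf G v^T).
have ch : continuous h.
  by move=> v; apply: continuous_max; exact: qf_rV_continuous.
have S0 : S !=set0.
  exists (delta_mx 0 0); rewrite /S/= sqnE (bigD1 ord0)//= !mxE !eqxx expr1n.
  by rewrite big1 ?addr0// => i i0; rewrite !mxE (negbTE i0) expr0n.
have Scl : closed S.
  rewrite (_ : S = (fun v : 'rV[R]_p.+1 => qf 1%:M v^T) @^-1` [set 1])//.
  by apply: preimage_closed; [move=> v _; exact: qf_rV_continuous|exact: closed_eq].
have Sb : bounded_set S.
  exists 1; split => // M M1 v Sv; rewrite /= [leLHS]/Num.norm/= mx_normrE.
  apply/bigmax_leP; split => /=; first by lra.
  move=> [i j] _ /=; rewrite (le_trans _ (ltW M1))// -(@ler_pXn2r _ 2)// ?nnegrE// expr1n.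
  rewrite real_normK ?num_real// -Sv sqnE (bigD1 j)//= !mxE ord1.
  by rewrite lerDl sumr_ge0// => k _; exact: sqr_ge0.
have [u uS umin] := EVT_min_rV S0 (bounded_closed_compact Sb Scl)
  (continuous_subspaceT ch).
exists u^T; first by move: uS; rewrite inE.
move=> v; have [->|v0] := eqVneq v 0; first by rewrite !qf0 /sqn qf0 mulr0 maxxx.
have sv := sqn_gt0 v0; pose c := (Num.sqrt (sqn v))^-1.
have c2 : c ^+ 2 = (sqn v)^-1 by rewrite exprVn sqr_sqrtr// ltW.
have cv : (c *: v^T)^T = c *: v by rewrite linearZ/= trmxK.
have cS : c *: v^T \in S.
  by rewrite inE /S/= cv /sqn qfZv -/(sqn v) c2 mulVf// gt_eqF.
have := umin _ cS; rewrite /h/= cv !qfZv c2 -maxr_pMr ?invr_ge0 ?(ltW sv)//.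
by rewrite [leRHS]mulrC ler_pdivlMr.
Qed.

Lemma qf_lower_bound p (F : 'M[R]_p) : exists c, forall v, c * sqn v <= qf F v.
Proof.
case: p F => [F|p F]; first by exists 0 => v; rewrite mul0r [v]flatmx0 qf0.
have [u _ umin] := sphere_min F F; exists (qf F u) => v.
by have := umin v; rewrite !maxxx.
Qed.

(** On the unit sphere max(F, -G) is positive, hence has a positive minimum. Half of it serves both
    as the violation of the constraint that is tolerated and as the margin that is guaranteed. *)
Lemma qf_gap p (F G : 'M[R]_p) :
  (forall v, v != 0 -> 0 <= qf G v -> 0 < qf F v) ->
  exists2 e, 0 < e & forall v, - e * sqn v <= qf G v -> e * sqn v <= qf F v.
Proof.
case: p F G => [F G _|p F G H].
  by exists 1 => // v _; rewrite [v]flatmx0 /sqn !qf0 mulr0.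
have [u u1 umin] := sphere_min F (- G).
have u0 : u != 0.
  by apply: contraTneq (oner_neq0 R) => u0; rewrite -u1 u0 /sqn qf0 eqxx.
move: umin; set e := Num.max _ _ => umin.
have e0 : 0 < e.
  rewrite /e qfN lt_max oppr_gt0; case: (ltP (qf G u)) => [_|/(H _ u0)->//].
  by rewrite orbT.
exists (e / 2) => [|v Gv]; first by rewrite divr_gt0.
have [->|v0] := eqVneq v 0; first by rewrite /sqn !qf0 mulr0.
have sv : 0 < e * sqn v by rewrite mulr_gt0// sqn_gt0.
have := umin v; rewrite qfN le_max => /orP[|]; last by lra.
lra.
Qed.

(* Along v + t w the form N has two roots of opposite signs, where M > 0;
   a positive combination of the two inequalities removes the linear term. *)
Lemma qf_ratio_lt p (M N : 'M[R]_p) v w : M^T = M -> N^T = N ->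
  (forall v, v != 0 -> 0 <= qf N v -> 0 < qf M v) ->
  qf N v < 0 -> 0 < qf N w -> qf M v / qf N v < qf M w / qf N w.
Proof.
move=> sM sN H Nv Nw.
have root t : qf N v + 2 * t * bf N v w + t ^+ 2 * qf N w = 0 ->
    0 < qf M v + 2 * t * bf M v w + t ^+ 2 * qf M w.
  move=> Nt.
  have E (A : 'M[R]_p) : A^T = A -> qf A (1 *: v + t *: w) =
      qf A v + 2 * t * bf A v w + t ^+ 2 * qf A w.
    by move=> sA; rewrite qf_comb// expr1n mul1r mulr1.
  rewrite -E//; apply: H; last by rewrite E// Nt.
  rewrite scale1r; apply/eqP => vw.
  have := Nv; rewrite (_ : v = (- t) *: w); last first.
    by apply/eqP; rewrite scaleNr -addr_eq0 vw.
  by rewrite qfZv ltNge mulr_ge0 ?sqr_ge0// ltW.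
pose b := bf N v w; pose d := b ^+ 2 - qf N v * qf N w.
have d0 : 0 <= d by rewrite subr_ge0 (le_trans _ (sqr_ge0 _))// nmulr_rle0// ltW.
pose s := Num.sqrt d.
have s2 : s ^+ 2 = b ^+ 2 - qf N v * qf N w by rewrite sqr_sqrtr.
have s0 : 0 < s.
  by rewrite sqrtr_gt0 subr_gt0 (lt_le_trans _ (sqr_ge0 _))// nmulr_rlt0.
clearbody s; clear d d0; move: root; rewrite -/b; clearbody b.
move: (bf M v w) s2 s0 Nv Nw.
move: (qf N v) (qf N w) (qf M v) (qf M w) => a c f g k s2 s0 a0 c0 root.
have c' : c != 0 by rewrite gt_eqF.
have r1 : a + 2 * ((s - b) / c) * b + ((s - b) / c) ^+ 2 * c = 0.
  have -> : a + 2 * ((s - b) / c) * b + ((s - b) / c) ^+ 2 * c =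
    (a * c + s ^+ 2 - b ^+ 2) / c by field.
  by rewrite s2; field.
have r2 : a + 2 * ((- s - b) / c) * b + ((- s - b) / c) ^+ 2 * c = 0.
  have -> : a + 2 * ((- s - b) / c) * b + ((- s - b) / c) ^+ 2 * c =
    (a * c + s ^+ 2 - b ^+ 2) / c by field.
  by rewrite s2; field.
have /root h1 := r1; have /root h2 := r2.
have sb : 0 < s - b /\ 0 < s + b.
  have ac : a * c < 0 by rewrite nmulr_rlt0.
  have : `|b| < s.
    rewrite -(@ltr_pXn2r _ 2)// ?nnegrE ?(ltW s0)// real_normK ?num_real//.
    by rewrite s2; lra.
  by rewrite ltr_norml => /andP[? ?]; split; lra.
case: sb => sb1 sb2.
rewrite ltr_ndivrMr// mulrAC ltr_pdivrMr//.
(* The two roots are (s - b) / c and -(s + b) / c, so the weights s + b and s - b cancel the linear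
   term. *)
have {}h1 := mulr_gt0 sb2 h1; have {}h2 := mulr_gt0 sb1 h2.
have : 0 < (2 * s) * (f + g * (s ^+ 2 - b ^+ 2) / c ^+ 2).
  apply: lt_le_trans (addr_gt0 h1 h2) _; rewrite le_eqVlt; apply/orP; left.
  by apply/eqP; field.
rewrite pmulr_rgt0 ?mulr_gt0// s2 => h.
have -> : f * c = (f + g * (b ^+ 2 - a * c - b ^+ 2) / c ^+ 2) * c + g * a by field.
by rewrite ltrDr mulr_gt0.
Qed.

(** Divided by N, the inequality M - alpha N >= 0 bounds alpha from above where N > 0 and from below
    where N < 0. By [qf_ratio_lt] every lower bound lies below every upper bound, so the supremum of
    the lower bounds is a valid alpha. *)
Theorem strict_S_lemma p (M N : 'M[R]_p) : M^T = M -> N^T = N ->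
  (forall v, v != 0 -> 0 <= qf N v -> 0 < qf M v) ->
  exists2 alpha, 0 <= alpha & forall v, v != 0 -> 0 < qf (M - alpha *: N) v.
Proof.
move=> sM sN H; have [e e0 He] := qf_gap H.
have [[w Nw]|noN] := pselect (exists w, 0 < qf N w); last first.
  have [c cM] := qf_lower_bound M.
  pose C := `|c| + 1; have C0 : 0 < C by rewrite ltr_wpDl.
  exists (C / e) => [|v v0]; first by rewrite ltW// divr_gt0.
  rewrite qfB qfZ; have sv := sqn_gt0 v0.
  have Nv : qf N v <= 0 by rewrite leNgt; apply/negP => ?; apply: noN; exists v.
  case: (leP (- e * sqn v) (qf N v)) => [/He Mv|Nve].
    have : C / e * qf N v <= 0 by rewrite mulr_ge0_le0// ltW// divr_gt0.
    have esv : 0 < e * sqn v by rewrite mulr_gt0.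
    by move: (C / e * _) => z; lra.
  have : C / e * qf N v < - C * sqn v.
    rewrite (_ : - C * sqn v = C / e * (- e * sqn v)).
      by rewrite ltr_pM2l// divr_gt0.
    by field; rewrite gt_eqF.
  have : - `|c| * sqn v <= c * sqn v.
    by rewrite ler_pM2r// lerNl -normrN ler_norm.
  by move: (cM v); rewrite /C; move: (C / e * _) => z; lra.
(* Half of the margin is given away here, so that a nonstrict inequality for [M'] yields the strict
   one for [M]. *)
pose M' := M - (e / 2) *: 1%:M.
have M'E v : qf M' v = qf M v - e / 2 * sqn v by rewrite qfB qfZ.
have H' v : v != 0 -> 0 <= qf N v -> 0 < qf M' v.
  move=> v0 Nv; have sv := sqn_gt0 v0; rewrite M'E.
  have esv : 0 < e * sqn v by rewrite mulr_gt0.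
  have : e * sqn v <= qf M v.
    by apply: He; apply: le_trans Nv; rewrite mulNr oppr_le0 ltW.
  by lra.
have sM' : M'^T = M' by rewrite linearB/= linearZ/= trmx1 sM.
(* The element 0 makes alpha nonnegative and keeps the set nonempty when N is nowhere negative. *)
pose E := [set x | x = 0 \/ exists2 v, qf N v < 0 & x = qf M' v / qf N v].
have Eub w' : 0 < qf N w' -> ubound E (qf M' w' / qf N w').
  move=> Nw' _ [->|[v Nv ->]].
    rewrite divr_ge0 ?(ltW Nw')// ltW// H' ?ltW//.
    by apply: contraTneq Nw' => ->; rewrite qf0 ltxx.
  exact/ltW/qf_ratio_lt.
have supE : has_sup E.
  by split; [exists 0; left|exists (qf M' w / qf N w); exact: Eub].
exists (sup E) => [|v v0]; first by apply: ub_le_sup; [exact: supE.2|left].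
have sv := sqn_gt0 v0; have esv : 0 < e * sqn v by rewrite mulr_gt0.
rewrite qfB qfZ; suff : sup E * qf N v <= qf M' v by rewrite M'E; lra.
case: (ltgtP (qf N v) 0) => Nv.
- rewrite -ler_ndivrMr//; apply: ub_le_sup; first exact: supE.2.
  by right; exists v.
- by rewrite -ler_pdivlMr//; apply: sup_le_ub; [exact: supE.1|exact: Eub].
- by rewrite Nv mulr0 ltW// H'// Nv.
Qed.

End QuadraticForms.

(** * Definite matrices: Schur complements, the pseudo-inverse and the matrix S-lemma *)

Section DefiniteMatrices.
Context {R : realType}.

Lemma qf_block p q (A : 'M[R]_p) (B : 'M[R]_(p, q)) (C : 'M[R]_(q, p)) (D : 'M[R]_q)
    a b : qf (block_mx A B C D) (col_mx a b) =
  qf A a + (a^T *m B *m b) 0 0 + ((b^T *m C *m a) 0 0 + qf D b).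
Proof.
rewrite /qf tr_col_mx mul_row_block mul_row_col !mulmxDl !mxE; ring.
Qed.

Lemma psd_congr p q (A : 'M[R]_p) (S : 'M[R]_(q, p)) :
  psdmx A -> psdmx (S *m A *m S^T).
Proof.
move=> [sA A0]; split; first by rewrite !trmx_mul trmxK sA mulmxA.
by move=> v; rewrite -/(qf _ v) qf_congr; exact: A0.
Qed.

Lemma psdD p (A B : 'M[R]_p) : psdmx A -> psdmx B -> psdmx (A + B).
Proof.
move=> [sA A0] [sB B0]; split; first by rewrite linearD/= sA sB.
by move=> v; rewrite -/(qf _ v) qfD addr_ge0//; [exact: A0|exact: B0].
Qed.

Lemma psdZ p c (A : 'M[R]_p) : 0 <= c -> psdmx A -> psdmx (c *: A).
Proof.
move=> c0 [sA A0]; split; first by rewrite linearZ/= sA.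
by move=> v; rewrite -/(qf _ v) qfZ mulr_ge0//; exact: A0.
Qed.

Lemma psd_gram p q (A : 'M[R]_(p, q)) : psdmx (A *m A^T).
Proof.
rewrite -{1}(mulmx1 A); apply: psd_congr; split; first exact: trmx1.
move=> v; rewrite -/(qf _ v) -/(sqn v) sqnE sumr_ge0// => i _; exact: sqr_ge0.
Qed.

Lemma posdefD p (A B : 'M[R]_p) : posdefmx A -> psdmx B -> posdefmx (A + B).
Proof.
move=> [sA A0] [sB B0]; split; first by rewrite linearD/= sA sB.
by move=> v v0; rewrite -/(qf _ v) qfD ltr_wpDr//; [exact: B0|exact: A0].
Qed.

Lemma posdef_psd p (A : 'M[R]_p) : posdefmx A -> psdmx A.
Proof.
move=> [sA A0]; split => // v; have [->|/A0/ltW//] := eqVneq v 0.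
by rewrite mulmx0 mxE.
Qed.

Lemma posdef_congr p q (A : 'M[R]_p) (S : 'M[R]_(q, p)) :
  (forall v : 'cV[R]_q, S^T *m v = 0 -> v = 0) ->
  posdefmx A -> posdefmx (S *m A *m S^T).
Proof.
move=> Sinj [sA A0]; split; first by rewrite !trmx_mul trmxK sA mulmxA.
move=> v v0; rewrite -/(qf _ v) qf_congr; apply: A0.
by apply: contraNneq v0 => /Sinj ->.
Qed.

Lemma row1_inj p q (Y : 'M[R]_(p, q)) (v : 'cV[R]_p) :
  (row_mx 1%:M Y)^T *m v = 0 -> v = 0.
Proof.
by rewrite tr_row_mx mul_col_mx trmx1 mul1mx -col_mx0 => /eq_col_mx[].
Qed.

Lemma unitmx_inj p (A : 'M[R]_p) :
  (forall v : 'cV[R]_p, A *m v = 0 -> v = 0) -> A \in unitmx.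
Proof.
move=> inj; rewrite -unitmx_tr -row_free_unit -kermx_eq0; apply/negPn/negP.
move=> /rowV0Pn[v /sub_kermxP vA /eqP]; apply; apply: trmx_inj; rewrite trmx0.
by apply: inj; rewrite -[A]trmxK -trmx_mul vA trmx0.
Qed.

Lemma posdef_unit p (A : 'M[R]_p) : posdefmx A -> A \in unitmx.
Proof.
move=> [_ A0]; apply: unitmx_inj => v Av; apply/eqP/negPn/negP => /A0.
by rewrite -mulmxA Av mulmx0 mxE ltxx.
Qed.

Lemma psd_CS p (A : 'M[R]_p) v w : psdmx A ->
  bf A v w ^+ 2 <= qf A v * qf A w.
Proof.
move=> [sA A0].
have H s t : 0 <= s ^+ 2 * qf A v + 2 * s * t * bf A v w + t ^+ 2 * qf A w.
  by rewrite -qf_comb//; exact: A0.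
have vA : 0 <= qf A v := A0 v; have wA : 0 <= qf A w := A0 w.
move: vA wA H; move: (qf A v) (qf A w) (bf A v w) => a c b a0 c0 H.
have [a1|a1] := ltP 0 a.
  have := H b (- a); rewrite (_ : _ + _ = a * (a * c - b ^+ 2)); last by ring.
  by rewrite pmulr_rge0// subr_ge0.
have a00 : a = 0 by lra.
rewrite {a a0 a1}a00 mul0r in H *.
have [c1|c1] := ltP 0 c; last by have := H 1 (- b); nra.
have := H c (- b); rewrite (_ : _ + _ = - (c * b ^+ 2)); last by ring.
by rewrite oppr_ge0 pmulr_rle0.
Qed.

Lemma psd_ker p (A : 'M[R]_p) v : psdmx A -> qf A v = 0 -> A *m v = 0.
Proof.
move=> pA Av; apply/matrixP => i j; rewrite ord1 mxE.
have := psd_CS (delta_mx i 0) v pA; rewrite Av mulr0 => h.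
have : bf A (delta_mx i 0) v = 0 by apply/eqP; rewrite -sqrf_eq0 eq_le h sqr_ge0.
by rewrite /bf trmx_delta -rowE -row_mul !mxE.
Qed.

Lemma invmx_sym p (A : 'M[R]_p) : A^T = A -> (invmx A)^T = invmx A.
Proof. by move=> sA; rewrite trmx_inv sA. Qed.

(** Completion of the square in [b]. [D] is merely invertible because the identity serves for
    positive definite and for negative definite blocks. *)
Lemma qf_schur p q (A : 'M[R]_p) (B : 'M[R]_(p, q)) (D : 'M[R]_q) a b :
  D^T = D -> D \in unitmx ->
  qf (block_mx A B B^T D) (col_mx a b) =
  qf (A - B *m invmx D *m B^T) a + qf D (b + invmx D *m B^T *m a).
Proof.
move=> sD uD; rewrite qf_block qfB.
have bE : (b^T *m B^T *m a) 0 0 = (a^T *m B *m b) 0 0.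
  have -> : b^T *m B^T *m a = (a^T *m B *m b)^T by rewrite !trmx_mul trmxK mulmxA.
  by rewrite mxE.
rewrite bE; set e := invmx D *m B^T *m a.
have De : D *m e = B^T *m a by rewrite /e !mulmxA mulmxV// mul1mx.
have eD : e^T *m D = a^T *m B by rewrite -[LHS]trmxK trmx_mul trmxK sD De trmx_mul trmxK.
have -> : qf D (b + e) = qf D b +
    ((e^T *m D *m b) 0 0 + (b^T *m (D *m e)) 0 0 + (e^T *m D *m e) 0 0).
  by rewrite /qf [(b + e)^T]linearD/= !mulmxDl !mulmxDr !mulmxA !mxE; ring.
have -> : qf (B *m invmx D *m B^T) a = (e^T *m D *m e) 0 0.
  by rewrite eD /e /qf !mulmxA.
by rewrite De eD mulmxA bE; ring.
Qed.

Lemma sym_block p q (A : 'M[R]_(p + q)) : A^T = A ->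
  [/\ (ulsubmx A)^T = ulsubmx A, dlsubmx A = (ursubmx A)^T &
      (drsubmx A)^T = drsubmx A].
Proof. by move=> sA; rewrite trmx_ulsub trmx_ursub trmx_drsub sA. Qed.

Lemma posdef_schur p q (A : 'M[R]_p) (B : 'M[R]_(p, q)) (D : 'M[R]_q) :
  A^T = A -> posdefmx D ->
  posdefmx (block_mx A B B^T D) <-> posdefmx (A - B *m invmx D *m B^T).
Proof.
move=> sA pD; have uD := posdef_unit pD; have sD := pD.1.
have sS : (A - B *m invmx D *m B^T)^T = A - B *m invmx D *m B^T.
  by rewrite linearB/= !trmx_mul trmxK invmx_sym// sA mulmxA.
split=> [[_ H]|[_ H]]; split => //.
- move=> v v0; have := H (col_mx v (- (invmx D *m B^T *m v))).
  rewrite -!/(qf _ _) qf_schur// addNr qf0 addr0; apply.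
  by rewrite col_mx_eq0 negb_and v0.
- by rewrite tr_block_mx trmxK sA sD.
- move=> v; rewrite -(vsubmxK v); set a := usubmx v; set b := dsubmx v => v0.
  rewrite -/(qf _ _) qf_schur//; have [a0|a0] := eqVneq a 0.
    rewrite a0 qf0 add0r mulmx0 addr0; apply: pD.2.
    by apply: contraNneq v0 => ->; rewrite a0 col_mx0.
  by rewrite ltr_wpDr//; [exact: (posdef_psd pD).2|exact: H].
Qed.

Lemma full_rank_gram p r (A : 'M[R]_(r, p)) : row_free A -> A *m A^T \in unitmx.
Proof.
move=> fA; apply: unitmx_inj => v Av.
have vA : v^T *m A = 0.
  have := psd_gram A => -[_ /(_ v)] _.
  have : sqn (A^T *m v) = 0.
    by rewrite /sqn -qf_congr mulmx1 /qf -mulmxA Av mulmx0 mxE.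
  move=> h; apply/trmx_inj; rewrite trmx_mul trmxK trmx0.
  apply/eqP/negPn/negP => /sqn_gt0; by rewrite h ltxx.
by apply/trmx_inj; rewrite trmx0; apply: (row_free_inj fA); rewrite /= mul0mx.
Qed.

(** [mpinv] is chosen by [xget], so its equations are available only once a solution is exhibited. A
    full-rank factorization A = L Q provides one. *)
Lemma penrose_exists p q (A : 'M[R]_(p, q)) : exists P, penrose A P.
Proof.
have [r [L [Q [-> uL uQ]]]] : exists r (L : 'M[R]_(p, r)) (Q : 'M[R]_(r, q)),
    [/\ A = L *m Q, L^T *m L \in unitmx & Q *m Q^T \in unitmx].
  exists (\rank A), (col_base A), (row_base A); split.
  - by rewrite mulmx_base.
  - rewrite -{2}(trmxK (col_base A)); apply: full_rank_gram.
    by rewrite /row_free mxrank_tr; exact: col_base_full.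
  - by apply: full_rank_gram; exact: row_base_free.
exists (Q^T *m invmx (Q *m Q^T) *m invmx (L^T *m L) *m L^T).
have AP : L *m Q *m (Q^T *m invmx (Q *m Q^T) *m invmx (L^T *m L) *m L^T) =
    L *m invmx (L^T *m L) *m L^T.
  by rewrite !mulmxA -(mulmxA L Q) -(mulmxA L (Q *m _)) mulmxV// mulmx1.
have PA : Q^T *m invmx (Q *m Q^T) *m invmx (L^T *m L) *m L^T *m (L *m Q) =
    Q^T *m invmx (Q *m Q^T) *m Q.
  by rewrite !mulmxA -(mulmxA _ L^T L) -(mulmxA _ _ (L^T *m L)) mulVmx// mulmx1.
split.
- by rewrite AP !mulmxA -(mulmxA _ L^T L) -(mulmxA _ _ (L^T *m L)) mulVmx// mulmx1.
- by rewrite PA !mulmxA -(mulmxA _ Q Q^T) -(mulmxA _ _ (Q *m Q^T)) mulVmx// mulmx1.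
- rewrite AP !trmx_mul trmxK invmx_sym ?mulmxA//.
  by rewrite trmx_mul trmxK.
- rewrite PA !trmx_mul trmxK invmx_sym ?mulmxA//.
  by rewrite trmx_mul trmxK.
Qed.

Lemma mulmx_mpinv p q (A : 'M[R]_(p, q)) : A *m mpinv A *m A = A.
Proof.
by have [P PP] := penrose_exists A; have [] : penrose A (mpinv A) := xgetI 0 PP.
Qed.

(* If v^T S T S^T v = 0 then T kills S^T v = [v; Y^T v], so that the
   generalized Schur complement vanishes at v. *)
Lemma posdef_row1_congr p q (T : 'M[R]_(p + q)) (Y : 'M[R]_(p, q)) :
  psdmx T ->
  posdefmx (ulsubmx T - ursubmx T *m mpinv (drsubmx T) *m (ursubmx T)^T) ->
  posdefmx (row_mx 1%:M Y *m T *m (row_mx 1%:M Y)^T).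
Proof.
move=> pT pS; have [sS Spsd] := psd_congr (row_mx 1%:M Y) pT; split => // v v0.
rewrite lt_neqAle Spsd andbT eq_sym; apply/eqP; rewrite -/(qf _ _) qf_congr.
move=> /(psd_ker pT); have [sT _] := pT.
have [s11 s21 s22] := sym_block sT.
rewrite tr_row_mx trmx1 mul_col_mx mul1mx; set y := Y^T *m v.
rewrite -{1}(submxK T) mul_block_col -col_mx0 => /eq_col_mx[e1 e2].
have := pS.2 _ v0; rewrite -/(qf _ _) qfB.
have e2' : (ursubmx T)^T *m v = - (drsubmx T *m y).
  by apply/eqP; rewrite -addr_eq0 -s21 e2.
have e3 : v^T *m ursubmx T = - (y^T *m drsubmx T).
  by apply/trmx_inj; rewrite trmx_mul trmxK e2' linearN/= trmx_mul trmxK s22.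
have e4 : ulsubmx T *m v = - (ursubmx T *m y) by apply/eqP; rewrite -addr_eq0 e1.
have -> : qf (ulsubmx T) v = (y^T *m drsubmx T *m y) 0 0.
  by rewrite /qf -mulmxA e4 mulmxN mulmxA e3 mulNmx opprK.
suff -> : qf (ursubmx T *m mpinv (drsubmx T) *m (ursubmx T)^T) v =
    (y^T *m drsubmx T *m y) 0 0 by rewrite subrr ltxx.
rewrite /qf; set P := mpinv _.
have -> : v^T *m (ursubmx T *m P *m (ursubmx T)^T) *m v =
    (v^T *m ursubmx T) *m P *m ((ursubmx T)^T *m v) by rewrite !mulmxA.
rewrite e3 e2' mulmxN !mulNmx opprK.
have -> : y^T *m drsubmx T *m P *m (drsubmx T *m y) =
    y^T *m (drsubmx T *m P *m drsubmx T) *m y by rewrite !mulmxA.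
by rewrite mulmx_mpinv.
Qed.

(* The vector v = [v1; v2] with v^T N v >= 0 is [I; Y^T] v1 for a feasible Y
   that differs from the centre of the feasible set by a rank-one matrix. *)
Lemma feasible_row1 p q (N : 'M[R]_(p + q)) (Y0 : 'M[R]_(p, q)) v :
  N^T = N -> posdefmx (- drsubmx N) ->
  psdmx (row_mx 1%:M Y0 *m N *m (row_mx 1%:M Y0)^T) -> 0 <= qf N v ->
  exists2 Y : 'M[R]_(p, q), psdmx (row_mx 1%:M Y *m N *m (row_mx 1%:M Y)^T) &
    v = (row_mx 1%:M Y)^T *m usubmx v.
Proof.
move=> sN pD pY0; have [s11 s21 s22] := sym_block sN.
pose D := - drsubmx N; have uD : drsubmx N \in unitmx.
  have := posdef_unit pD; rewrite -scaleN1r unitmxZ//.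
  by rewrite unitrN unitr1.
pose B := ursubmx N.
pose P := ulsubmx N - B *m invmx (drsubmx N) *m B^T.
have qfN' a b : qf N (col_mx a b) =
    qf P a - qf D (b + invmx (drsubmx N) *m B^T *m a).
  by rewrite -[N in LHS](submxK N) s21 qf_schur// /D qfN opprK.
(* With this [K] the feasible [Y] are those for which Y^T + K does not increase length, measured by
   the form P before and by the form D after; the centre is -K^T. *)
pose K := invmx (drsubmx N) *m B^T.
have qfY Y a : qf (row_mx 1%:M Y *m N *m (row_mx 1%:M Y)^T) a =
    qf P a - qf D ((Y^T + K) *m a).
  by rewrite qf_congr tr_row_mx trmx1 mul_col_mx mul1mx qfN' mulmxDl.
have symY Y : (row_mx 1%:M Y *m N *m (row_mx 1%:M Y)^T)^T =
    row_mx 1%:M Y *m N *m (row_mx 1%:M Y)^T.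
  by rewrite !trmx_mul trmxK sN mulmxA.
have D0 : psdmx D := posdef_psd pD.
have pP : psdmx P.
  split.
    by rewrite /P linearB/= !trmx_mul trmxK invmx_sym// s11 mulmxA.
  move=> a; rewrite -/(qf _ _); have := pY0.2 a; rewrite -/(qf _ _) qfY.
  by have := D0.2 ((Y0^T + K) *m a); rewrite -/(qf _ _); lra.
rewrite -[v in qf _ v](vsubmxK v); set a := usubmx v; set b := dsubmx v.
rewrite qfN'; set z := b + _ => Nv.
have Dz := D0.2 z; rewrite -/(qf _ _) in Dz.
have bE : b = z - K *m a by rewrite /z /K addrK.
(* If P vanishes at [a], then z = 0 and the centre itself is the required [Y]. *)
have [s0|s0] := eqVneq (qf P a) 0.
  have z0 : z = 0.
    apply/eqP/negPn/negP => /(pD.2 z); rewrite -/(qf _ _) -/D.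
    by move: Nv; rewrite s0; lra.
  exists (- K^T).
    split=> // w; rewrite -/(qf _ _) qfY linearN/= trmxK addNr mul0mx qf0 subr0.
    exact: pP.2.
  rewrite tr_row_mx trmx1 mul_col_mx mul1mx linearN/= trmxK -{1}(vsubmxK v).
  by rewrite -/a -/b bE z0 sub0r mulNmx.
have s1 : 0 < qf P a by rewrite lt_neqAle eq_sym s0; exact: pP.2.
(* The rank-one term is chosen so that Y^T + K sends [a] to [z]. Feasibility is the Cauchy-Schwarz
   inequality for P together with qf D z <= qf P a. *)
exists ((qf P a)^-1 *: (P *m a *m z^T) - K^T).
  split=> // w; rewrite -/(qf _ _) qfY linearB/= linearZ/= !trmx_mul !trmxK.
  rewrite subrK pP.1 -scalemxAl qfZv.
  have -> : z *m (a^T *m P) *m w = bf P a w *: z.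
    rewrite -mulmxA [a^T *m P *m w]mx11_scalar -/(bf P a w).
    by rewrite mul_mx_scalar.
  rewrite qfZv subr_ge0.
  apply: (@le_trans _ _ ((qf P a)^-1 ^+ 2 * (qf P a * qf P w * qf P a))).
    rewrite ler_wpM2l ?sqr_ge0// ler_pM ?sqr_ge0//; first exact: psd_CS.
    by rewrite -subr_ge0.
  by rewrite le_eqVlt; apply/orP; left; apply/eqP; field.
rewrite tr_row_mx trmx1 mul_col_mx mul1mx linearB/= linearZ/= !trmx_mul !trmxK.
rewrite -{1}(vsubmxK v) -/a -/b; congr col_mx.
rewrite mulmxBl -scalemxAl pP.1 -mulmxA [a^T *m P *m a]mx11_scalar -/(qf P a).
by rewrite mul_mx_scalar scalerA mulVf// scale1r.
Qed.

Theorem matrix_S_lemma p q (M N : 'M[R]_(p + q)) (Y0 : 'M[R]_(p, q)) :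
  M^T = M -> N^T = N -> posdefmx (- drsubmx N) ->
  psdmx (row_mx 1%:M Y0 *m N *m (row_mx 1%:M Y0)^T) ->
  (forall Y : 'M[R]_(p, q), psdmx (row_mx 1%:M Y *m N *m (row_mx 1%:M Y)^T) ->
     posdefmx (row_mx 1%:M Y *m M *m (row_mx 1%:M Y)^T)) ->
  exists2 alpha, 0 <= alpha & posdefmx (M - alpha *: N).
Proof.
move=> sM sN pD pY0 H.
have [|alpha a0 Ha] := strict_S_lemma sM sN.
  move=> v v0 /(feasible_row1 sN pD pY0)[Y /H[_ pM] vE].
  rewrite vE -qf_congr; apply: pM; apply: contraNneq v0 => u0.
  by rewrite vE u0 mulmx0.
by exists alpha => //; split; [rewrite linearB/= linearZ/= sM sN|exact: Ha].
Qed.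

End DefiniteMatrices.

(** * Absolutely continuous functions *)

Section AbsoluteContinuity.
Context {R : realType}.
Implicit Types (a b x y e : R) (f : R -> R) (p q : R * R) (L : seq (R * R)).

Definition noverlap p q : bool := (p.2 <= q.1) || (q.2 <= p.1).

Definition subitv a b p : bool := [&& a <= p.1, p.1 <= p.2 & p.2 <= b].

(* Absolute continuity with families of intervals as lists, which are easier
   to concatenate than families indexed by ordinals. *)
Definition acl a b f := forall e, 0 < e -> exists2 d, 0 < d &
  forall L, all (subitv a b) L -> pairwise noverlap L ->
  \sum_(p <- L) (p.2 - p.1) < d -> \sum_(p <- L) `|f p.2 - f p.1| < e.

Lemma abs_continuous_acl a b f : abs_continuous a b f -> acl a b f.
Proof.
move=> acf e /acf[d d0 H]; exists d => // L Lab Lno Ld.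
pose s (i : 'I_(size L)) := (nth (0, 0) L i).1.
pose t (i : 'I_(size L)) := (nth (0, 0) L i).2.
rewrite (big_nth (0, 0)) big_mkord; apply: (H _ s t).
- move=> i; have /allP/(_ (nth (0,0) L i)) := Lab.
  by rewrite mem_nth// => /(_ isT)/and3P[].
- apply/trivIsetP => i j _ _; wlog ij : i j / (i < j)%N.
    move=> W; case: (ltngtP i j) => [ij _|ji|/val_inj->]; last by rewrite eqxx.
      by apply: W => //; rewrite neq_ltn ij.
    by rewrite setIC eq_sym => ?; apply: W.
  move=> _; move/(pairwiseP (0, 0)): Lno => /(_ i j).
  rewrite !inE !ltn_ord => /(_ isT isT ij) /orP no.
  rewrite -subset0 => u [] /=; rewrite !in_itv/= => /andP[u1 u2] /andP[u3 u4].
  by move: u1 u2 u3 u4; rewrite /s /t; case: no => no; lra.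
- by move: Ld; rewrite (big_nth (0, 0)) big_mkord.
Qed.

Lemma aclD a b f g : acl a b f -> acl a b g -> acl a b (fun x => f x + g x).
Proof.
move=> acf acg e e0.
have [d1 d10 H1] := acf (e / 2) ltac:(by rewrite divr_gt0).
have [d2 d20 H2] := acg (e / 2) ltac:(by rewrite divr_gt0).
exists (Num.min d1 d2) => [|L L1 L2]; first by rewrite lt_min d10.
rewrite lt_min => /andP[/(H1 _ L1 L2) h1 /(H2 _ L1 L2) h2].
rewrite [e]splitr; apply: le_lt_trans (ltrD h1 h2).
rewrite -big_split/=; apply: ler_sum => p _.
by rewrite opprD addrACA; exact: ler_normD.
Qed.

Lemma aclN a b f : acl a b f -> acl a b (fun x => - f x).
Proof.
move=> acf e /acf[d d0 H]; exists d => // L L1 L2 L3.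
rewrite (eq_bigr (fun p => `|f p.2 - f p.1|)); first exact: H.
by move=> p _; rewrite -opprD normrN.
Qed.

Lemma acl_dist a b f : acl a b f -> forall e, 0 < e -> exists2 d, 0 < d &
  forall x y, a <= x -> y <= b -> x <= y -> y - x < d -> `|f y - f x| < e.
Proof.
move=> acf e /acf[d d0 H]; exists d => // x y ax yb xy xyd.
have := H [:: (x, y)]; rewrite /= !big_seq1/= /subitv/= ax xy yb; exact.
Qed.

Lemma acl_continuous a b f : a < b -> acl a b f ->
  {within `[a, b], continuous f}.
Proof.
move=> ab acf; apply/continuous_within_itvP => //; split.
- move=> x; rewrite in_itv/= => /andP[ax xb].
  apply/cvgrPdist_lt => e /(acl_dist acf)[d d0 H].
  near=> t.
  have at_ : a < t by near: t; exact: lt_nbhsr.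
  have tb : t < b by near: t; exact: lt_nbhsl.
  have xtd : `|x - t| < d by near: t; exact: cvgr_dist_lt.
  case: (leP t x) => tx.
    apply: H => //; [exact: ltW|exact: ltW|].
    by rewrite (le_lt_trans (ler_norm _)).
  rewrite distrC; apply: H => //; [exact: ltW|exact: ltW|exact: ltW|].
  by rewrite (le_lt_trans (ler_norm _))// distrC.
- apply/cvgrPdist_lt => e /(acl_dist acf)[d d0 H].
  near=> t; rewrite distrC; apply: H => //.
  + near: t; exact: nbhs_right_le.
  + rewrite ltrBlDl; near: t; apply: nbhs_right_lt; lra.
- apply/cvgrPdist_lt => e /(acl_dist acf)[d d0 H].
  near=> t; apply: H => //.
  + near: t; exact: nbhs_left_ge.
  + rewrite ltrBlDl -ltrBlDr; near: t; apply: nbhs_left_gt; lra.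
Unshelve. all: by end_near. Qed.

(** Turns the partitions behind [variation] into interval lists, to which [acl] applies. *)
Lemma itv_partition_pairs x y f s : itv_partition x y s ->
  exists L, [/\ all (subitv x y) L, pairwise noverlap L,
    \sum_(p <- L) (p.2 - p.1) = y - x &
    \sum_(p <- L) `|f p.2 - f p.1| = variation x y f s].
Proof.
elim: s x => [x /itv_partition_nil<-|h s ih x xs].
  by exists [::]; rewrite !big_nil subrr variation_nil.
have hs := itv_partition_cons xs.
have [xh _] : x < h /\ True by case: xs => /andP[].
have hy := itv_partition_le hs.
have [L [L1 L2 L3 L4]] := ih _ hs.
exists ((x, h) :: L); split => /=.
- rewrite /subitv lexx (ltW xh) hy/=; apply: sub_all L1 => p /and3P[? ? ?].
  by apply/and3P; split => //; rewrite (le_trans (ltW xh)).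
- rewrite L2 andbT; apply: sub_all L1 => p /and3P[? ? ?].
  by rewrite /noverlap/=; apply/orP; left.
- by rewrite big_cons L3/=; lra.
- rewrite big_cons L4/=.
  rewrite (variation_zip _ xs) (variation_zip _ hs)/= big_cons//=.
Qed.

Local Notation TV := total_variation.

(** Absolute continuity with e = 1 bounds the variation by 1 on intervals shorter than d; finitely
    many steps of length d / 2 exhaust [a, b]. *)
Lemma acl_bounded_variation a b f : a <= b -> acl a b f ->
  bounded_variation a b f.
Proof.
move=> ab acf; have [d d0 H] := acf 1 ltr01.
have short x y : a <= x -> x <= y -> y <= b -> y - x < d ->
    TV x y f \is a fin_num.
  move=> ax xy yb xyd; apply/bounded_variationP => //.
  exists 1 => _ [s xys <-].
  have [L [L1 L2 L3 <-]] := itv_partition_pairs f xys.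
  apply/ltW/H => //; last by rewrite L3.
  apply: sub_all L1 => p /and3P[? ? ?].
  by apply/and3P; split => //; [exact: le_trans ax _|exact: le_trans yb].
have long k x : a <= x -> x <= b -> x - a < (d / 2) *+ k.+1 ->
    TV a x f \is a fin_num.
  elim: k x => [|k ih] x ax xb xk.
    by apply: short => //; rewrite mulr1n in xk; lra.
  have [|xd] := leP x (a + d / 2); first by move=> ?; apply: short => //; lra.
  rewrite (@total_variationD _ a x (x - d / 2))//; [|lra|lra].
  rewrite fin_numD ih//=; [|lra|lra|by move: xk; rewrite mulrS; lra].
  by apply: short => //; lra.
apply/bounded_variationP => //.
apply: (long (Num.truncn ((b - a) / (d / 2)))) => //.
rewrite -mulr_natl -ltr_pdivrMr; last by lra.
by apply: truncnS_gt.
Qed.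

(** Each given interval is replaced by a partition whose variation nearly attains the total one.
    This changes no total length, so the modulus of [f] for e / 2 can be used. *)
Lemma acl_total_variation a b f : a <= b -> acl a b f ->
  acl a b (fun x => fine (TV a x f)).
Proof.
move=> ab acf e e0.
have [d d0 H] := acf (e / 2) ltac:(by rewrite divr_gt0).
exists d => // L L1 L2 L3.
have bvf := acl_bounded_variation ab acf.
have TVfin x y : a <= x -> x <= y -> y <= b -> TV x y f \is a fin_num.
  move=> ax xy yb; apply/bounded_variationP => //.
  by apply: (bounded_variationl xy yb); apply: bounded_variationr ax _ bvf; lra.
pose n := size L.
(* The remaining e / 2 is shared among the intervals; the divisor n + 1 is nonzero also for the
   empty list. The last conjunct below, that each new interval sits inside an old one, is what keeps
   the concatenated list free of overlaps. *)
have r0 : 0 < e / 2 / n.+1%:R by rewrite !divr_gt0.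
have [M [M1 M2 M3 M4 _]] : exists M, [/\ all (subitv a b) M,
    pairwise noverlap M, \sum_(p <- M) (p.2 - p.1) = \sum_(p <- L) (p.2 - p.1),
    \sum_(p <- L) `|fine (TV a p.2 f) - fine (TV a p.1 f)| <=
      \sum_(p <- M) `|f p.2 - f p.1| + (e / 2 / n.+1%:R) *+ size L &
    forall q, q \in M -> exists2 p, p \in L & subitv p.1 p.2 q].
  move: (e / 2 / _) r0 => r r0.
  elim: L L1 L2 {L3 n} => [_ _|p L ih].
    by exists [::]; rewrite !big_nil mulr0n addr0.
  move=> /= /andP[/and3P[ap pp pb] L1] /andP[pL L2].
  have [M [M1 M2 M3 M4 M5]] := ih L1 L2.
  have TVp := TVfin _ _ ap pp pb.
  have [s ps sr] : exists2 s, itv_partition p.1 p.2 s &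
      fine (TV p.1 p.2 f) - r < variation p.1 p.2 f s.
    have : ((fine (TV p.1 p.2 f) - r)%:E < TV p.1 p.2 f)%E.
      by rewrite -[ltRHS]fineK// lte_fin ltrBlDr ltrDl.
    by move=> /ereal_sup_gt[_ [_ [s ps <-] <-]]; rewrite lte_fin => ?; exists s.
  have [P [P1 P2 P3 P4]] := itv_partition_pairs f ps.
  exists (P ++ M); split.
  - rewrite all_cat M1 andbT; apply: sub_all P1 => q /and3P[? ? ?].
    by apply/and3P; split; [exact: le_trans ap _| |exact: le_trans pb].
  - rewrite pairwise_cat P2 M2/= andbT; apply/allrelP => u v uP /M5[w wL].
    move/and3P => [w1 _ w2]; move/allP: P1 => /(_ _ uP)/and3P[u1 _ u2].
    move/allP: pL => /(_ _ wL) /orP[h|h]; apply/orP; [left|right].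
      exact: le_trans u2 (le_trans h w1).
    exact: le_trans w2 (le_trans h u1).
  - by rewrite big_cat/= big_cons P3 M3.
  - rewrite big_cat/= big_cons P4.
    have -> : `|fine (TV a p.2 f) - fine (TV a p.1 f)| = fine (TV p.1 p.2 f).
      rewrite (total_variationD f ap pp) fineD//; last first.
        by apply: TVfin => //; lra.
      rewrite addrC addKr ger0_norm// fine_ge0// total_variation_ge0//.
    by rewrite mulrS; lra.
  - move=> q; rewrite mem_cat => /orP[qP|/M5[w wL ?]].
      by exists p; [rewrite inE eqxx|move/allP: P1 => /(_ _ qP)].
    by exists w => //; rewrite inE wL orbT.
have := H M M1 M2; rewrite M3 => /(_ L3) He.
apply: le_lt_trans M4 _.
have : (e / 2 / n.+1%:R) *+ n <= e / 2.
  rewrite -mulr_natl mulrCA ler_piMr//; first lra.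
  by rewrite ler_pdivrMr// mul1r ler_nat.
by rewrite -/n; move: (_ *+ n) => w; lra.
Qed.

End AbsoluteContinuity.

(** * Densities of Stieltjes measures of absolutely continuous functions *)

Section AbsoluteContinuityFTC.
Context {R : realType}.
Notation mu := (@lebesgue_measure R).
Implicit Types (a b x y e : R) (f F : R -> R).

Let pt a b n k : R := a + (b - a) / n.+1%:R * k%:R.

Let pt_le a b n k l : a < b -> (k <= l)%N -> pt a b n k <= pt a b n l.
Proof.
move=> ab kl; rewrite lerD2l ler_wpM2l ?ler_nat//.
by rewrite divr_ge0// subr_ge0 ltW.
Qed.

Let pt0 a b n : pt a b n 0 = a. Proof. by rewrite /pt mulr0 addr0. Qed.

Let ptS a b n : pt a b n n.+1 = b.
Proof. by rewrite /pt divfK// addrC subrK. Qed.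

Let cell a b n k : set R := `]pt a b n k, pt a b n k.+1]%classic.

Let icell (U : set R) a b n k : set R :=
  if `[< cell a b n k `<=` U >] && (k < n.+1)%N then cell a b n k else set0.

Let icells U a b n : set R := \big[setU/set0]_(k < n.+1) icell U a b n k.

Let icells_sub U a b n : icells U a b n `<=` U.
Proof.
rewrite /icells => x; rewrite -bigcup_mkord => -[k _].
by rewrite /icell; case: asboolP => //= + ; case: ifP => // _ h /h.
Qed.

Let measurable_icell U a b n k : measurable (icell U a b n k).
Proof. by rewrite /icell; case: ifP => _ //; exact: measurable_itv. Qed.

Let measurable_icells U a b n : measurable (icells U a b n).
Proof. by apply: bigsetU_measurable => i _; exact: measurable_icell. Qed.

Let trivIset_icell U a b n : a < b -> trivIset setT (icell U a b n).
Proof.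
move=> ab; apply/trivIsetP => i j _ _; wlog ij : i j / (i < j)%N.
  move=> W; rewrite neq_ltn => /orP[ij|ji].
    by apply: W => //; rewrite neq_ltn ij.
  by rewrite setIC; apply: W => //; rewrite neq_ltn ji.
move=> _; rewrite -subset0 => x []; rewrite /icell.
do 2 case: ifP => // _; rewrite /cell/= !in_itv/= => /andP[_ xi] /andP[jx _].
by have := le_lt_trans (le_trans xi (pt_le n ab ij)) jx; rewrite ltxx.
Qed.

(** Once the mesh is smaller than the radius of a ball around [x] inside [U], the cell of [x] is
    contained in [U]. Cells are open on the left, whence a < x. *)
Let icellsP U a b x : a < b -> open U -> U x -> a < x <= b ->
  exists n0, forall n, (n0 <= n)%N -> icells U a b n x.
Proof.
move=> ab oU Ux /andP[ax xb].
have /nbhs_ballP[r /= r0 rU] : nbhs x U by exact: open_nbhs_nbhs.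
exists (Num.truncn ((b - a) / r)) => n n0n.
have hr : (b - a) / n.+1%:R < r.
  rewrite ltr_pdivrMr ?ltr0n// mulrC -ltr_pdivrMr//.
  by rewrite (lt_le_trans (truncnS_gt _))// ler_nat.
pose P k := x <= pt a b n k.+1.
have exP : exists k, P k by exists n; rewrite /P ptS.
case: (ex_minnP exP) => k Pk kmin.
have kx : pt a b n k < x.
  case: k {Pk} kmin => [|k] kmin; first by rewrite pt0.
  by rewrite ltNge; apply/negP => /kmin; rewrite ltnn.
have kn : (k < n.+1)%N by rewrite ltnS; apply: kmin; rewrite /P ptS.
rewrite /icells -bigcup_mkord; exists k => //=.
rewrite /icell kn andbT; case: asboolP => [_|[]].
  by rewrite /cell/= in_itv/= kx.
move=> y; rewrite /cell/= in_itv/= => /andP[ky yk]; apply: rU.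
move: hr Pk ky yk kx; rewrite /P /pt /ball/= -(natr1 k).
set h := (b - a) / n.+1%:R; rewrite mulrDr mulr1.
by move: (h * _) => u *; rewrite ltr_norml; lra.
Qed.

Lemma stieltjes_itv_oc (c : cumulative R R) x y : x <= y ->
  lebesgue_stieltjes_measure c `]x, y]%classic = (c y - c x)%:E.
Proof.
move=> xy; rewrite /lebesgue_stieltjes_measure /measure_extension.
by rewrite measurable_mu_extE/=; [exact: wlength_itv_bnd|exact: is_ocitv].
Qed.

(* An open set is exhausted by the grid cells it contains, and there absolute
   continuity applies; covering a null set by small open sets then gives
   dominated convergence of the two measures. *)
Lemma stieltjes_dominates (c : cumulative R R) a b (A : set R) : a < b ->
  acl a b c -> measurable A -> mu A = 0 ->
  lebesgue_stieltjes_measure c (A `&` `]a, b]%classic) = 0.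
Proof.
move=> ab acc mA A0; set nu := lebesgue_stieltjes_measure c.
have mD : measurable (A `&` `]a, b]%classic) by exact: measurableI.
have D0 : mu (A `&` `]a, b]) = 0.
  by apply/eqP; rewrite -measure_le0 -A0 le_measure ?inE//; exact: subIsetl.
suff H e : 0 < e -> (nu (A `&` `]a, b]) <= e%:E)%E.
  apply/eqP; rewrite -measure_le0; apply/lee_addgt0Pr => e e0.
  by rewrite add0e; exact: H.
move=> /acc[d d0 {}acc].
have D0lt : (mu (A `&` `]a, b]%classic) < +oo)%E by rewrite D0.
have [U [oU DU Ud]] := lebesgue_regularity_outer mD D0lt d0.
have {}Ud : (mu U < d%:E)%E.
  rewrite -[X in (mu X < _)%E](setDUK DU).
  apply: le_lt_trans (measureU2 _ _ _) _ => //.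
    by apply: measurableD => //; exact: open_measurable.
  by rewrite [X in (X + _)%E](_ : _ = 0)%E ?add0e; [exact: Ud|exact: D0].
(* Stated for any cumulative function because it is used twice: with [c] for [nu], and with the
   identity, whose Stieltjes measure is Lebesgue measure, to bound the total length of the cells. *)
have cellsE (k : cumulative R R) n :
    lebesgue_stieltjes_measure k (icells U a b n) =
    (\sum_(i <- iota 0 n.+1 | `[< cell a b n i `<=` U >])
       (k (pt a b n i.+1) - k (pt a b n i)))%:E.
  rewrite /icells measure_bigsetU;
    [|move=> i; exact: measurable_icell|exact: trivIset_icell].
  rewrite -(big_mkord xpredT (fun i => lebesgue_stieltjes_measure k (icell U a b n i))).
  rewrite /index_iota subn0 -sumEFin [RHS]big_mkcond !big_seq.
  apply: eq_bigr => i; rewrite mem_iota add0n => /andP[_ iN].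
  rewrite /icell iN andbT; case: ifP => _; last exact: measure0.
  by rewrite stieltjes_itv_oc//; apply: pt_le.
pose L n := [seq (pt a b n i, pt a b n i.+1) | i <- iota 0 n.+1
               & `[< cell a b n i `<=` U >]].
have nuV n : (nu (icells U a b n) <= e%:E)%E.
  rewrite /nu cellsE lee_fin.
  have -> : \sum_(i <- iota 0 n.+1 | `[< cell a b n i `<=` U >])
       (c (pt a b n i.+1) - c (pt a b n i)) =
       \sum_(p <- L n) `|c p.2 - c p.1|.
    rewrite big_map big_filter; apply: eq_bigr => i _ /=.
    rewrite ger0_norm// subr_ge0; apply: cumulative_is_nondecreasing.
    exact: pt_le.
  apply/ltW/acc.
  - apply/allP => _ /mapP[i + ->]; rewrite mem_filter mem_iota => /andP[_].
    rewrite add0n => /andP[_ iN]; apply/and3P; split => /=.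
    + by rewrite -[leLHS](pt0 a b n); exact: pt_le.
    + exact: pt_le.
    + by rewrite -[leRHS](ptS a b n); exact: pt_le.
  - rewrite pairwise_map.
    have : pairwise ltn [seq i <- iota 0 n.+1 | `[< cell a b n i `<=` U >]].
      rewrite -sorted_pairwise; last exact: ltn_trans.
      by apply: sorted_filter; [exact: ltn_trans|exact: iota_ltn_sorted].
    by apply: sub_pairwise => i j ij; rewrite /noverlap/= pt_le.
  - rewrite big_map big_filter/= -lte_fin.
    by rewrite -(cellsE idfun n); apply: le_lt_trans Ud; apply: le_measure;
      rewrite ?inE//; [exact: measurable_icells|
        exact: open_measurable].
(* The grids are not nested, so the sets [icells] need not increase with n. The points covered from
   stage [m] on do form an increasing sequence, and continuity from below applies to it. *)
pose W m := \bigcap_(n in [set n | (m <= n)%N]) icells U a b n.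
have mV n : measurable (icells U a b n) by exact: measurable_icells.
have mW m : measurable (W m).
  apply: bigcap_measurable => //.
  by exists m => /=.
have mWU : measurable (\bigcup_m W m) by apply: bigcup_measurable.
apply: (@le_trans _ _ (nu (\bigcup_m W m))).
  apply: le_measure; rewrite ?inE// => x Dx.
  have [n0 n0P] : exists n0, forall n, (n0 <= n)%N -> icells U a b n x.
    apply: icellsP => //; first exact: DU.
    by case: Dx => _ /=; rewrite in_itv.
  by exists n0 => // n; exact: n0P.
have Wcv : (nu \o W) n @[n --> \oo] --> nu (\bigcup_m W m).
  apply: nondecreasing_cvg_mu => // m k mk; apply/subsetPset => x Wx n kn.
  exact/Wx/(leq_trans mk).
rewrite -(cvg_lim _ Wcv)//; apply: lime_le; first by apply/cvg_ex; eexists; exact: Wcv.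
apply: nearW => m; apply: le_trans (nuV m).
apply: le_measure; rewrite ?inE; [exact: mW|exact: mV|].
by move=> x /(_ m); apply => /=.
Qed.

(** Composition with [clamp] extends a function constantly beyond [a, b], giving the cumulative
    function on the whole line that a Stieltjes measure requires. *)
Let clamp a b x : R := Num.max a (Num.min x b).

Lemma nondecreasing_acl_integral a b F : a < b ->
  {in `[a, b] &, nondecreasing_fun F} -> acl a b F ->
  exists2 g : R -> R, mu.-integrable setT (EFin \o g) &
    forall t, a <= t <= b -> F t = F a + \int[mu]_(s in `[a, t]) g s.
Proof.
move=> ab ndF acF; pose G x := F (clamp a b x).
have cab x : clamp a b x \in `[a, b].
  by rewrite in_itv/= /clamp le_max lexx/= ge_max (ltW ab)/= ge_min lexx orbT.
have cE x : a <= x <= b -> clamp a b x = x.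
  by move=> /andP[ax xb]; rewrite /clamp min_l// max_r.
have GE x : a <= x <= b -> G x = F x by move=> /cE; rewrite /G => ->.
have ndc : {homo clamp a b : x y / x <= y}.
  by move=> x y xy; rewrite /clamp le_max2// le_min2.
have ndG : nondecreasing_fun G by move=> x y xy; apply: ndF => //; exact: ndc.
have clip x y : x <= y -> clamp a b y - clamp a b x <= y - x.
  move=> xy; rewrite /clamp /Num.max /Num.min.
  by do !case: ifPn; rewrite -?leNgt => *; lra.
have rcG : right_continuous G.
  apply/right_continuousW => x; apply/cvgrPdist_lt => e /(acl_dist acF)[d d0 H].
  near=> t; have xtd : `|x - t| < d by near: t; exact: cvgr_dist_lt.
  have := cab x; have := cab t; rewrite !in_itv/= => /andP[t1 t2] /andP[x1 x2].
  case: (leP t x) => tx.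
    apply: H => //; first exact: ndc.
    by apply: le_lt_trans (clip _ _ tx) _; rewrite (le_lt_trans (ler_norm _)).
  rewrite distrC; apply: H => //; first exact/ndc/ltW.
  apply: le_lt_trans (clip _ _ (ltW tx)) _.
  by rewrite (le_lt_trans (ler_norm _))// distrC.
pose c : cumulative R R := HB.pack G (isCumulative.Build R _ R G ndG rcG).
have acG : acl a b c.
  move=> e /acF[d d0 H]; exists d => // L L1 L2 L3.
  rewrite (_ : \sum_(p <- L) _ = \sum_(p <- L) `|F p.2 - F p.1|); first exact: H.
  rewrite !big_seq; apply: eq_bigr => p /(allP L1)/and3P[? ? ?].
  by rewrite -[c p.2]/(G p.2) -[c p.1]/(G p.1) !GE//; apply/andP; split => //; lra.
pose nu := lebesgue_stieltjes_measure c.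
have mD : measurable (`]a, b]%classic : set R) by exact: measurable_itv.
have nuD : (nu `]a, b]%classic < +oo)%E.
  by rewrite /nu stieltjes_itv_oc ?ltry// ltW.
have [|g [g0 gfin gint nuE]] := @radon_nikodym_sigma_finite _ _ R mu
    (@mfrestr _ (measurableTypeR R) R _ nu mD nuD).
  apply/null_content_dominatesP => A mA A0; rewrite /mfrestr /mrestr.
  exact: stieltjes_dominates.
have fgint : mu.-integrable setT (EFin \o (fine \o g)).
  by apply: eq_integrable gint => // x _; rewrite /= fineK.
exists (fine \o g) => //.
move=> t /andP[at_ tb].
have mt : measurable (`]a, t]%classic : set R) by exact: measurable_itv.
have E : (`]a, t] `&` `]a, b] = `]a, t] :> set R)%classic.
  apply/seteqP; split => x /=; rewrite !in_itv/=; first by case.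
  by move=> /andP[-> xt]; rewrite xt (le_trans xt tb).
have h : (c t - c a)%:E = (\int[mu]_(x in `]a, t]) g x)%E.
  rewrite -nuE// -stieltjes_itv_oc// /mfrestr /mrestr.
  by congr (nu _); rewrite -[LHS]E.
rewrite -Rintegral_itv_obnd_cbnd; last first.
  by apply: integrableS fgint.
rewrite /Rintegral (eq_integral g); last by move=> x _; rewrite /= fineK.
rewrite -h -[fine _]/(G t - G a) !GE ?lexx ?at_ ?(ltW ab)//.
by rewrite addrC subrK.
Unshelve. all: by end_near. Qed.

End AbsoluteContinuityFTC.

(** * The fundamental theorem of calculus for absolutely continuous functions *)

Section FundamentalTheorem.
Context {R : realType}.
Notation mu := (@lebesgue_measure R).
Implicit Types (a b x y e : R) (f g : R -> R).

(** Jordan decomposition f = T - (T - f) with T the total variation: both terms are nondecreasing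
    and absolutely continuous. *)
Lemma acl_integral a b f : a < b -> acl a b f ->
  exists2 g : R -> R, mu.-integrable setT (EFin \o g) &
    forall t, a <= t <= b -> f t = f a + \int[mu]_(s in `[a, t]) g s.
Proof.
move=> ab acf; pose T x := fine (total_variation a x f).
have bvf := acl_bounded_variation (ltW ab) acf.
have TVfin x y : a <= x -> x <= y -> y <= b ->
    total_variation x y f \is a fin_num.
  move=> ax xy yb; apply/bounded_variationP => //.
  by apply: (bounded_variationl xy yb); apply: bounded_variationr ax _ bvf; lra.
have TB x y : a <= x -> x <= y -> y <= b -> `|f y - f x| <= T y - T x.
  move=> ax xy yb; rewrite /T (total_variationD f ax xy) fineD; last 2 first.
  - by apply: TVfin => //; exact: le_trans yb.
  - exact: TVfin.
  rewrite addrAC subrr add0r -lee_fin fineK; first exact: total_variation_ge.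
  exact: TVfin.
have acT : acl a b T := acl_total_variation (ltW ab) acf.
have [|g1 ig1 E1] := nondecreasing_acl_integral ab _ acT.
  move=> x y; rewrite !in_itv/= => /andP[ax _] /andP[_ yb] xy.
  by rewrite -subr_ge0; apply: le_trans (TB _ _ ax xy yb).
have [|g2 ig2 E2] := nondecreasing_acl_integral ab _ (aclD acT (aclN acf)).
  move=> x y; rewrite !in_itv/= => /andP[ax _] /andP[_ yb] xy.
  by have := TB _ _ ax xy yb; rewrite ler_norml => /andP[_]; lra.
exists (fun x => g1 x - g2 x).
  rewrite (_ : _ \o _ = (EFin \o g1) \- (EFin \o g2))%E; first exact: integrableB.
  by apply/funext => x /=; rewrite EFinB.
move=> t atb; rewrite RintegralB//; [|exact: (integrableS measurableT)..].
by have := E1 _ atb; have := E2 _ atb; rewrite /=; lra.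
Qed.

Lemma ae_in_oo a b (P : R -> Prop) :
  {ae mu, forall t, a < t < b -> P t} ->
  {ae mu, forall t, `[a, b]%classic t -> P t}.
Proof.
have ae1 x : {ae mu, forall t : R, t <> x}.
  exists [set x]; split; [exact: measurable_set1|exact: lebesgue_measure_set1|].
  by move=> t /= /contrapT.
have := ae1 b; have := ae1 a; apply: filterS3; first exact: (ae_filter_ringOfSetsType mu).
move=> t ta tb tP /=.
rewrite in_itv/= => /andP[at_ tb']; apply: tP.
by rewrite !lt_neqAle at_ tb' !andbT eq_sym; apply/andP; split; apply/eqP.
Qed.

(** Lebesgue differentiation gives the derivative of the primitive. It transfers to [f] at interior
    points, where a neighbourhood stays inside [a, b]; the two endpoints are a null set. *)
Lemma acl_derive1 a b f : a < b -> acl a b f ->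
  exists g : R -> R, [/\ mu.-integrable setT (EFin \o g),
    forall t, a <= t <= b -> f t = f a + \int[mu]_(s in `[a, t]) g s &
    {ae mu, forall t, `[a, b]%classic t -> derive1 f t = g t}].
Proof.
move=> ab /(acl_integral ab)[g ig E]; exists g; split => //.
have igS y : mu.-integrable `[a, y] (EFin \o g) by apply: integrableS ig.
have := FTC1 igS (open_integrable_locally openT ig).
move=> FTC; apply: ae_in_oo; move: FTC.
apply: filterS; first exact: (ae_filter_ringOfSetsType mu).
move=> t H /andP[at_ tb].
have [dF <-] := H at_.
have -> : derive1 f t = derive1 (fun x => f a + \int[mu]_(s in `[a, x]) g s) t.
  rewrite !derive1E; apply: near_eq_derive; near=> x; apply: E; apply/andP; split.
    by apply: ltW; near: x; exact: lt_nbhsr.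
  by apply: ltW; near: x; exact: lt_nbhsl.
rewrite !derive1E deriveD// ?derive_cst ?add0r//.
Unshelve. all: by end_near. Qed.

(** On a bounded interval |f| is dominated by the integrable function f^2 + 1. *)
Lemma L2_integrable a b f : L2 a b f ->
  mu.-integrable `[a, b] (EFin \o f).
Proof.
move=> [mf f2].
have i1 : mu.-integrable `[a, b] (fun=> 1%E : \bar R).
  apply/integrableP; split; first exact: measurable_cst.
  under eq_integral do rewrite gee0_abs//.
  rewrite integral_cst//= mul1e lebesgue_measure_itv/=.
  by case: ifP => _; rewrite ?ltry// -EFinB ltry.
apply: (le_integrable _ _ _ (integrableD _ f2 i1)) => //.
  exact/measurable_EFinP.
move=> x _ /=; rewrite lee_fin [leRHS]ger0_norm; last first.
  by rewrite addr_ge0// sqr_ge0.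
rewrite -real_normK ?num_real//; move: `|f x| (normr_ge0 (f x)) => u u0.
nra.
Qed.

Lemma H1_integral a b f : a < b -> H1 a b f ->
  forall t, a <= t <= b -> f t = f a + \int[mu]_(s in `[a, t]) derive1 f s.
Proof.
move=> ab [/abs_continuous_acl/(acl_derive1 ab)[g [ig E fg]] L2f] t /andP[at_ tb].
rewrite E ?at_//; congr +%R; rewrite /Rintegral; congr fine.
have sub : `[a, t]%classic `<=` (`[a, b]%classic : set R).
  by move=> s /=; rewrite !in_itv/= => /andP[-> st]; rewrite (le_trans st).
apply: ae_eq_integral => //.
- by apply: measurable_funTS; exact: measurable_int ig.
- by apply: measurable_funS (measurable_int _ (L2_integrable L2f)).
- move: fg; apply: filterS; first exact: (ae_filter_ringOfSetsType mu).
  by move=> s H /sub/H ->.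
Qed.

End FundamentalTheorem.

(** * Gram matrices of the data operators *)

Section IntegrationByParts.
Context {R : realType}.
Notation mu := (@lebesgue_measure R).
Implicit Types (a b x y e : R) (f g : R -> R).

Let tri (A B : R -> R) (z : R * R) : \bar R :=
  (if z.1 <= z.2 then A z.1 * B z.2 else 0)%:E.

Let tri_integrable (A B : R -> R) :
  mu.-integrable setT (EFin \o A) -> mu.-integrable setT (EFin \o B) ->
  (mu \x mu)%E.-integrable setT (tri A B).
Proof.
move=> iA iB.
have mA : measurable_fun setT A by apply/measurable_EFinP; exact: measurable_int iA.
have mB : measurable_fun setT B by apply/measurable_EFinP; exact: measurable_int iB.
have mT : measurable_fun setT (tri A B).
  apply/measurable_EFinP; apply: measurable_fun_ifT => //.
    by apply: measurable_fun_ler; [exact: measurable_fst|exact: measurable_snd].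
  apply: measurable_funM.
    by apply: measurableT_comp => //; exact: measurable_fst.
  by apply: measurableT_comp => //; exact: measurable_snd.
apply/integrable12ltyP => //.
pose I := (\int[mu]_t `|(EFin \o B) t|)%E.
have Ioo : (I < +oo)%E by case/integrableP: iB.
apply: (@le_lt_trans _ _ (\int[mu]_s (`|(EFin \o A) s| * I)))%E.
  apply: ge0_le_integral => //.
  - by move=> s _; exact: integral_ge0.
  - apply: (@measurable_fun_fubini_tonelli_F _ _ _ _ _ mu (abse \o tri A B)).
      exact/measurableT_comp.
    by move=> z; exact: abse_ge0.
  - apply: emeasurable_funM => //.
    by apply: measurableT_comp => //; exact/measurable_EFinP.
  move=> s _; rewrite -ge0_integralZl//; last first.
    by apply: measurableT_comp => //; exact/measurable_EFinP.
  apply: ge0_le_integral => //.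
  - by apply: measurableT_comp => //; exact: measurableT_comp mT _.
  - apply: emeasurable_funM => //.
    by apply: measurableT_comp => //; exact/measurable_EFinP.
  move=> t _; rewrite /tri/= lee_fin -normrM; case: ifP => // _.
  by rewrite normr0.
rewrite ge0_integralZr//; last 2 first.
- by apply: measurableT_comp => //; exact/measurable_EFinP.
- exact: integral_ge0.
apply: lte_mul_pinfty => //; first exact: integral_ge0.
by case/integrableP: iA => _ h; rewrite ge0_fin_numE//; exact: integral_ge0.
Qed.

(** Fubini's theorem for f(s) g(t) on the triangle s <= t. It acts as integration by parts for
    primitives of merely integrable functions. *)
Lemma Rintegral_triangle a b f g :
  mu.-integrable `[a, b] (EFin \o f) -> mu.-integrable `[a, b] (EFin \o g) ->
  \int[mu]_(s in `[a, b]) (f s * \int[mu]_(t in `[s, b]) g t) =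
  \int[mu]_(t in `[a, b]) (g t * \int[mu]_(s in `[a, t]) f s).
Proof.
move=> fi gi; pose A := f \_ `[a, b]; pose B := g \_ `[a, b].
have iA : mu.-integrable setT (EFin \o A).
  by rewrite -restrict_EFin; apply/integrable_restrict => //=; rewrite setTI.
have iB : mu.-integrable setT (EFin \o B).
  by rewrite -restrict_EFin; apply/integrable_restrict => //=; rewrite setTI.
have E1 s : (\int[mu]_t tri A B (s, t) =
    ((fun s => f s * \int[mu]_(t in `[s, b]) g t) \_ `[a, b] s)%:E)%E.
  rewrite patchE; case: ifPn => sab; last first.
    rewrite (eq_integral (cst 0%E)) ?integral0// => t _; rewrite /tri/= /A patchE.
    by rewrite (negbTE sab) mul0r if_same.
  have gsi : mu.-integrable `[s, b] (EFin \o g).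
    apply: integrableS gi => // t /=; move: sab; rewrite inE/= !in_itv/=.
    by move=> /andP[as_ _] /andP[st ->]; rewrite (le_trans as_ st).
  transitivity (\int[mu]_t ((f s)%:E * ((EFin \o g) \_ `[s, b]) t))%E.
    apply: eq_integral => t _; rewrite /tri/= /A /B !patchE sab.
    move: sab; rewrite !inE/= !in_itv/= => /andP[as_ sb].
    rewrite /= !mem_setE !in_itv/=; case: (leP s t) => st/=; last by rewrite mule0.
    by rewrite (le_trans as_ st)/=; case: ifP => _; rewrite ?mulr0 ?mule0.
  rewrite integralZl//; last first.
    by apply/integrable_restrict => //; rewrite setTI.
  rewrite -integral_mkcond EFinM; congr (_ * _)%E.
  by rewrite /Rintegral fineK//; exact: integrable_fin_num.
have E2 t : (\int[mu]_s tri A B (s, t) =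
    ((fun t => g t * \int[mu]_(s in `[a, t]) f s) \_ `[a, b] t)%:E)%E.
  rewrite patchE; case: ifPn => tab; last first.
    rewrite (eq_integral (cst 0%E)) ?integral0// => s _; rewrite /tri/= /B patchE.
    by rewrite (negbTE tab) mulr0 if_same.
  have fti : mu.-integrable `[a, t] (EFin \o f).
    apply: integrableS fi => // s /=; move: tab; rewrite inE/= !in_itv/=.
    by move=> /andP[_ tb] /andP[-> st]; rewrite (le_trans st tb).
  transitivity (\int[mu]_s ((g t)%:E * ((EFin \o f) \_ `[a, t]) s))%E.
    apply: eq_integral => s _; rewrite /tri/= /A /B !patchE tab.
    move: tab; rewrite !inE/= !in_itv/= => /andP[at_ tb].
    rewrite /= !mem_setE !in_itv/=; case: (leP s t) => st/=; last first.
      by rewrite andbF mule0.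
    rewrite (le_trans st tb)/= !andbT.
    by case: ifP => _; rewrite ?mul0r ?mule0// mulrC.
  rewrite integralZl//; last first.
    by apply/integrable_restrict => //; rewrite setTI.
  rewrite -integral_mkcond EFinM; congr (_ * _)%E.
  by rewrite /Rintegral fineK//; exact: integrable_fin_num.
transitivity (fine (\int[mu]_s \int[mu]_t tri A B (s, t))%E).
  rewrite Rintegral_mkcond /Rintegral; congr fine.
  by apply: eq_integral => s _; rewrite E1.
rewrite (Fubini (tri_integrable iA iB)) Rintegral_mkcond /Rintegral; congr fine.
by apply: eq_integral => t _; rewrite E2.
Qed.

End IntegrationByParts.

(** * Riesz representers in H^1_0 *)

Section Representers.
Context {R : realType}.
Notation mu := (@lebesgue_measure R).
Implicit Types (a b tau x y e : R) (f g phi : R -> R).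

Definition antideriv f t : R := \int[mu]_(s in `[0, t]) f s.

(* The derivative of the representer in H^1_0 of phi |-> \int phi f: minus a
   primitive of f, of mean zero so that the representer vanishes at tau. *)
Definition rderiv tau f t : R :=
  tau^-1 * \int[mu]_(s in `[0, tau]) antideriv f s - antideriv f t.

Definition h10_repr tau f t : R :=
  if 0 <= t <= tau then \int[mu]_(s in `[0, t]) rderiv tau f s else 0.

Lemma within_continuous_integrable a b f : {within `[a, b], continuous f} ->
  mu.-integrable `[a, b] (EFin \o f).
Proof.
by move=> cf; apply: continuous_compact_integrable => //; exact: segment_compact.
Qed.

Lemma antideriv_continuous tau f : 0 <= tau -> mu.-integrable `[0, tau] (EFin \o f) ->
  {within `[0, tau], continuous (antideriv f)}.
Proof. by move=> t0 fi; exact: parameterized_integral_continuous. Qed.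

Lemma rderiv_continuous tau f : 0 <= tau -> mu.-integrable `[0, tau] (EFin \o f) ->
  {within `[0, tau], continuous (rderiv tau f)}.
Proof.
move=> t0 fi x; apply: cvgB; first exact: cvg_cst.
exact: antideriv_continuous.
Qed.

Lemma integral_rderiv tau f : 0 < tau -> mu.-integrable `[0, tau] (EFin \o f) ->
  \int[mu]_(s in `[0, tau]) rderiv tau f s = 0.
Proof.
move=> t0 fi; have t0' := ltW t0.
rewrite RintegralB//; last 2 first.
- apply: within_continuous_integrable => x; exact: cvg_cst.
- by apply: within_continuous_integrable; exact: antideriv_continuous.
rewrite Rintegral_cst//= lebesgue_measure_itv/= lte_fin t0 -EFinB/= subr0.
by rewrite mulrAC mulVf ?gt_eqF// mul1r subrr.
Qed.

Lemma h10_repr0 tau f : 0 < tau -> h10_repr tau f 0 = 0.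
Proof.
by move=> t0; rewrite /h10_repr lexx ltW//= set_itv1 Rintegral_set1.
Qed.

Lemma h10_repr_tau tau f : 0 < tau -> mu.-integrable `[0, tau] (EFin \o f) ->
  h10_repr tau f tau = 0.
Proof. by move=> t0 fi; rewrite /h10_repr lexx ltW//=; exact: integral_rderiv. Qed.

(** [rderiv] is continuous although [f] is only integrable, so the classical fundamental theorem
    applies at every interior point. *)
Lemma derive1_h10_repr tau f t : mu.-integrable `[0, tau] (EFin \o f) ->
  0 < t < tau -> derive1 (h10_repr tau f) t = rderiv tau f t.
Proof.
move=> fi /andP[t0 tt]; have tau0 : 0 < tau := lt_trans t0 tt.
have ci := rderiv_continuous (ltW tau0) fi.
have -> : derive1 (h10_repr tau f) t = derive1 (antideriv (rderiv tau f)) t.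
  rewrite !derive1E; apply: near_eq_derive; near=> x; rewrite /h10_repr ifT//.
  apply/andP; split.
    by apply: ltW; near: x; exact: lt_nbhsr.
  by apply: ltW; near: x; exact: lt_nbhsl.
have [] := @continuous_FTC1_closed _ (rderiv tau f) 0 t tau tt _ t0 => //.
  exact: within_continuous_integrable.
move: ci => /(continuous_within_itvP _ tau0)[+ _ _]; apply.
by rewrite in_itv/= t0.
Unshelve. all: by end_near. Qed.

Lemma within_continuous_bounded tau f : 0 < tau ->
  {within `[0, tau], continuous f} ->
  exists2 M, 0 < M & forall t, 0 <= t <= tau -> `|f t| <= M.
Proof.
move=> t0 cf.
have cn : {within `[0, tau], continuous (fun x => `|f x|)}.
  by move=> x; apply: cvg_norm; exact: cf.
have [c _ cM] := EVT_max (ltW t0) cn.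
exists (`|f c| + 1); first by rewrite ltr_wpDl.
by move=> t tt; rewrite (le_trans (cM _ _)) ?in_itv// lerDl.
Qed.

Lemma integrable_mul_continuous tau f h : 0 < tau ->
  mu.-integrable `[0, tau] (EFin \o f) -> {within `[0, tau], continuous h} ->
  mu.-integrable `[0, tau] (EFin \o (fun t => f t * h t)).
Proof.
move=> t0 fi ch; have [M M0 HM] := within_continuous_bounded t0 ch.
have mh := within_continuous_integrable ch.
have Mfi : mu.-integrable `[0, tau] (fun x => M%:E * (EFin \o f) x)%E.
  exact: integrableZl.
apply: le_integrable Mfi => //.
- apply/measurable_EFinP; apply: measurable_funM.
    by apply/measurable_EFinP; exact: measurable_int fi.
  by apply/measurable_EFinP; exact: measurable_int mh.
- move=> x; rewrite /= in_itv/= => /HM hx.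
  by rewrite lee_fin !normrM mulrC ler_wpM2r// (le_trans hx)// ler_norm.
Qed.

Lemma ae_eq_derive1_h10_repr tau f : mu.-integrable `[0, tau] (EFin \o f) ->
  {ae mu, forall t, `[0, tau]%classic t -> derive1 (h10_repr tau f) t = rderiv tau f t}.
Proof.
move=> fi; apply: ae_in_oo; apply: aeW => t /=; exact: derive1_h10_repr.
Qed.

Lemma measurable_itv_oo_cc a b f :
  measurable_fun `]a, b[ f -> measurable_fun `[a, b] f.
Proof.
move=> /measurable_fun_itv_obnd_cbndP mf; apply/measurable_fun_itv_bndo_bndcP.
exact: mf.
Qed.

Lemma measurable_derive1_h10_repr tau f : 0 < tau ->
  mu.-integrable `[0, tau] (EFin \o f) ->
  measurable_fun `[0, tau] (derive1 (h10_repr tau f)).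
Proof.
move=> t0 fi; apply: measurable_itv_oo_cc.
apply: (eq_measurable_fun (rderiv tau f)).
  by move=> t; rewrite inE/= in_itv/= => tt; rewrite derive1_h10_repr.
apply: (@measurable_funS _ _ _ _ `[0, tau]%classic) => //.
  exact: subset_itv_oo_cc.
have := within_continuous_integrable (rderiv_continuous (ltW t0) fi).
by move=> /measurable_int/measurable_EFinP.
Qed.

(** The derivative is bounded by some M, so the representer is Lipschitz on [0, tau] and d = e / M
    witnesses absolute continuity. *)
Lemma H10_h10_repr tau f : 0 < tau -> mu.-integrable `[0, tau] (EFin \o f) ->
  H10 0 tau (h10_repr tau f).
Proof.
move=> t0 fi; have cr := rderiv_continuous (ltW t0) fi.
have [M M0 HM] := within_continuous_bounded t0 cr.
split; [|exact: h10_repr0|exact: h10_repr_tau|]; last first.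
  by move=> t /=; rewrite /h10_repr in_itv/=; case: ifP.
split.
- move=> e e0; exists (e / M); first by rewrite divr_gt0.
  move=> l s t st _ sd; apply: (@le_lt_trans _ _ (\sum_i (t i - s i) * M)).
    apply: ler_sum => i _; have [si sti ti] := st i.
    have ri := within_continuous_integrable cr.
    rewrite /h10_repr !ifT; last 2 first.
    + by rewrite si (le_trans sti).
    + by rewrite ti (le_trans si).
    rewrite Rintegral_itvB ?bnd_simp//; last first.
      apply: integrableS ri => // x /=; rewrite !in_itv/= => /andP[-> xt].
      by rewrite (le_trans xt).
    have ri' : mu.-integrable `]s i, t i] (EFin \o rderiv tau f).
      apply: integrableS ri => // x /=; rewrite !in_itv/= => /andP[sx xt].
      by rewrite (le_trans xt ti) (le_trans si (ltW sx)).
    apply: le_trans (le_normr_Rintegral _ _) _ => //.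
    have -> : (t i - s i) * M = \int[mu]_(x in `]s i, t i]) M.
      rewrite Rintegral_cst//= lebesgue_measure_itv/= lte_fin.
      case: ltP => tsi /=; first by rewrite mulrC.
      by rewrite (@le_anti _ _ (s i) (t i)) ?sti// subrr mul0r mulr0.
    apply: le_Rintegral => //.
    + exact: (integrable_norm ri').
    + apply/integrableP; split; first exact: measurable_cst.
      under eq_integral do rewrite gee0_abs ?lee_fin ?ltW//.
      rewrite integral_cst//= lebesgue_measure_itv/=.
      by case: ifP => _; rewrite ?mule0 ?ltry// -EFinB -EFinM ltry.
    + move=> x /=; rewrite in_itv/= => /andP[sx xt]; apply: HM.
      by rewrite (le_trans xt ti) (le_trans si (ltW sx)).
  by rewrite -mulr_suml -ltr_pdivlMr.
- split; first exact: measurable_derive1_h10_repr.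
  have cr2 : {within `[0, tau], continuous (fun t => rderiv tau f t ^+ 2)}.
    rewrite (_ : (fun t => _) = (fun t => rderiv tau f t * rderiv tau f t)).
      by move=> x; apply: cvgM; exact: cr.
    by apply/funext => t; rewrite expr2.
  have := within_continuous_integrable cr2.
  move=> /integrableP[m2 i2]; apply/integrableP; split.
    apply/measurable_EFinP; apply: measurable_funX.
    exact: measurable_derive1_h10_repr.
  apply: le_lt_trans i2; rewrite le_eqVlt; apply/orP; left; apply/eqP.
  apply: ae_eq_integral => //.
  + apply: measurableT_comp => //; apply/measurable_EFinP.
    by apply: measurable_funX; exact: measurable_derive1_h10_repr.
  + by apply: measurableT_comp.
  + move: (ae_eq_derive1_h10_repr fi).
    apply: filterS; first exact: (ae_filter_ringOfSetsType mu).
    by move=> x H /H /= ->.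
Qed.

Lemma H10_measurable_derive1 tau phi : H10 0 tau phi ->
  measurable_fun `[0, tau] (derive1 phi).
Proof. by case=> -[_ []]. Qed.

Lemma H10_integrable_derive1 tau phi : H10 0 tau phi ->
  mu.-integrable `[0, tau] (EFin \o derive1 phi).
Proof. by case=> -[_ /L2_integrable]. Qed.

(** With phi written as the primitive of phi', exchanging integrals leaves phi' against the integral
    of f over [t, tau]. As phi' has mean zero, that factor may be shifted by any constant, in
    particular to [rderiv]. *)
Lemma H10_rderiv tau phi f : 0 < tau -> H10 0 tau phi ->
  mu.-integrable `[0, tau] (EFin \o f) ->
  \int[mu]_(t in `[0, tau]) (phi t * f t) =
  \int[mu]_(t in `[0, tau]) (derive1 phi t * rderiv tau f t).
Proof.
move=> t0 Hphi fi; have [H1phi p0 pt _] := Hphi.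
have phiE t : 0 <= t <= tau -> phi t = \int[mu]_(s in `[0, t]) derive1 phi s.
  by move=> /(H1_integral t0 H1phi) ->; rewrite p0 add0r.
have di := H10_integrable_derive1 Hphi.
have di0 : \int[mu]_(s in `[0, tau]) derive1 phi s = 0.
  by rewrite -phiE ?lexx ?ltW.
have bounded_mul (h : R -> R) : {within `[0, tau], continuous h} ->
    mu.-integrable `[0, tau] (EFin \o (fun t => derive1 phi t * h t)).
  exact: integrable_mul_continuous.
rewrite (@eq_Rintegral _ _ _ mu _ (fun t => f t * \int[mu]_(s in `[0, t]) derive1 phi s)).
  2: by move=> t; rewrite inE/= in_itv/= => /phiE ->; rewrite mulrC.
rewrite -Rintegral_triangle//.
rewrite (@eq_Rintegral _ _ _ mu _
  (fun t => derive1 phi t * (antideriv f tau - antideriv f t))); last first.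
  move=> t; rewrite inE/= in_itv/= => /andP[tge tle]; congr (_ * _).
  rewrite -Rintegral_itv_obnd_cbnd; last first.
    apply: integrableS fi => // x /=; rewrite !in_itv/= => /andP[tx ->].
    by rewrite andbT (le_trans tge (ltW tx)).
  by rewrite -(@Rintegral_itvB _ f (BLeft 0))// ?bnd_simp.
have cc (c : R) : {within `[0, tau], continuous (fun=> c)}.
  by move=> x; exact: cvg_cst.
have cp := antideriv_continuous (ltW t0) fi.
have key (c : R) : \int[mu]_(t in `[0, tau]) (derive1 phi t * (c - antideriv f t)) =
    (- \int[mu]_(t in `[0, tau]) (derive1 phi t * antideriv f t)).
  under eq_Rintegral do rewrite mulrBr.
  rewrite RintegralB//; [|exact: bounded_mul|exact: bounded_mul].
  by rewrite RintegralZr// di0 mul0r add0r.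
by rewrite key /rderiv key.
Qed.

Lemma H10_ip_h10_repr tau phi f : 0 < tau -> H10 0 tau phi ->
  mu.-integrable `[0, tau] (EFin \o f) ->
  ipH10 0 tau phi (h10_repr tau f) =
  \int[mu]_(t in `[0, tau]) (derive1 phi t * rderiv tau f t).
Proof.
move=> t0 Hphi fi; rewrite /ipH10 /Rintegral; congr fine.
apply: ae_eq_integral => //.
- apply/measurable_EFinP; apply: measurable_funM.
    exact: H10_measurable_derive1.
  exact: measurable_derive1_h10_repr.
- apply/measurable_EFinP; apply: measurable_funM.
    exact: H10_measurable_derive1.
  by apply/measurable_EFinP; apply: measurable_int;
    exact/within_continuous_integrable/rderiv_continuous/fi/ltW.
- move: (ae_eq_derive1_h10_repr fi).
  apply: filterS; first exact: (ae_filter_ringOfSetsType mu).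
  by move=> x H /H /= ->.
Qed.

Lemma ip_h10_repr tau f g : 0 < tau -> mu.-integrable `[0, tau] (EFin \o f) ->
  mu.-integrable `[0, tau] (EFin \o g) ->
  ipH10 0 tau (h10_repr tau f) (h10_repr tau g) =
  \int[mu]_(t in `[0, tau]) (rderiv tau f t * rderiv tau g t).
Proof.
move=> t0 fi gi; rewrite H10_ip_h10_repr//; last exact: H10_h10_repr.
rewrite /Rintegral; congr fine; apply: ae_eq_integral => //.
- apply/measurable_EFinP; apply: measurable_funM.
    exact: measurable_derive1_h10_repr.
  by apply/measurable_EFinP; apply: measurable_int;
    exact/within_continuous_integrable/rderiv_continuous/gi/ltW.
- apply/measurable_EFinP; apply: measurable_funM.
    by apply/measurable_EFinP; apply: measurable_int;
      exact/within_continuous_integrable/rderiv_continuous/fi/ltW.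
  by apply/measurable_EFinP; apply: measurable_int;
    exact/within_continuous_integrable/rderiv_continuous/gi/ltW.
- move: (ae_eq_derive1_h10_repr fi).
  apply: filterS; first exact: (ae_filter_ringOfSetsType mu).
  by move=> x H /H /= ->.
Qed.

(** Apply [H10_rderiv] to f': its primitive differs from [f] by the constant f(0), and constants
    integrate to zero against phi'. *)
Lemma H10_parts tau phi f : 0 < tau -> H10 0 tau phi -> H1 0 tau f ->
  (- \int[mu]_(t in `[0, tau]) (derive1 phi t * f t)) =
  \int[mu]_(t in `[0, tau]) (phi t * derive1 f t).
Proof.
move=> t0 Hphi Hf; have fi := L2_integrable Hf.2.
have ci := antideriv_continuous (ltW t0) fi.
have di := H10_integrable_derive1 Hphi.
have di0 : \int[mu]_(s in `[0, tau]) derive1 phi s = 0.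
  case: Hphi => H p0 pt _; have := @H1_integral _ 0 tau phi t0 H tau.
  by rewrite lexx ltW// p0 pt add0r => <-.
have im (c : R) : mu.-integrable `[0, tau] (EFin \o (fun t => derive1 phi t * c)).
  rewrite (_ : _ \o _ = fun x => (EFin \o derive1 phi) x * c%:E)%E.
    exact: integrableZr.
  by apply/funext => x /=; rewrite EFinM.
rewrite H10_rderiv// /rderiv.
set c := _^-1 * _.
have pfi : mu.-integrable `[0, tau]
    (EFin \o (fun t => derive1 phi t * antideriv (derive1 f) t)).
  exact: integrable_mul_continuous.
rewrite (@eq_Rintegral _ _ _ mu _
  (fun t => derive1 phi t * f 0 + derive1 phi t * antideriv (derive1 f) t)); last first.
  move=> t; rewrite inE/= in_itv/= => tt; rewrite -mulrDr; congr (_ * _).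
  exact: (H1_integral t0 Hf tt).
rewrite RintegralD//.
under [RHS]eq_Rintegral do rewrite mulrBr.
by rewrite RintegralB// !RintegralZr// di0 !mul0r add0r sub0r.
Qed.

End Representers.

(** * Products of operators and adjoints as Gram matrices of representers *)

Section Gramians.
Context {R : realType}.
Notation mu := (@lebesgue_measure R).
Local Notation L1 tau f := (mu.-integrable `[0, tau] (EFin \o f)).

Lemma integral_linear_comb (I : Type) (r : seq I) (c : I -> R) (f : I -> R -> R)
    a b : (forall i, mu.-integrable `[a, b] (EFin \o f i)) ->
  mu.-integrable `[a, b] (EFin \o (fun t => \sum_(i <- r) c i * f i t)) /\
  \int[mu]_(t in `[a, b]) (\sum_(i <- r) c i * f i t) =
  \sum_(i <- r) c i * \int[mu]_(t in `[a, b]) f i t.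
Proof.
move=> fi; elim: r => [|i r [ih1 ih2]].
  rewrite (_ : EFin \o _ = cst 0%E); last first.
    by apply/funext => t /=; rewrite big_nil.
  split; first exact: integrable0.
  under eq_Rintegral do rewrite big_nil.
  by rewrite big_nil Rintegral_cst// mul0r.
have ci : mu.-integrable `[a, b] (EFin \o (fun t => c i * f i t)).
  rewrite (_ : _ \o _ = fun x => (c i)%:E * (EFin \o f i) x)%E.
    exact: integrableZl.
  by apply/funext => t /=; rewrite EFinM.
split.
  rewrite (_ : _ \o _ = (EFin \o (fun t => (c i * f i t)%R)) \+
      (EFin \o (fun t => \sum_(j <- r) c j * f j t)%R))%E; last first.
    by apply/funext => t /=; rewrite big_cons EFinD.
  exact: integrableD.
under eq_Rintegral do rewrite big_cons.
by rewrite RintegralD// big_cons ih2 RintegralZl.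
Qed.

Lemma integrableSle tau t (f : R -> R) : t <= tau -> L1 tau f -> L1 t f.
Proof.
move=> tt; apply: integrableS => // s /=; rewrite !in_itv/= => /andP[-> st].
by rewrite (le_trans st tt).
Qed.

Lemma rderiv_linear_comb (I : Type) (r : seq I) (c : I -> R) (f : I -> R -> R)
    tau t : 0 <= t <= tau -> (forall i, L1 tau (f i)) ->
  rderiv tau (fun s => \sum_(i <- r) c i * f i s) t =
  \sum_(i <- r) c i * rderiv tau (f i) t.
Proof.
move=> /andP[t0 tt] fi.
have pE s : 0 <= s <= tau ->
    antideriv (fun s => \sum_(i <- r) c i * f i s) s =
    \sum_(i <- r) c i * antideriv (f i) s.
  move=> /andP[s0 st]; rewrite /antideriv.
  by have [] := @integral_linear_comb _ r c f 0 s (fun i => integrableSle st (fi i)).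
rewrite /rderiv pE; last by apply/andP.
rewrite (@eq_Rintegral _ _ _ mu _
  (fun s => \sum_(i <- r) c i * antideriv (f i) s)); last first.
  by move=> s; rewrite inE/= in_itv/= => /pE.
have [_ ->] := @integral_linear_comb _ r c (fun i => antideriv (f i)) 0 tau
  (fun i => within_continuous_integrable (antideriv_continuous (le_trans t0 tt) (fi i))).
rewrite mulr_sumr -sumrB; apply: eq_bigr => i _.
by rewrite mulrBr mulrCA.
Qed.

Lemma rderiv_ae (f g : R -> R) tau t : 0 <= t <= tau -> L1 tau f -> L1 tau g ->
  {ae mu, forall s, `[0, tau]%classic s -> f s = g s} ->
  rderiv tau f t = rderiv tau g t.
Proof.
move=> /andP[t0 tt] fi gi fg.
have pE s : 0 <= s <= tau -> antideriv f s = antideriv g s.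
  move=> /andP[s0 st]; rewrite /antideriv /Rintegral; congr fine.
  have fi' := measurable_int _ (integrableSle st fi).
  have gi' := measurable_int _ (integrableSle st gi).
  apply: ae_eq_integral => //.
  move: fg; apply: filterS; first exact: (ae_filter_ringOfSetsType mu).
  move=> x H; rewrite /= in_itv/= => /andP[x0 xs]; rewrite H//= in_itv/= x0.
  exact: le_trans st.
rewrite /rderiv pE; last by apply/andP.
suff -> : \int[mu]_(s in `[0, tau]) antideriv f s =
    \int[mu]_(s in `[0, tau]) antideriv g s by [].
by apply: eq_Rintegral => s; rewrite inE/= in_itv/= => /pE.
Qed.

Lemma rderiv_mul_integrable tau (f g : R -> R) : 0 < tau -> L1 tau f -> L1 tau g ->
  L1 tau (fun t => rderiv tau f t * rderiv tau g t).
Proof.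
move=> t0 fi gi; apply: integrable_mul_continuous => //.
  exact/within_continuous_integrable/rderiv_continuous/fi/ltW.
exact/rderiv_continuous/gi/ltW.
Qed.

(** Whatever element psi is chosen for the adjoint of S at the j-th basis vector, (T psi)_i = <psi,
    aT i> = <aT i, psi> = (S (aT i))_j = <aT i, aS j>. *)
Lemma mul_adjointE (V : pointedType) (H : set V) (ip : V -> V -> R) p q
    (T : V -> 'cV[R]_p) (S : V -> 'cV[R]_q) (aT : 'I_p -> V) (aS : 'I_q -> V) :
  (forall phi psi, ip phi psi = ip psi phi) ->
  (forall i, H (aT i)) -> (forall i, H (aS i)) ->
  (forall phi i, H phi -> T phi i 0 = ip phi (aT i)) ->
  (forall phi i, H phi -> S phi i 0 = ip phi (aS i)) ->
  mul_adjoint H ip T S = \matrix_(i, j) ip (aT i) (aS j).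
Proof.
move=> ipC HT HS TE SE; apply/matrixP => i j; rewrite !mxE.
have dE phi : ((S phi)^T *m delta_mx j 0) 0 0 = S phi j 0.
  rewrite mxE (bigD1 j)//= !mxE !eqxx mulr1 big1 ?addr0// => l lj.
  by rewrite !mxE (negbTE lj) mulr0.
rewrite /adjoint; set P := [set psi | _].
have [] : P (get P).
  by apply: getPex; exists (aS j); split => // phi Hphi; rewrite dE SE.
move: (get P) => psi Hpsi psiE.
by rewrite TE// ipC psiE// dE SE.
Qed.

Section Tuples.
Variables (N : nat) (tau : 'I_N -> R).
Hypothesis tau_gt0 : forall k, 0 < tau k.

Definition L1v p (w : 'I_N -> R -> 'cV[R]_p) :=
  forall k i, L1 (tau k) (fun t => w k t i 0).

(* The matrix of W W^* for the operator W = Lop w. *)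
Definition gramian p (w : 'I_N -> R -> 'cV[R]_p) : 'M[R]_p :=
  \matrix_(i, j) \sum_k \int[mu]_(t in `[0, tau k])
    (rderiv (tau k) (fun t => w k t i 0) t * rderiv (tau k) (fun t => w k t j 0) t).

Definition Lop p (w : 'I_N -> R -> 'cV[R]_p) (phi : 'I_N -> R -> R) : 'cV[R]_p :=
  \sum_k intop (tau k) (w k) (phi k).

Lemma ipHtauC (phi psi : 'I_N -> R -> R) :
  ipHtau tau phi psi = ipHtau tau psi phi.
Proof.
apply: eq_bigr => k _; rewrite /ipH10; apply: eq_Rintegral => t _.
by rewrite mulrC.
Qed.

Lemma intopE p t (f : R -> 'cV[R]_p) (phi : R -> R) i :
  intop t f phi i 0 = \int[mu]_(s in `[0, t]) (phi s * f s i 0).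
Proof. by rewrite /intop mxE; apply: eq_Rintegral => s _; rewrite mxE. Qed.

Lemma gramE k p q (f : R -> 'cV[R]_p) (g : R -> 'cV[R]_q) :
  (forall i, L1 (tau k) (fun t => f t i 0)) ->
  (forall i, L1 (tau k) (fun t => g t i 0)) ->
  gram (tau k) f g = \matrix_(i, j) \int[mu]_(t in `[0, tau k])
    (rderiv (tau k) (fun t => f t i 0) t * rderiv (tau k) (fun t => g t j 0) t).
Proof.
move=> fi gi; rewrite /gram (@mul_adjointE _ _ _ _ _ _ _
    (fun i => h10_repr (tau k) (fun t => f t i 0))
    (fun i => h10_repr (tau k) (fun t => g t i 0))).
- by apply/matrixP => i j; rewrite !mxE ip_h10_repr.
- by move=> phi psi; apply: eq_Rintegral => t _; rewrite mulrC.
- by move=> i; exact: H10_h10_repr.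
- by move=> i; exact: H10_h10_repr.
- by move=> phi i Hphi; rewrite intopE H10_rderiv// H10_ip_h10_repr.
- by move=> phi i Hphi; rewrite intopE H10_rderiv// H10_ip_h10_repr.
Qed.

(** Agreement of [T] with [Lop w] is asked on [Htau] alone, since integration by parts rewrites
    [Zop] only there. *)
Lemma mul_adjoint_gramian p (w : 'I_N -> R -> 'cV[R]_p) T : L1v w ->
  (forall phi, Htau tau phi -> T phi = Lop w phi) ->
  mul_adjoint (Htau tau) (ipHtau tau) T T = gramian w.
Proof.
move=> wi TE.
pose a i k := h10_repr (tau k) (fun t => w k t i 0).
have aH i : Htau tau (a i) by move=> k; exact: H10_h10_repr.
have TE' phi i : Htau tau phi -> T phi i 0 = ipHtau tau phi (a i).
  move=> Hphi; rewrite TE// /Lop summxE; apply: eq_bigr => k _.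
  by rewrite intopE H10_rderiv// H10_ip_h10_repr.
rewrite (mul_adjointE ipHtauC aH aH TE' TE').
apply/matrixP => i j; rewrite !mxE; apply: eq_bigr => k _.
by rewrite /a ip_h10_repr.
Qed.

Lemma mulmx_coordE p q (S : 'M[R]_(q, p)) (w : R -> 'cV[R]_p) i :
  (fun t => (S *m w t) i 0) = (fun t => \sum_j S i j * w t j 0).
Proof. by apply/funext => t; rewrite mxE. Qed.

Lemma L1v_mulmx p q (S : 'M[R]_(q, p)) (w : 'I_N -> R -> 'cV[R]_p) :
  L1v w -> L1v (fun k t => S *m w k t).
Proof.
move=> wi k i; rewrite mulmx_coordE.
by have [] := @integral_linear_comb _ (index_enum 'I_p) (S i)
  (fun j t => w k t j 0) 0 (tau k) (wi k).
Qed.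

(** In operator terms (S W)(S W)^* = S W W^* S^T; it transports the pointwise system equation to
    Gram matrices. *)
Lemma gramian_mulmx p q (S : 'M[R]_(q, p)) (w : 'I_N -> R -> 'cV[R]_p) : L1v w ->
  gramian (fun k t => S *m w k t) = S *m gramian w *m S^T.
Proof.
move=> wi; apply/matrixP => i j; rewrite !mxE.
have rE k l t : 0 <= t <= tau k ->
    rderiv (tau k) (fun t => (S *m w k t) l 0) t =
    \sum_h S l h * rderiv (tau k) (fun t => w k t h 0) t.
  move=> tt; rewrite mulmx_coordE.
  exact: (@rderiv_linear_comb _ _ (S l) (fun h t => w k t h 0)).
pose G k h l := \int[mu]_(t in `[0, tau k])
  (rderiv (tau k) (fun t => w k t h 0) t * rderiv (tau k) (fun t => w k t l 0) t).
transitivity (\sum_k \sum_l S j l * \sum_h S i h * G k h l).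
  apply: eq_bigr => k _.
  rewrite (@eq_Rintegral _ _ _ mu _ (fun t => \sum_l S j l *
      (\sum_h S i h * (rderiv (tau k) (fun t => w k t h 0) t *
         rderiv (tau k) (fun t => w k t l 0) t)))); last first.
    move=> t; rewrite inE/= in_itv/= => tt; rewrite !rE// mulrC mulr_suml.
    apply: eq_bigr => l _; rewrite -mulrA; congr (_ * _).
    rewrite mulrC mulr_suml; apply: eq_bigr => h _.
    by rewrite mulrA.
  have Gi h l := rderiv_mul_integrable (tau_gt0 k) (wi k h) (wi k l).
  pose F l t := \sum_h S i h * (rderiv (tau k) (fun t => w k t h 0) t *
         rderiv (tau k) (fun t => w k t l 0) t).
  have FiE l := @integral_linear_comb _ (index_enum 'I_p) (S i) _ 0 (tau k)
    (fun h => Gi h l).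
  have [_ ->] := @integral_linear_comb _ (index_enum 'I_p) (S j) F 0 (tau k)
    (fun l => (FiE l).1).
  by apply: eq_bigr => l _; rewrite (FiE l).2.
rewrite exchange_big/=; apply: eq_bigr => l _.
rewrite !mxE mulr_suml -mulr_sumr mulrC; rewrite exchange_big/= mulr_suml.
apply: eq_bigr => h _; rewrite !mxE -mulr_sumr//.
Qed.

(** The form at v is the Gram matrix of the scalar signal v^T w, a sum of integrals of squares. *)
Lemma gramian_psd p (w : 'I_N -> R -> 'cV[R]_p) : L1v w -> psdmx (gramian w).
Proof.
move=> wi; split.
  apply/matrixP => i j; rewrite !mxE; apply: eq_bigr => k _.
  by apply: eq_Rintegral => t _; rewrite mulrC.
move=> v; rewrite -{2}(trmxK v) -gramian_mulmx// mxE; apply: sumr_ge0 => k _.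
by apply: Rintegral_ge0 => t _; rewrite -expr2 sqr_ge0.
Qed.

Lemma gramian_ae p (w w' : 'I_N -> R -> 'cV[R]_p) : L1v w -> L1v w' ->
  (forall k, {ae mu, forall t, `[0, tau k]%classic t -> w k t = w' k t}) ->
  gramian w = gramian w'.
Proof.
move=> wi wi' ww; apply/matrixP => i j; rewrite !mxE; apply: eq_bigr => k _.
apply: eq_Rintegral => t; rewrite inE/= in_itv/= => tt.
have E l : rderiv (tau k) (fun t => w k t l 0) t = rderiv (tau k) (fun t => w' k t l 0) t.
  apply: rderiv_ae => //; move: (ww k).
  by apply: filterS; first exact: (ae_filter_ringOfSetsType mu); move=> s H /H ->.
by rewrite !E.
Qed.

End Tuples.
End Gramians.

(** * Consistency with the data as a quadratic matrix inequality *)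

Section DataMatrices.
Context {R : realType}.
Notation mu := (@lebesgue_measure R).
Local Notation L1 tau f := (mu.-integrable `[0, tau] (EFin \o f)).

Lemma L2_comb (I : Type) (r : seq I) (c : I -> R) (f : I -> R -> R) a b :
  (forall i, L2 a b (f i)) -> L2 a b (fun t => \sum_(i <- r) c i * f i t).
Proof.
move=> fL; elim: r => [|i r [ih1 ih2]].
  rewrite (_ : (fun t : R => _) = cst 0); last first.
    by apply/funext => t; rewrite big_nil.
  split; first exact: measurable_cst.
  rewrite (_ : (fun t : R => _) = cst 0%E); first exact: integrable0.
  by apply/funext => t /=; rewrite expr0n.
rewrite (_ : (fun t : R => _) = (fun t => c i * f i t + \sum_(j <- r) c j * f j t)).
  2: by apply/funext => t; rewrite big_cons.
have [mf if2] := fL i.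
have mcf : measurable_fun `[a, b] (fun t => c i * f i t).
  by apply: measurable_funM => //; exact: measurable_cst.
have ms : measurable_fun `[a, b] (fun t => c i * f i t + \sum_(j <- r) c j * f j t).
  exact: measurable_funD.
split => //.
have i2 : mu.-integrable `[a, b] (fun t => (2 * c i ^+ 2)%:E * (f i t ^+ 2)%:E)%E.
  exact: integrableZl.
have i3 : mu.-integrable `[a, b]
    (fun t => 2%:E * ((\sum_(j <- r) c j * f j t) ^+ 2)%:E)%E.
  exact: integrableZl.
apply: (le_integrable _ _ _ (integrableD _ i2 i3)) => //.
  by apply/measurable_EFinP; apply: measurable_funX.
move=> t _; rewrite /= lee_fin.
move: (f i t) (\sum_(j <- r) _) => u v.
rewrite !ger0_norm ?sqr_ge0//; last first.
  by rewrite addr_ge0// mulr_ge0 ?sqr_ge0// mulr_ge0// sqr_ge0.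
have := sqr_ge0 (c i * u - v); rewrite sqrrB sqrrD !exprMn; lra.
Qed.

Lemma L2N a b (f : R -> R) : L2 a b f -> L2 a b (fun t => - f t).
Proof.
move=> [mf f2]; split; first exact: measurableT_comp.
rewrite (_ : (fun t : R => _) = (fun t => (f t ^+ 2)%:E))//.
by apply/funext => t; rewrite sqrrN.
Qed.

Lemma acl_L2 a b (f : R -> R) : a < b -> acl a b f -> L2 a b f.
Proof.
move=> ab /(acl_continuous ab) cf; split.
  by have /measurable_int/measurable_EFinP := within_continuous_integrable cf.
apply: (@within_continuous_integrable _ a b (fun t => f t ^+ 2)).
rewrite (_ : (fun t : R => _) = (fun t => f t * f t)).
  by move=> x; apply: cvgM; exact: cf.
by apply/funext => t; rewrite expr2.
Qed.

Variables (n m N : nat) (tau : 'I_N -> R).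
Hypothesis tau_gt0 : forall k, 0 < tau k.

Definition stack (p q : 'I_N -> R -> 'cV[R]_n) (r : 'I_N -> R -> 'cV[R]_m) k t :=
  col_mx (p k t) (col_mx (- q k t) (- r k t)).

Definition data (x : 'I_N -> R -> 'cV[R]_n) (u : 'I_N -> R -> 'cV[R]_m) :=
  stack (fun k => derivv (x k)) x u.

Lemma stack_L2 p q r : (forall k, [/\ L2v 0 (tau k) (p k), L2v 0 (tau k) (q k)
               & L2v 0 (tau k) (r k)]) ->
  forall k, L2v 0 (tau k) (stack p q r k).
Proof.
move=> H k i; have [Hp Hq Hr] := H k; case: (split_ordP i) => [j|j] ->.
  rewrite (_ : (fun t : R => _) = (fun t => p k t j 0)); first exact: Hp.
  by apply/funext => t; rewrite col_mxEu.
case: (split_ordP j) => l ->.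
  rewrite (_ : (fun t : R => _) = (fun t => - q k t l 0)); first exact/L2N/Hq.
  by apply/funext => t; rewrite col_mxEd col_mxEu mxE.
rewrite (_ : (fun t : R => _) = (fun t => - r k t l 0)); first exact/L2N/Hr.
by apply/funext => t; rewrite !col_mxEd mxE.
Qed.

Lemma L2v_L1v p (w : 'I_N -> R -> 'cV[R]_p) :
  (forall k, L2v 0 (tau k) (w k)) -> L1v tau w.
Proof. by move=> w2 k i; exact/L2_integrable/w2. Qed.

Lemma WW_gramian p q r : (forall k, [/\ L2v 0 (tau k) (p k), L2v 0 (tau k) (q k)
               & L2v 0 (tau k) (r k)]) ->
  WW tau p q r = gramian tau (stack p q r).
Proof. by move=> H; apply: mul_adjoint_gramian => //; exact/L2v_L1v/stack_L2. Qed.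

Variables (x : 'I_N -> R -> 'cV[R]_n) (u : 'I_N -> R -> 'cV[R]_m).
Hypothesis xH1 : forall k, H1v 0 (tau k) (x k).
Hypothesis uL2 : forall k, L2v 0 (tau k) (u k).

Lemma derivv_L2 k : L2v 0 (tau k) (derivv (x k)).
Proof.
move=> i; rewrite (_ : (fun t : R => _) = derive1 (fun t => x k t i 0)).
  by have [] := xH1 k i.
by apply/funext => t; rewrite mxE.
Qed.

Lemma x_L2 k : L2v 0 (tau k) (x k).
Proof.
by move=> i; apply: acl_L2 => //; apply: abs_continuous_acl; have [] := xH1 k i.
Qed.

Lemma data_components k : [/\ L2v 0 (tau k) (derivv (x k)), L2v 0 (tau k) (x k)
               & L2v 0 (tau k) (u k)].
Proof. by split; [exact: derivv_L2|exact: x_L2|]. Qed.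

Lemma data_L2 k : L2v 0 (tau k) (data x u k).
Proof. exact: (stack_L2 data_components). Qed.

Lemma data_L1 : L1v tau (data x u).
Proof. exact/L2v_L1v/data_L2. Qed.

Lemma H10_mul_integrable t (phi f : R -> R) : 0 < t -> H10 0 t phi -> L1 t f ->
  L1 t (fun s => phi s * f s).
Proof.
move=> t0 [[/abs_continuous_acl/(acl_continuous t0) cphi _] _ _ _] fi.
rewrite (_ : (fun s : R => _) = (fun s => f s * phi s)); last first.
  by apply/funext => s; rewrite mulrC.
exact: integrable_mul_continuous.
Qed.

Lemma intopN p t (f : R -> 'cV[R]_p) phi : 0 < t -> H10 0 t phi ->
  (forall i, L1 t (fun s => f s i 0)) ->
  intop t (fun s => - f s) phi = - intop t f phi.
Proof.
move=> t0 Hphi fi; apply/matrixP => i j; rewrite ord1 intopE mxE intopE.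
rewrite (@eq_Rintegral _ _ _ mu _ (fun s => (-1) * (phi s * f s i 0))).
  by rewrite RintegralZl ?mulN1r//; exact: H10_mul_integrable.
by move=> s _; rewrite mxE mulN1r mulrN.
Qed.

Lemma intop_col p q t (f : R -> 'cV[R]_p) (g : R -> 'cV[R]_q) phi :
  intop t (fun s => col_mx (f s) (g s)) phi = col_mx (intop t f phi) (intop t g phi).
Proof.
apply/matrixP => i j; rewrite ord1 intopE; case: (split_ordP i) => l ->.
  by rewrite col_mxEu intopE; apply: eq_Rintegral => s _; rewrite col_mxEu.
by rewrite col_mxEd intopE; apply: eq_Rintegral => s _; rewrite col_mxEd.
Qed.

(* By parts, X_d phi = \int phi x', so that Z is an operator of the same form
   as W, with the data x', x, u in place of the noise p, q, r. *)
Lemma Zop_Lop phi : Htau tau phi -> Zop tau x u phi = Lop tau (data x u) phi.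
Proof.
move=> Hphi; apply: eq_bigr => k _.
have Hk := Hphi k.
rewrite -intopN//; last by move=> i; exact/L2_integrable/x_L2.
rewrite -intopN//; last by move=> i; exact/L2_integrable/uL2.
have -> : dintop (tau k) (x k) (phi k) = intop (tau k) (derivv (x k)) (phi k).
  apply/matrixP => i j; rewrite ord1 intopE mxE mxE.
  rewrite (@eq_Rintegral _ _ _ mu _
    (fun t => derive1 (phi k) t * x k t i 0)); last by move=> t _; rewrite mxE.
  rewrite H10_parts//; last exact: xH1.
  by apply: eq_Rintegral => t _; rewrite mxE.
by rewrite /data /stack !intop_col.
Qed.

Lemma ZZ_gramian : ZZ tau x u = gramian tau (data x u).
Proof. by apply: mul_adjoint_gramian => //; [exact: data_L1|exact: Zop_Lop]. Qed.

Lemma rderivN t (f : R -> R) s : 0 <= s <= t -> L1 t f ->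
  rderiv t (fun s => - f s) s = - rderiv t f s.
Proof.
move=> st fi.
rewrite (_ : (fun s => _) = (fun s => \sum_(i <- [:: tt]) -1 * f s)); last first.
  by apply/funext => y; rewrite big_seq1 mulN1r.
by rewrite (@rderiv_linear_comb _ _ _ (fun=> -1) (fun=> f))// big_seq1 mulN1r.
Qed.

(** The minus signs that [Zop] puts on the state and input rows cancel in pairs, which connects
    hypothesis (b) with the lower right block. *)
Lemma drsubmx_ZZ : drsubmx (ZZ tau x u) =
  \sum_k block_mx (gram (tau k) (x k) (x k)) (gram (tau k) (x k) (u k))
                  (gram (tau k) (u k) (x k)) (gram (tau k) (u k) (u k)).
Proof.
have xi k i : L1 (tau k) (fun t => x k t i 0) by exact/L2_integrable/x_L2.
have ui k i : L1 (tau k) (fun t => u k t i 0) by exact/L2_integrable/uL2.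
have N2 k (f g : R -> R) : L1 (tau k) f -> L1 (tau k) g ->
    \int[mu]_(t in `[0, tau k])
      (rderiv (tau k) (fun s => - f s) t * rderiv (tau k) (fun s => - g s) t) =
    \int[mu]_(t in `[0, tau k]) (rderiv (tau k) f t * rderiv (tau k) g t).
  move=> fi gi; apply: eq_Rintegral => t; rewrite inE/= in_itv/= => tt.
  by rewrite !rderivN// mulrNN.
have E1 k (l : 'I_n) : (fun t => data x u k t (rshift n (lshift m l)) 0) =
    (fun t => - x k t l 0).
  by apply/funext => t; rewrite /data /stack col_mxEd col_mxEu mxE.
have E2 k (l : 'I_m) : (fun t => data x u k t (rshift n (rshift n l)) 0) =
    (fun t => - u k t l 0).
  by apply/funext => t; rewrite /data /stack !col_mxEd mxE.
rewrite ZZ_gramian; apply/matrixP => i j; rewrite !mxE summxE; apply: eq_bigr => k _.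
rewrite !gramE//.
case: (split_ordP i) => a ->; case: (split_ordP j) => b ->.
- by rewrite block_mxEul mxE !E1 N2.
- by rewrite block_mxEur mxE E1 E2 N2.
- by rewrite block_mxEdl mxE E1 E2 N2.
- by rewrite block_mxEdr mxE !E2 N2.
Qed.

Lemma row1_stack (A : 'M[R]_n) (B : 'M[R]_(n, m)) p q r k t :
  row_mx 1%:M (row_mx A B) *m stack p q r k t =
  p k t - A *m q k t - B *m r k t.
Proof. by rewrite /stack !mul_row_col mul1mx !mulmxN addrA. Qed.

Lemma consistent_QMI (Theta : 'M[R]_(n + (n + m))) (A : 'M[R]_n) (B : 'M[R]_(n, m)) :
  let S := row_mx 1%:M (row_mx A B) in
  consistent tau Theta x u A B -> psdmx (S *m (Theta - ZZ tau x u) *m S^T).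
Proof.
move=> S [p [q [r [[H WT] sys]]]].
rewrite mulmxBr mulmxBl ZZ_gramian -gramian_mulmx//; last exact: data_L1.
have -> : gramian tau (fun k t => S *m data x u k t) =
    gramian tau (fun k t => S *m stack p q r k t).
  apply: gramian_ae.
  - exact: (L1v_mulmx _ data_L1).
  - exact: (L1v_mulmx _ (L2v_L1v (stack_L2 H))).
  move=> k; move: (sys k); apply: filterS; first exact: (ae_filter_ringOfSetsType mu).
  move=> t /[apply] E; rewrite !row1_stack.
  have -> : derivv (x k) t = A *m (x k t - q k t) + B *m (u k t - r k t) + p k t.
    by rewrite -E subrK.
  rewrite !mulmxBr.
  by apply/matrixP => i j; rewrite !mxE; ring.
rewrite gramian_mulmx//; last exact: (L2v_L1v (stack_L2 H)).
by rewrite -WW_gramian// -mulmxBl -mulmxBr; exact: psd_congr.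
Qed.

(* The noise M S z, where z is the data and M S is the oblique projection with
   M = Theta S^T (S Theta S^T)^-1, explains the data and has a Gram matrix below
   Theta. *)
Lemma QMI_consistent (Theta : 'M[R]_(n + (n + m))) (A : 'M[R]_n) (B : 'M[R]_(n, m)) :
  let S := row_mx 1%:M (row_mx A B) in
  psdmx Theta -> posdefmx (S *m Theta *m S^T) ->
  psdmx (S *m (Theta - ZZ tau x u) *m S^T) -> consistent tau Theta x u A B.
Proof.
move=> S pT pS pQ; have uS := posdef_unit pS; have [sT _] := pT.
pose P := S *m Theta *m S^T; pose M := Theta *m S^T *m invmx P.
have SM : S *m M = 1%:M by rewrite /M !mulmxA mulmxV.
pose w k t := M *m S *m data x u k t.
have w2 k : L2v 0 (tau k) (w k).
  move=> i; rewrite mulmx_coordE.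
  exact: (@L2_comb _ _ _ (fun j t => data x u k t j 0) _ _ (data_L2 k)).
pose p k t := usubmx (w k t).
pose q k t := - usubmx (dsubmx (w k t)); pose r k t := - dsubmx (dsubmx (w k t)).
have wE : stack p q r = w.
  by apply/funext => k; apply/funext => t; rewrite /stack /q /r !opprK !vsubmxK.
have H k : [/\ L2v 0 (tau k) (p k), L2v 0 (tau k) (q k) & L2v 0 (tau k) (r k)].
  split=> i.
  - rewrite (_ : (fun t : R => _) = (fun t => w k t (lshift _ i) 0)); first exact: w2.
    by apply/funext => t; rewrite mxE.
  - rewrite (_ : (fun t : R => _) = (fun t => - w k t (rshift _ (lshift _ i)) 0)).
      exact/L2N/w2.
    by apply/funext => t; rewrite !mxE.
  - rewrite (_ : (fun t : R => _) = (fun t => - w k t (rshift _ (rshift _ i)) 0)).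
      exact/L2N/w2.
    by apply/funext => t; rewrite !mxE.
exists p, q, r; split; first split => //.
  rewrite /loewner_le WW_gramian// wE gramian_mulmx//; last exact: data_L1.
  have sP : P^T = P := pS.1.
  have MT : M^T = invmx P *m S *m Theta.
    by rewrite /M !trmx_mul trmxK invmx_sym// sT mulmxA.
  (* M S is a projection with M S Theta = Theta (M S)^T, so Theta splits without cross terms into
     the part on the complement of the projection and the part that the data inequality controls. *)
  have -> : Theta - M *m S *m gramian tau (data x u) *m (M *m S)^T =
      (1%:M - M *m S) *m Theta *m (1%:M - M *m S)^T +
      M *m (S *m (Theta - ZZ tau x u) *m S^T) *m M^T.
    rewrite -ZZ_gramian; set Z := ZZ tau x u.
    have e1 : M *m S *m Theta = Theta *m (M *m S)^T.
      by rewrite trmx_mul MT /M !mulmxA.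
    have e2 : M *m S *m Theta *m (M *m S)^T = M *m S *m Theta.
      rewrite [in LHS]trmx_mul MT !mulmxA.
      have -> : M *m S *m Theta *m S^T = Theta *m S^T.
        by rewrite /M -!mulmxA !(mulmxA S) -/P mulVmx// mulmx1.
      by rewrite /M.
    rewrite (_ : (1%:M - M *m S)^T = 1%:M - (M *m S)^T); last first.
      by rewrite linearB/= trmx1.
    rewrite (mulmxBr S) (mulmxBl (S *m Theta)) (mulmxBr M) (mulmxBl (M *m _)).
    rewrite !mulmxBl !mulmxBr !mul1mx !mulmx1 -e1 e2.
    have e3 Y : M *m (S *m Y *m S^T) *m M^T = M *m S *m Y *m (M *m S)^T.
      by rewrite [(M *m S)^T]trmx_mul !mulmxA.
    rewrite !e3 e2.
    by rewrite subrr subr0 addrA subrK.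
  by apply: psdD; apply: psd_congr.
move=> k; apply: aeW => t _.
have : S *m w k t = S *m data x u k t by rewrite /w -(mulmxA M S) (mulmxA S M) SM mul1mx.
rewrite -wE !row1_stack => E.
have -> : derivv (x k) t = p k t - A *m q k t - B *m r k t + A *m x k t + B *m u k t.
  by rewrite E addrAC !subrK.
by rewrite !mulmxBr; apply/matrixP => i j; rewrite !mxE; ring.
Qed.

End DataMatrices.

(** * Lyapunov inequalities and the H2 norm *)

Section Lyapunov.
Context {R : realType}.

Lemma complexmxM p q r (A : 'M[R]_(p, q)) (B : 'M[R]_(q, r)) :
  complexmx (A *m B) = complexmx A *m complexmx B.
Proof. exact: map_mxM. Qed.

Lemma complexmxB p q (A B : 'M[R]_(p, q)) :
  complexmx (A - B) = complexmx A - complexmx B.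
Proof. exact: map_mxB. Qed.

Definition remx p q (A : 'M[R[i]]_(p, q)) : 'M[R]_(p, q) := map_mx (@complex.Re R) A.
Definition immx p q (A : 'M[R[i]]_(p, q)) : 'M[R]_(p, q) := map_mx (@complex.Im R) A.

Lemma remxM p q r (A : 'M[R[i]]_(p, q)) (B : 'M[R]_(q, r)) :
  remx (A *m complexmx B) = remx A *m B.
Proof.
apply/matrixP => i j; rewrite !mxE raddf_sum; apply: eq_bigr => k _.
by rewrite !mxE; case: (A i k) => a b /=; rewrite mulr0 subr0.
Qed.

Lemma immxM p q r (A : 'M[R[i]]_(p, q)) (B : 'M[R]_(q, r)) :
  immx (A *m complexmx B) = immx A *m B.
Proof.
apply/matrixP => i j; rewrite !mxE raddf_sum; apply: eq_bigr => k _.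
by rewrite !mxE; case: (A i k) => a b /=; rewrite mulr0 add0r.
Qed.

Lemma remxZ p q z (A : 'M[R[i]]_(p, q)) :
  remx (z *: A) = complex.Re z *: remx A - complex.Im z *: immx A.
Proof.
by apply/matrixP => i j; rewrite !mxE; case: z => a b; case: (A i j).
Qed.

Lemma immxZ p q z (A : 'M[R[i]]_(p, q)) :
  immx (z *: A) = complex.Re z *: immx A + complex.Im z *: remx A.
Proof.
by apply/matrixP => i j; rewrite !mxE; case: z => a b; case: (A i j).
Qed.

Lemma remx_immx_eq0 p q (A : 'M[R[i]]_(p, q)) : remx A = 0 -> immx A = 0 -> A = 0.
Proof.
move=> rA iA; apply/matrixP => i j; move/matrixP: rA => /(_ i j).
move/matrixP: iA => /(_ i j); rewrite !mxE.
by case: (A i j) => a b /= -> ->.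
Qed.

Lemma qf_sym_part p (A P : 'M[R]_p) v : P^T = P ->
  qf (A *m P + (A *m P)^T) v = 2 * bf P (A^T *m v) v.
Proof.
move=> sP; rewrite qfD.
have -> : qf (A *m P)^T v = qf (A *m P) v.
  rewrite /qf; have <- : (v^T *m (A *m P) *m v)^T = v^T *m (A *m P)^T *m v.
    by rewrite !trmx_mul trmxK !mulmxA.
  by rewrite mxE.
have -> : qf (A *m P) v = bf P (A^T *m v) v by rewrite /qf /bf trmx_mul trmxK !mulmxA.
by rewrite mulr2n mulrDl mul1r.
Qed.

Lemma bf_Dl p (P : 'M[R]_p) (a b v : 'cV[R]_p) s t :
  bf P (s *: a + t *: b) v = s * bf P a v + t * bf P b v.
Proof.
rewrite /bf [(_ + _)^T]linearD/= ![(_ *: _)^T]linearZ/= !mulmxDl -!scalemxAl.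
by rewrite !mxE.
Qed.

(** For a left eigenvector a^T + i b^T with eigenvalue z, the Lyapunov form summed over [a] and [b]
    equals 2 Re z (qf P a + qf P b): by symmetry of P the contributions of Im z cancel. The left
    side is negative and P is positive. *)
Lemma lyapunov_hurwitz n (A P : 'M[R]_n) : posdefmx P ->
  posdefmx (- (A *m P + (A *m P)^T)) -> hurwitz A.
Proof.
move=> pP [_ H] z /eigenvalueP[v vA v0].
pose a := (remx v)^T; pose b := (immx v)^T; have sP := pP.1.
have ra : A^T *m a = complex.Re z *: a + (- complex.Im z) *: b.
  apply: trmx_inj; rewrite trmx_mul trmxK /a trmxK -remxM vA remxZ scaleNr.
  by rewrite linearB/= !linearZ/= !trmxK.
have rb : A^T *m b = complex.Re z *: b + complex.Im z *: a.
  apply: trmx_inj; rewrite trmx_mul trmxK /b trmxK -immxM vA immxZ.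
  by rewrite linearD/= !linearZ/= !trmxK.
have ha := qf_sym_part A a sP; have hb := qf_sym_part A b sP.
rewrite ra bf_Dl in ha; rewrite rb bf_Dl in hb.
have sum : qf (A *m P + (A *m P)^T) a + qf (A *m P + (A *m P)^T) b =
    2 * complex.Re z * (qf P a + qf P b).
  rewrite ha hb (bfC b a sP) -!/(qf P _) -/(bf P a a) -/(bf P b b).
  by rewrite /qf /bf; ring.
have pos w : 0 <= qf P w by exact: (posdef_psd pP).2.
have neg w : w != 0 -> qf (A *m P + (A *m P)^T) w < 0 /\ 0 < qf P w.
  by move=> w0; split; [have := H w w0; rewrite -/(qf _ _) qfN oppr_gt0|exact: pP.2].
have neg' w : qf (A *m P + (A *m P)^T) w <= 0.
  by have [->|/neg[/ltW]//] := eqVneq w 0; rewrite qf0.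
have [a0|a0] := eqVneq a 0.
  have [b0|b0] := eqVneq b 0.
    move: v0; rewrite (_ : v = 0) ?eqxx//; apply: remx_immx_eq0; apply: trmx_inj.
      by rewrite trmx0.
    by rewrite trmx0.
  have [h1 h2] := neg _ b0; have := pos a; have := neg' a.
  by move: sum h1 h2; move: (qf P a) (qf P b) (qf _ a) (qf _ b) (complex.Re z) =>
     *; nra.
have [h1 h2] := neg _ a0; have := pos b; have := neg' b.
by move: sum h1 h2; move: (qf P a) (qf P b) (qf _ a) (qf _ b) (complex.Re z) =>
   *; nra.
Qed.

Lemma mxtrace_psd p (A : 'M[R]_p) : psdmx A -> 0 <= \tr A.
Proof.
move=> [_ A0]; apply: sumr_ge0 => i _.
by have := A0 (delta_mx i 0); rewrite trmx_delta -rowE -colE !mxE.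
Qed.

Lemma mxtrace_gram p q (A : 'M[R]_(p, q)) :
  \tr (A *m A^T) = \sum_i \sum_j A i j ^+ 2.
Proof.
apply: eq_bigr => i _; rewrite mxE; apply: eq_bigr => j _.
by rewrite mxE expr2.
Qed.

Section Discretization.
Variables (n nw : nat) (A P : 'M[R]_n) (B : 'M[R]_(n, nw)).
Hypothesis pP : posdefmx P.
Hypothesis lyap : posdefmx (- (A *m P + (A *m P)^T + B *m B^T)).

Lemma lyap_posdef : posdefmx (- (A *m P + (A *m P)^T)).
Proof.
have := posdefD lyap (psd_gram B).
by rewrite opprD subrK.
Qed.

(** If A^T v = v, the Lyapunov form at v would equal twice the form of P, which is positive. *)
Lemma onemx_unit : 1%:M - A \in unitmx.
Proof.
rewrite -unitmx_tr; apply: unitmx_inj => v; rewrite linearB/= trmx1 mulmxBl mul1mx.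
move=> /eqP; rewrite subr_eq0 => /eqP vA; apply/eqP/negPn/negP => v0.
have := lyap_posdef.2 v v0; rewrite -/(qf _ _) qfN qf_sym_part; last exact: pP.1.
have := pP.2 v v0; rewrite -vA -/(bf P v v); lra.
Qed.

(* The Cayley transform turns the continuous-time Lyapunov inequality into the
   discrete-time Stein inequality. *)
Definition cayley_mx := invmx (1%:M - A) *m (1%:M + A).

(** Up to the scalar factor [cayley_coef], the coefficient of z^k in the expansion of (iw - A)^-1
    B. *)
Definition cayley_iter k := iter k (mulmx cayley_mx) (invmx (1%:M - A) *m B).

(** After factoring out (I - A)^-1 on both sides, the identity behind it is (I - A) P (I - A)^T - (I
    + A) P (I + A)^T = -2 (A P + P A^T). *)
Lemma stein : psdmx (P - cayley_mx *m P *m cayley_mx^T -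
  2 *: (cayley_iter 0 *m (cayley_iter 0)^T)).
Proof.
pose V := invmx (1%:M - A); have uV := onemx_unit.
have E : P = V *m ((1%:M - A) *m P *m (1%:M - A)^T) *m V^T.
  rewrite !mulmxA mulVmx// mul1mx -mulmxA -trmx_mul mulVmx// trmx1 mulmx1//.
have -> : P - cayley_mx *m P *m cayley_mx^T -
    2 *: (cayley_iter 0 *m (cayley_iter 0)^T) =
    V *m (2 *: (- (A *m P + (A *m P)^T + B *m B^T))) *m V^T.
  rewrite {1}E /cayley_mx /cayley_iter/= -/V !trmx_mul.
  have -> : V *m (1%:M + A) *m P *m ((1%:M + A)^T *m V^T) =
    V *m ((1%:M + A) *m P *m (1%:M + A)^T) *m V^T by rewrite !mulmxA.
  have -> : 2 *: (V *m B *m (B^T *m V^T)) = V *m (2 *: (B *m B^T)) *m V^T.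
    by rewrite -scalemxAr -scalemxAl !mulmxA.
  rewrite -!mulmxBl -!mulmxBr; congr (_ *m _ *m _).
  rewrite [(1%:M - A)^T]linearB/= [(1%:M + A)^T]linearD/= trmx1.
  rewrite !mulmxBr !mulmxDr !mulmxBl !mulmxDl !mul1mx !mulmx1 pP.1.
  by apply/matrixP => i j; rewrite !mxE; ring.
apply: psd_congr; apply: posdef_psd; have [sQ Q] := lyap; split.
  by rewrite linearZ/= sQ.
by move=> v v0; rewrite -/(qf _ _) qfZ mulr_gt0//; exact: Q.
Qed.

(** Conjugates of the Stein inequality by powers of F = [cayley_mx] telescope; V is the remainder
    F^M P (F^M)^T. *)
Lemma stein_sum M : exists2 V, psdmx V &
  psdmx (P - V - 2 *: \sum_(k < M) (cayley_iter k *m (cayley_iter k)^T)).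
Proof.
pose V k := iter k (fun X => cayley_mx *m X *m cayley_mx^T) P.
have VS k : psdmx (V k - V k.+1 - 2 *: (cayley_iter k *m (cayley_iter k)^T)).
  elim: k => [|k ih]; first exact: stein.
  have := psd_congr cayley_mx ih; rewrite !mulmxBr !mulmxBl -scalemxAr -scalemxAl.
  have gen (T : 'M[R]_n) (Y : 'M[R]_(n, nw)) :
      T *m (Y *m Y^T) *m T^T = (T *m Y) *m (T *m Y)^T.
    by rewrite trmx_mul !mulmxA.
  by rewrite gen.
exists (V M).
  by elim: M => [|M ih]; [exact: posdef_psd|exact: psd_congr].
elim: M => [|M ih].
  by rewrite big_ord0 scaler0 subr0 subrr; split=> [|v];
     rewrite ?trmx0// mulmx0 mul0mx mxE.
rewrite big_ord_recr/= scalerDr.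
rewrite (_ : _ - _ = P - V M - 2 *: (\sum_(k < M) cayley_iter k *m (cayley_iter k)^T) +
  (V M - V M.+1 - 2 *: (cayley_iter M *m (cayley_iter M)^T))).
  exact: psdD.
by apply/matrixP => i j; rewrite !mxE; ring.
Qed.

Lemma cayley_sum_le nz (C : 'M[R]_(nz, n)) M :
  2 * (\sum_(k < M) \sum_i \sum_j (C *m cayley_iter k) i j ^+ 2) <=
  \tr (C *m P *m C^T).
Proof.
have [V pV pS] := stein_sum M.
have := mxtrace_psd (psd_congr C (psdD pS pV)).
rewrite [_ - _ + V]addrAC subrK mulmxBr mulmxBl linearB/= subr_ge0.
rewrite -scalemxAr -scalemxAl linearZ/= mulmx_sumr mulmx_suml linear_sum/=.
apply: le_trans; rewrite le_eqVlt; apply/orP; left; apply/eqP.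
congr (_ * _); apply: eq_bigr => k _; rewrite -mxtrace_gram.
by rewrite trmx_mul !mulmxA.
Qed.

(** The bound of [cayley_sum_le] for C = I makes every entry square summable in k. *)
Lemma cayley_iter_cvg i j : cayley_iter k i j @[k --> \oo] --> (0 : R).
Proof.
pose a k := cayley_iter k i j ^+ 2.
have a0 k : 0 <= a k by exact: sqr_ge0.
have cs : cvgn (series a).
  apply: nondecreasing_is_cvgn.
    by apply: nondecreasing_series => k _ _; exact: a0.
  exists (\tr P); move=> _ [M _ <-]; rewrite /series/= big_mkord.
  have := cayley_sum_le 1%:M M; rewrite trmx1 mul1mx mulmx1.
  apply: le_trans; rewrite -[leLHS]mul1r ler_pM ?sumr_ge0// ?ler1n//.
  apply: ler_sum => k _; rewrite mul1mx /a (bigD1 i)//= (bigD1 j)//= -addrA.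
  rewrite lerDl addr_ge0// ?sumr_ge0// => [l _|l _]; first exact: sqr_ge0.
  by rewrite sumr_ge0// => h _; exact: sqr_ge0.
have := cvg_series_cvg_0 cs => a_0.
apply/cvgr0Pnorm_lt => e e0.
have e2 : 0 < e ^+ 2 by rewrite exprn_gt0.
move/cvgr0Pnorm_lt: a_0 => /(_ _ e2); apply: filterS => k.
rewrite /a normrX => h; rewrite -(@ltr_pXn2r _ 2)// ?nnegrE// ltW//.
Qed.

End Discretization.
End Lyapunov.

(** * Orthogonality and Parseval's identity on the imaginary axis *)

Section CayleyWeights.
Context {R : realType}.
Notation mu := (@lebesgue_measure R).

(* With w = tan (t / 2), the measure 4 dw / (1 + w^2) is 2 dt, so these are the
   Fourier cosines of the imaginary axis seen through the Cayley transform. *)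
Definition cweight (d w : R) : R := 4 / (1 + w ^+ 2) * cos (d * (2 * atan w)).

Lemma continuous_cweight d : continuous (cweight d).
Proof.
move=> w; rewrite /cweight; apply: cvgM.
  apply: cvgM; first exact: cvg_cst.
  apply: cvgV; first by rewrite gt_eqF// ltr_wpDr// sqr_ge0.
  by apply: cvgD; [exact: cvg_cst|exact: exprn_continuous].
apply: (@continuous_comp _ _ _ (fun w => d * (2 * atan w)) cos); last first.
  exact: continuous_cos.
by apply: cvgM; [exact: cvg_cst|apply: cvgM; [exact: cvg_cst|exact: continuous_atan]].
Qed.

Lemma integral_cweight0 W : 0 < W ->
  \int[mu]_(w in `[- W, W]) cweight 0 w = 8 * atan W.
Proof.
move=> W0; rewrite /Rintegral.
have dF (w : R) : is_derive w 1 (fun w => 4 * atan w) (cweight 0 w).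
  by apply: is_derive_eq; rewrite /cweight mul0r cos0 mulr1 /GRing.scale/=.
have cF : continuous (fun w : R => 4 * atan w).
  by move=> w; apply: cvgM; [exact: cvg_cst|exact: continuous_atan].
rewrite (@continuous_FTC2 _ (cweight 0) (fun w => 4 * atan w)).
- by rewrite /= atanN; ring.
- by rewrite ltrNl (lt_trans _ W0)// oppr_lt0.
- by apply: continuous_subspaceT; exact: continuous_cweight.
- split; [by move=> w _; case: (dF w)| |].
    by apply: cvg_at_right_filter; exact: cF.
  by apply: cvg_at_left_filter; exact: cF.
- by move=> w _; rewrite derive1E; apply: derive_val.
Qed.

Lemma integral_cweight d W : d != 0 -> 0 < W ->
  \int[mu]_(w in `[- W, W]) cweight d w = 4 / d * sin (d * (2 * atan W)).
Proof.
move=> d0 W0; rewrite /Rintegral; pose F (w : R) := 2 / d * sin (d * (2 * atan w)).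
have dF (w : R) : is_derive w 1 F (cweight d w).
  rewrite /F; apply: is_derive_eq.
  rewrite /cweight /GRing.scale/=.
  by field; rewrite d0 gt_eqF// ltr_wpDr// sqr_ge0.
have cF : continuous F.
  by move=> w; apply: differentiable_continuous; apply/derivable1_diffP; case: (dF w).
rewrite (@continuous_FTC2 _ (cweight d) F).
- by rewrite /F /= atanN !mulrN sinN; field.
- by rewrite ltrNl (lt_trans _ W0)// oppr_lt0.
- by apply: continuous_subspaceT; exact: continuous_cweight.
- split; [by move=> w _; case: (dF w)| |].
    by apply: cvg_at_right_filter; exact: cF.
  by apply: cvg_at_left_filter; exact: cF.
- by move=> w _; rewrite derive1E; apply: derive_val.
Qed.

Lemma sin_nat_pi k : sin (k%:R * pi) = 0 :> R.
Proof.
elim: k => [|k ih]; first by rewrite mul0r sin0.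
by rewrite -natr1 mulrDl mul1r sinDpi ih oppr0.
Qed.

(** 2 atan W tends to pi, and the primitive found above contains the sine of an integer multiple of
    it, which vanishes in the limit unless k = l. *)
Lemma cvg_integral_cweight (k l : nat) :
  \int[mu]_(w in `[- n.+1%:R, n.+1%:R]) cweight (k%:R - l%:R) w @[n --> \oo] -->
  (if k == l then 4 * pi else 0).
Proof.
have catan : atan (n.+1%:R : R) @[n --> \oo] --> pi / 2.
  apply: (cvg_comp _ _ _ (@cvgy_atan R)); apply/cvgryPge => c.
  exists (Num.truncn `|c|) => // n /= cn; apply: le_trans (ler_norm c) _.
  by rewrite ltW// (lt_le_trans (truncnS_gt _))// ler_nat.
case: eqVneq => [->|kl].
  rewrite subrr; under eq_cvg do rewrite integral_cweight0//.
  rewrite (_ : 4 * pi = 8 * (pi / 2)); last by field.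
  by apply: cvgM; [exact: cvg_cst|].
have d0 : k%:R - l%:R != 0 :> R by rewrite subr_eq0 eqr_nat.
under eq_cvg do rewrite integral_cweight//.
move: d0; set d : R := k%:R - l%:R => d0.
have lim0 : 4 / d * sin (d * (2 * (pi / 2))) = 0.
  have -> : d * (2 * (pi / 2)) = k%:R * pi - l%:R * pi by rewrite /d; field.
  rewrite sinB !sin_nat_pi.
  by rewrite mul0r mulr0 subrr mulr0.
have H : 4 / d * sin (d * (2 * atan n.+1%:R)) @[n --> \oo] -->
    4 / d * sin (d * (2 * (pi / 2))).
  apply: cvgM; first exact: cvg_cst.
  apply: continuous_cvg; first exact: continuous_sin.
  by apply: cvgM; [exact: cvg_cst|apply: cvgM; [exact: cvg_cst|]].
by rewrite lim0 in H.
Qed.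

Section PartialSums.
Variables (M : nat) (h : nat -> R).

(** The squared modulus of [cayley_coef w] times the partial sum of h_k z^k, as [nsq_partial_sum]
    shows, in a real form that can be integrated. *)
Definition cayley_sqr (w : R) : R := 4 / (1 + w ^+ 2) *
  ((\sum_(k < M) h k * cos (k%:R * (2 * atan w))) ^+ 2 +
   (\sum_(k < M) h k * sin (k%:R * (2 * atan w))) ^+ 2).

Lemma cayley_sqr_ge0 w : 0 <= cayley_sqr w.
Proof.
rewrite mulr_ge0 ?addr_ge0 ?sqr_ge0// divr_ge0//.
by rewrite addr_ge0// sqr_ge0.
Qed.

Lemma cayley_sqrE w : cayley_sqr w =
  \sum_(p : 'I_M * 'I_M) h p.1 * h p.2 * cweight (p.1%:R - p.2%:R) w.
Proof.
rewrite -(pair_bigA _ (fun k l : 'I_M => h k * h l * cweight (k%:R - l%:R) w))/=.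
rewrite /cayley_sqr !expr2 !big_distrlr/= -big_split/= mulr_sumr.
apply: eq_bigr => k _; rewrite -big_split/= mulr_sumr.
by apply: eq_bigr => l _; rewrite /cweight mulrBl cosB; ring.
Qed.

Lemma cayley_sqr_continuous : continuous cayley_sqr.
Proof.
rewrite (_ : cayley_sqr = fun w =>
  \sum_(p : 'I_M * 'I_M) h p.1 * h p.2 * cweight (p.1%:R - p.2%:R) w).
  apply: continuous_big => [|p _ w]; first exact: add_continuous.
  by apply: cvgM; [exact: cvg_cst|exact: continuous_cweight].
by apply/funext => w; rewrite cayley_sqrE.
Qed.

Lemma cvg_integral_cayley_sqr :
  \int[mu]_(w in `[- n.+1%:R, n.+1%:R]) cayley_sqr w @[n --> \oo] -->
  4 * pi * \sum_(k < M) h k ^+ 2.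
Proof.
have E n : \int[mu]_(w in `[- n.+1%:R, n.+1%:R]) cayley_sqr w =
    \sum_(p : 'I_M * 'I_M) h p.1 * h p.2 *
      \int[mu]_(w in `[- n.+1%:R, n.+1%:R]) cweight (p.1%:R - p.2%:R) w.
  rewrite (@eq_Rintegral _ _ _ mu _ (fun w => \sum_(p : 'I_M * 'I_M)
    h p.1 * h p.2 * cweight (p.1%:R - p.2%:R) w)); last first.
    by move=> w _; exact: cayley_sqrE.
  have ci (p : 'I_M * 'I_M) : mu.-integrable `[- n.+1%:R, n.+1%:R]
      (EFin \o cweight (p.1%:R - p.2%:R)).
    apply: within_continuous_integrable; apply: continuous_subspaceT.
    exact: continuous_cweight.
  by have [_ ->] := @integral_linear_comb _ _ (index_enum ('I_M * 'I_M)%type)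
    (fun p => h p.1 * h p.2) _ _ _ ci.
rewrite (_ : 4 * pi * _ = \sum_(p : 'I_M * 'I_M) h p.1 * h p.2 *
    (if (p.1 : nat) == p.2 then 4 * pi else 0)).
  under eq_cvg do rewrite E.
  apply: cvg_big => [|p _]; first exact: add_continuous.
  by apply: cvgM; [exact: cvg_cst|exact: cvg_integral_cweight].
rewrite -(pair_bigA _ (fun k l : 'I_M =>
  h k * h l * (if (k : nat) == l then 4 * pi else 0)))/=.
rewrite mulr_sumr; apply: eq_bigr => k _; rewrite (bigD1 k)//= eqxx big1 ?addr0.
  by rewrite mulrC expr2.
by move=> l lk; rewrite ifN ?mulr0// -[_ == _]/(k == l) eq_sym.
Qed.

(** Parseval's identity. Since the integrand is nonnegative, monotone convergence carries the limit
    over growing intervals to the whole line. *)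
Lemma integral_cayley_sqr :
  (\int[mu]_w (cayley_sqr w)%:E)%E = (4 * pi * \sum_(k < M) h k ^+ 2)%:E.
Proof.
pose F n : set R := `[- n.+1%:R, n.+1%:R]%classic.
have mc : measurable_fun setT (EFin \o cayley_sqr).
  by apply/measurable_EFinP; exact: continuous_measurable_fun cayley_sqr_continuous.
have FT : \bigcup_n F n = setT.
  rewrite -subTset => w _; exists (Num.truncn `|w|) => //=.
  by rewrite /F/= in_itv/= -ler_norml ltW// truncnS_gt.
have h1 : (\int[mu]_(w in F n) (cayley_sqr w)%:E @[n --> \oo] -->
    \int[mu]_w (cayley_sqr w)%:E)%E.
  rewrite -FT; apply: ge0_nondecreasing_set_cvg_integral => //.
  - move=> n k nk; apply/subsetPset => w; rewrite /F/= !in_itv/= => /andP[w1 w2].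
    rewrite (le_trans w2) ?ler_nat// andbT (le_trans _ w1)// lerN2 ler_nat//.
  - by move=> n; exact: measurable_itv.
  - by move=> n; exact: measurable_funTS.
  - by move=> n w _; rewrite lee_fin cayley_sqr_ge0.
have h2 : ((\int[mu]_(w in F n) (cayley_sqr w)%:E)%E @[n --> \oo] -->
    (4 * pi * \sum_(k < M) h k ^+ 2)%:E).
  rewrite (_ : (fun n => _) = EFin \o (fun n => \int[mu]_(w in F n) cayley_sqr w)).
    apply/cvg_EFin; first exact: nearW.
    exact: cvg_integral_cayley_sqr.
  apply/funext => n; rewrite /= /Rintegral fineK//.
  have ci : mu.-integrable `[- n.+1%:R, n.+1%:R] (EFin \o cayley_sqr).
    apply: within_continuous_integrable; apply: continuous_subspaceT.
    exact: cayley_sqr_continuous.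
  exact: integrable_fin_num ci.
exact: cvg_unique h1 h2.
Qed.

End PartialSums.
End CayleyWeights.

(** * Expansion of the frequency response in the Cayley variable *)

Section FrequencyResponse.
Context {R : realType}.
Notation mu := (@lebesgue_measure R).

Definition nsq (z : R[i]) : R := complex.Re z ^+ 2 + complex.Im z ^+ 2.

Lemma nsqM z1 z2 : nsq (z1 * z2) = nsq z1 * nsq z2.
Proof. by case: z1 => a b; case: z2 => c d; rewrite /nsq/=; ring. Qed.

(** The point (1 - iw) / (1 + iw) of the unit circle in polar form, which makes its powers
    explicit. *)
Definition cayley_pt (w : R) : R[i] :=
  Complex (cos (2 * atan w)) (- sin (2 * atan w)).

(** The number 2 / (1 + iw). *)
Definition cayley_coef (w : R) : R[i] :=
  Complex (2 / (1 + w ^+ 2)) (- (2 * w / (1 + w ^+ 2))).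

Let w2 (w : R) : 1 + w ^+ 2 != 0.
Proof. by rewrite gt_eqF// ltr_pwDl// sqr_ge0. Qed.

Lemma cos_2atan (w : R) : cos (2 * atan w) = (1 - w ^+ 2) / (1 + w ^+ 2).
Proof.
rewrite mulr2n mulrDl mul1r cosD -!expr2.
rewrite (_ : sin (atan w) ^+ 2 = 1 - cos (atan w) ^+ 2); last first.
  by rewrite -(cos2Dsin2 (atan w)) addrAC subrr add0r.
have -> : cos (atan w) ^+ 2 = (1 + w ^+ 2)^-1.
  by rewrite cos_atan exprVn sqr_sqrtr// addr_ge0// sqr_ge0.
by field; exact: w2.
Qed.

Lemma sin_2atan (w : R) : sin (2 * atan w) = 2 * w / (1 + w ^+ 2).
Proof.
have c0 : cos (atan w) != 0.
  by rewrite cos_atan invr_neq0// gt_eqF// sqrtr_gt0 ltr_pwDl// sqr_ge0.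
have sE : sin (atan w) = w * cos (atan w).
  by rewrite -{2}(atanK w) /tan divfK.
have c2 : cos (atan w) ^+ 2 = (1 + w ^+ 2)^-1.
  by rewrite cos_atan exprVn sqr_sqrtr// addr_ge0// sqr_ge0.
rewrite mulr2n mulrDl mul1r sinD sE.
have -> : w * cos (atan w) * cos (atan w) + cos (atan w) * (w * cos (atan w)) =
  2 * w * cos (atan w) ^+ 2 by ring.
by rewrite c2.
Qed.

Lemma cayley_ptX w k : cayley_pt w ^+ k =
  Complex (cos (k%:R * (2 * atan w))) (- sin (k%:R * (2 * atan w))).
Proof.
rewrite /cayley_pt; move: (2 * atan w) => t.
elim: k => [|k ih]; first by rewrite expr0 mul0r cos0 sin0 oppr0.
have E : k.+1%:R * t = k%:R * t + t by rewrite -(natr1 k); ring.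
rewrite exprS ih E cosD sinD.
by congr Complex; rewrite /=; ring.
Qed.

Lemma cayley_coef_pt w : 1 + cayley_pt w = cayley_coef w.
Proof.
rewrite /cayley_pt cos_2atan sin_2atan /cayley_coef.
by congr Complex; rewrite /=; field; exact: w2.
Qed.

Lemma cayley_coef_im w : 1 - cayley_pt w = cayley_coef w * Complex 0 w.
Proof.
rewrite /cayley_pt cos_2atan sin_2atan /cayley_coef.
by congr Complex; rewrite /=; field; exact: w2.
Qed.

Lemma nsq_cayley_coef w : nsq (cayley_coef w) = 4 / (1 + w ^+ 2).
Proof. by rewrite /nsq /cayley_coef/=; field; exact: w2. Qed.

Lemma nsq_partial_sum M (h : nat -> R) w :
  nsq (cayley_coef w * \sum_(k < M) cayley_pt w ^+ k * (h k)%:C%C) =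
  cayley_sqr M h w.
Proof.
rewrite nsqM nsq_cayley_coef /cayley_sqr /nsq !raddf_sum/=; congr (_ * (_ + _)).
  congr (_ ^+ 2); apply: eq_bigr => k _; rewrite cayley_ptX/=.
  by rewrite mulr0 subr0 mulrC.
rewrite -sqrrN -sumrN; congr (_ ^+ 2); apply: eq_bigr => k _; rewrite cayley_ptX/=.
by rewrite mulr0 add0r mulNr opprK mulrC.
Qed.

Section Resolvent.
Variables (n nw nz : nat) (A P : 'M[R]_n) (B : 'M[R]_(n, nw)) (C : 'M[R]_(nz, n)).
Hypothesis pP : posdefmx P.
Hypothesis lyap : posdefmx (- (A *m P + (A *m P)^T + B *m B^T)).

Local Notation Bk := (cayley_iter A B).

Lemma onemx_cayley_iter k :
  (1%:M - A) *m Bk k.+1 = (1%:M + A) *m Bk k.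
Proof.
rewrite /cayley_iter iterS /cayley_mx !mulmxA mulmxV ?mul1mx//.
exact: onemx_unit pP lyap.
Qed.

Lemma complexmxD p q (X Y : 'M[R]_(p, q)) :
  complexmx (X + Y) = complexmx X + complexmx Y.
Proof. exact: map_mxD. Qed.

Lemma resolvent_unit w : (Complex 0 w)%:M - complexmx A \in unitmx.
Proof.
have hA : hurwitz A := lyapunov_hurwitz pP (lyap_posdef lyap).
rewrite -row_free_unit -kermx_eq0; apply/negPn/negP.
move=> /rowV0Pn[v /sub_kermxP vA v0].
have /hA/= : eigenvalue (complexmx A) (Complex 0 w).
  apply/eigenvalueP; exists v => //; apply/esym/eqP.
  by rewrite -subr_eq0 -mul_mx_scalar -mulmxBr vA.
by rewrite ltxx.
Qed.

Definition response (w : R) : 'M[R[i]]_(nz, nw) :=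
  complexmx C *m invmx ((Complex 0 w)%:M - complexmx A) *m complexmx B.

(** With c = 1 + z and c iw = 1 - z one gets c (iw - A) = (I - A) - z (I + A), so the recursion for
    the coefficients makes the sum telescope and leaves an exact remainder. *)
Lemma response_partial_sum w M :
  response w = (\sum_(k < M) (cayley_coef w * cayley_pt w ^+ k) *: complexmx (C *m Bk k)) +
    cayley_pt w ^+ M *: (complexmx C *m invmx ((Complex 0 w)%:M - complexmx A)
       *m complexmx (1%:M - A) *m complexmx (Bk M)).
Proof.
set S := _ - complexmx A; set z := cayley_pt w; set c := cayley_coef w.
have c1 : 1 + z = c := cayley_coef_pt w.
have cs : 1 - z = c * Complex 0 w := cayley_coef_im w.
have step k : S *m (c *: complexmx (Bk k)) =
    complexmx ((1%:M - A) *m Bk k) - z *: complexmx ((1%:M - A) *m Bk k.+1).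
  rewrite onemx_cayley_iter -scalemxAr mulmxBl mul_scalar_mx.
  rewrite mulmxBl mulmxDl !mul1mx complexmxB complexmxD -!complexmxM.
  rewrite scalerBr scalerA -cs -c1.
  rewrite scalerBl scalerDl scalerDr !scale1r.
  by rewrite !opprD addrACA.
have tel : complexmx B = S *m (\sum_(k < M) (c * z ^+ k) *: complexmx (Bk k)) +
    z ^+ M *: complexmx ((1%:M - A) *m Bk M).
  elim: M => [|M ih].
    rewrite big_ord0 mulmx0 add0r expr0 scale1r; congr complexmx.
    by rewrite /cayley_iter/= mulmxA mulmxV ?mul1mx//; exact: onemx_unit pP lyap.
  rewrite [LHS]ih big_ord_recr/= mulmxDr -addrA; congr (_ + _).
  rewrite mulrC -scalerA -scalemxAr step scalerBr scalerA -exprSr subrK//.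
rewrite /response -/S tel mulmxDr !mulmxA; congr (_ + _).
  rewrite -(mulmxA _ (invmx S)) mulVmx ?resolvent_unit// mulmx1 mulmx_sumr.
  by apply: eq_bigr => k _; rewrite -scalemxAr complexmxM.
by rewrite -scalemxAr complexmxM !mulmxA.
Qed.

(** The remainder is a power of z, of modulus one, times a fixed matrix applied to the iterates,
    which tend to zero. *)
Lemma cvg_response_partial_sum w i j :
  cayley_sqr M (fun k => (C *m Bk k) i j) w @[M --> \oo] --> nsq (response w i j).
Proof.
pose a := complexmx C *m invmx ((Complex 0 w)%:M - complexmx A) *m complexmx (1%:M - A).
pose e M := \sum_l a i l * (Bk M l j)%:C%C.
have GE M : cayley_coef w * \sum_(k < M) cayley_pt w ^+ k * ((C *m Bk k) i j)%:C%C =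
    response w i j - cayley_pt w ^+ M * e M.
  rewrite (response_partial_sum w M) mxE summxE mulr_sumr.
  apply/eqP; rewrite eq_sym subr_eq; apply/eqP; congr (_ + _).
    by apply: eq_bigr => k _; rewrite !mxE mulrA.
  by rewrite !mxE; congr (_ * _); apply: eq_bigr => l _; rewrite !mxE.
have zr M : `|complex.Re (cayley_pt w ^+ M)| <= 1 /\ `|complex.Im (cayley_pt w ^+ M)| <= 1.
  by rewrite cayley_ptX/= normrN ler_norml cos_geN1 cos_le1 ler_norml sin_geN1 sin_le1.
have [re0 im0] : complex.Re (cayley_pt w ^+ M * e M) @[M --> \oo] --> (0 : R) /\
    complex.Im (cayley_pt w ^+ M * e M) @[M --> \oo] --> (0 : R).
  (* Abstracts over the real and the imaginary part, so that both limits follow from one squeeze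
     argument. *)
  have ceval (f : R[i] -> R) (fD : forall I (r : seq I) (F : I -> R[i]),
        f (\sum_(k <- r) F k) = \sum_(k <- r) f (F k))
      (fM : forall M x t, `|f (cayley_pt w ^+ M * (x * t%:C%C))| <=
         (`|complex.Re x| + `|complex.Im x|) * `|t|) :
      f (cayley_pt w ^+ M * e M) @[M --> \oo] --> (0 : R).
    rewrite (_ : (fun M => _) = fun M =>
        \sum_l f (cayley_pt w ^+ M * (a i l * (Bk M l j)%:C%C))).
      have s0 : \sum_(l < n) (0 : R) = 0 by rewrite big1.
      suff : (\sum_l f (cayley_pt w ^+ M * (a i l * (Bk M l j)%:C%C)))
          @[M --> \oo] --> \sum_(l < n) (0 : R) by rewrite s0.
      apply: cvg_big => [|l _]; first exact: add_continuous.
      apply/norm_cvg0P.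
      apply: (@squeeze_cvgr _ _ _ _ (cst 0)
        (fun k => (`|complex.Re (a i l)| + `|complex.Im (a i l)|) * `|Bk k l j|)).
      - by near=> k; rewrite normr_ge0 fM.
      - exact: cvg_cst.
      - have B0 : `|Bk k l j| @[k --> \oo] --> (0 : R).
          by apply/norm_cvg0P; exact: cayley_iter_cvg pP lyap _ _.
        have := cvgM (cvg_cst (`|complex.Re (a i l)| + `|complex.Im (a i l)|)) B0.
        by rewrite mulr0; exact.
    by apply/funext => M; rewrite /e mulr_sumr fD.
  have bd (p q r s t : R) : `|p| <= 1 -> `|q| <= 1 ->
      `|p * (r * t) + q * (s * t)| <= (`|r| + `|s|) * `|t|.
    move=> p1 q1; apply: le_trans (ler_normD _ _) _; rewrite mulrDl lerD//.
      by rewrite !normrM -[leRHS]mul1r ler_pM.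
    by rewrite !normrM -[leRHS]mul1r ler_pM.
  split; apply: ceval.
  - by move=> I r F; rewrite raddf_sum.
  - move=> M x t; have [h1 h2] := zr M; move: h1 h2.
    case: (cayley_pt w ^+ M) => p q; case: x => r s /= h1 h2.
    rewrite !mulr0 subr0 add0r -mulNr; apply: bd => //; by rewrite normrN.
  - by move=> I r F; rewrite raddf_sum.
  - move=> M x t; have [h1 h2] := zr M; move: h1 h2.
    case: (cayley_pt w ^+ M) => p q; case: x => r s /= h1 h2.
    by rewrite !mulr0 subr0 add0r addrC; apply: bd.
have sub0 (x : R) (g : nat -> R) : g M @[M --> \oo] --> (0 : R) ->
    x - g M @[M --> \oo] --> x.
  by move=> g0; have := cvgB (cvg_cst x) g0; rewrite subr0; exact.
have re1 := sub0 (complex.Re (response w i j)) _ re0.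
have im1 := sub0 (complex.Im (response w i j)) _ im0.
rewrite /nsq !expr2.
apply: cvg_trans (cvgD (cvgM re1 re1) (cvgM im1 im1)).
apply: near_eq_cvg; near=> M; rewrite /= -nsq_partial_sum GE /nsq !expr2.
by congr (_ * _ + _ * _); rewrite raddfB.
Unshelve. all: by end_near. Qed.

End Resolvent.
End FrequencyResponse.

(** * The bound on the H2 norm *)

Section H2Bound.
Context {R : realType}.
Notation mu := (@lebesgue_measure R).

Lemma Re_trace_nsq p q (G : 'M[R[i]]_(p, q)) :
  complex.Re (\tr ((map_mx conjc G)^T *m G)) = \sum_i \sum_j nsq (G i j).
Proof.
rewrite exchange_big/= raddf_sum; apply: eq_bigr => j _.
rewrite mxE raddf_sum; apply: eq_bigr => i _; rewrite !mxE /nsq.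
by case: (G i j) => a b /=; ring.
Qed.

(** The partial sums are known to converge pointwise only, and an upper bound is all that is wanted,
    which is the situation of Fatou's lemma. *)
Lemma integral_response_le n nw nz (A P : 'M[R]_n) (B : 'M[R]_(n, nw))
    (C : 'M[R]_(nz, n)) : posdefmx P ->
  posdefmx (- (A *m P + (A *m P)^T + B *m B^T)) ->
  (\int[mu]_w (\sum_i \sum_j nsq (response A B C w i j))%:E <=
   (2 * pi * \tr (C *m P *m C^T))%:E)%E.
Proof.
move=> pP lyap.
pose h (i : 'I_nz) (j : 'I_nw) k : R := (C *m cayley_iter A B k) i j.
pose f M w : \bar R := (\sum_i \sum_j cayley_sqr M (h i j) w)%:E.
have fE w : f M w @[M --> \oo] --> (\sum_i \sum_j nsq (response A B C w i j))%:E.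
  have fR : \sum_i \sum_j cayley_sqr M (h i j) w @[M --> \oo] -->
      \sum_i \sum_j nsq (response A B C w i j).
    apply: cvg_big => [|i _]; first exact: add_continuous.
    apply: cvg_big => [|j _]; first exact: add_continuous.
    exact: (cvg_response_partial_sum pP lyap).
  by apply/cvg_EFin; [exact: nearW|exact: fR].
have mf M : measurable_fun setT (f M).
  apply/measurable_EFinP; apply: continuous_measurable_fun.
  apply: continuous_big => [|i _]; first exact: add_continuous.
  apply: continuous_big => [|j _]; first exact: add_continuous.
  exact: cayley_sqr_continuous.
have f0 M w : (0 <= f M w)%E.
  by rewrite lee_fin sumr_ge0// => i _; rewrite sumr_ge0// => j _; exact: cayley_sqr_ge0.
have If M : (\int[mu]_w f M w <= (2 * pi * \tr (C *m P *m C^T))%:E)%E.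
  rewrite (_ : (\int[mu]_w f M w)%E =
      (4 * pi * \sum_i \sum_j \sum_(k < M) h i j k ^+ 2)%:E).
    (* The constants match: Parseval gives 4 pi times the sum of squares, and twice that sum is at
       most the trace. *)
    have := cayley_sum_le pP lyap C M.
    rewrite (_ : \sum_(k < M) _ = \sum_i \sum_j \sum_(k < M) h i j k ^+ 2).
      rewrite lee_fin => le; have := ler_wpM2l (pi_ge0 R) le.
      by move: (pi : R) (\tr _) (\sum_i _) => *; lra.
    rewrite exchange_big/=; apply: eq_bigr => i _.
    by rewrite exchange_big.
  rewrite (_ : (fun w => f M w) = (fun w => \sum_i \sum_j (cayley_sqr M (h i j) w)%:E)%E).
    have ms i j : measurable_fun setT (fun w => (cayley_sqr M (h i j) w)%:E).
      apply/measurable_EFinP; apply: continuous_measurable_fun.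
      exact: cayley_sqr_continuous.
    have s0 i j w : (0 <= (cayley_sqr M (h i j) w)%:E)%E.
      by rewrite lee_fin cayley_sqr_ge0.
    rewrite ge0_integral_sum//.
    - rewrite mulr_sumr -sumEFin; apply: eq_bigr => i _.
      rewrite ge0_integral_sum//; last by move=> j; exact: ms.
      rewrite mulr_sumr -sumEFin; apply: eq_bigr => j _.
      exact: integral_cayley_sqr.
    - by move=> i; apply: emeasurable_sum => j; exact: ms.
    - by move=> i w _; apply: sume_ge0.
  by apply/funext => w; rewrite /f -sumEFin; apply: eq_bigr => i _; rewrite -sumEFin.
rewrite (@eq_integral _ _ _ mu _ (fun w => limn_einf (f^~ w))); last first.
  move=> w _; rewrite is_cvg_limn_einfE; last by apply/cvg_ex; eexists; exact: fE.
  by apply/esym/cvg_lim => //; exact: fE.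
apply: le_trans (fatou _ _ _ _) _ => //.
rewrite limn_einf_lim; apply: lime_le; first exact: is_cvg_einfs.
apply: nearW => M; apply: le_trans (If M).
by apply: ereal_inf_lbound; exists M => /=.
Qed.

Lemma H2norm_lt n nw nz (A P : 'M[R]_n) (B : 'M[R]_(n, nw))
    (C : 'M[R]_(nz, n)) gamma : posdefmx P ->
  posdefmx (- (A *m P + (A *m P)^T + B *m B^T)) ->
  0 < gamma -> \tr (C *m P *m C^T) < gamma ^+ 2 ->
  (H2norm (fun s => complexmx C *m invmx (s%:M - complexmx A) *m complexmx B) < gamma%:E)%E.
Proof.
move=> pP lyap g0 tr; rewrite /H2norm.
have pi0 : 0 < 2 * pi :> R by rewrite mulr_gt0// pi_gt0.
have := integral_response_le C pP lyap.
rewrite (@eq_integral _ _ _ mu _ (fun w =>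
  (complex.Re (\tr ((map_mx conjc (response A B C w))^T
  *m response A B C w)))%:E)); last by move=> w _; rewrite Re_trace_nsq.
rewrite -/(response _ _ _ _).
set I := (\int[mu]_w _)%E => Ile.
have I0 : (0 <= I)%E.
  apply: integral_ge0 => w _; rewrite lee_fin Re_trace_nsq.
  by rewrite sumr_ge0// => i _; rewrite sumr_ge0// => j _; rewrite addr_ge0// sqr_ge0.
have Ifin : I \is a fin_num by rewrite ge0_fin_numE// (le_lt_trans Ile)// ltry.
rewrite -/I; move: Ile I0; rewrite -(fineK Ifin) !lee_fin => Ile I0.
rewrite -EFinM poweR_EFin lte_fin powR12_sqrt; last first.
  by rewrite mulr_ge0// invr_ge0 ltW.
rewrite -(@ltr_pXn2r _ 2)// ?nnegrE ?sqrtr_ge0// ?ltW//.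
rewrite sqr_sqrtr; last by rewrite mulr_ge0// invr_ge0 ltW.
by apply: le_lt_trans tr; rewrite ler_pdivrMl.
Qed.

End H2Bound.

(** * The linear matrix inequalities *)

Section LMI.
Context {R : realType}.

Lemma loewner_gt0 p (A : 'M[R]_p) : loewner_lt 0 A = posdefmx A.
Proof. by rewrite /loewner_lt subr0. Qed.

Lemma loewner_lt0 p (A : 'M[R]_p) : loewner_lt A 0 = posdefmx (- A).
Proof. by rewrite /loewner_lt sub0r. Qed.

Variables (n m nw nz : nat).
Variables (Omega : 'M[R]_(n + (n + m), nw)).

Definition lyap_mx (Phi : 'M[R]_n) (L : 'M[R]_(m, n)) : 'M[R]_(n + (n + m)) :=
  block_mx (0 : 'M[R]_n) (row_mx (- Phi) (- L^T))
    (col_mx (- Phi) (- L)) (block_mx 0 0 0 0).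

Lemma lyap_mx_sym Phi L : Phi^T = Phi -> (lyap_mx Phi L)^T = lyap_mx Phi L.
Proof.
move=> sP; rewrite /lyap_mx tr_block_mx tr_row_mx tr_col_mx.
rewrite !linearN/= trmxK sP trmx0; congr (block_mx _ _ _ _).
by rewrite tr_block_mx !trmx0.
Qed.

Lemma lyap_mx_congr Phi L (A : 'M[R]_n) (B : 'M[R]_(n, m)) : Phi^T = Phi ->
  let S := row_mx 1%:M (row_mx A B) in
  S *m (lyap_mx Phi L - Omega *m Omega^T) *m S^T =
  - ((A *m Phi + B *m L) + (A *m Phi + B *m L)^T +
     BOmega Omega A B *m (BOmega Omega A B)^T).
Proof.
move=> sP S.
have E : S *m lyap_mx Phi L *m S^T = - ((A *m Phi + B *m L) + (A *m Phi + B *m L)^T).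
  rewrite /S /lyap_mx block_mx0 tr_row_mx mul_row_block mul_row_col trmx1.
  rewrite !mulmx0 !mul1mx add0r addr0 mulmx1 mul_row_col tr_row_mx mul_row_col.
  by rewrite [(_ + _)^T]linearD/= !trmx_mul sP !mulmxN !mulNmx !opprD.
by rewrite mulmxBr mulmxBl E /BOmega -/S trmx_mul !mulmxA -opprD.
Qed.

(** For alpha = 0 the form at a vector [0; w] reduces to that of -Omega Omega^T, which is never
    positive. A nonzero w exists because n > 0. *)
Lemma lyap_mx_pos_alpha Phi L alpha (Q : 'M[R]_(n + (n + m))) : (0 < n)%N ->
  0 <= alpha ->
  posdefmx (lyap_mx Phi L - Omega *m Omega^T + alpha *: Q) -> 0 < alpha.
Proof.
move=> n0; rewrite le_eqVlt => /predU1P[<-|//]; rewrite scale0r addr0 => -[_ H].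
pose w : 'cV[R]_(n + m) := const_mx 1.
pose v : 'cV[R]_(n + (n + m)) := col_mx 0 w.
have v0 : v != 0.
  rewrite /v col_mx_eq0 eqxx/=; apply/eqP => /matrixP/(_ (lshift m (Ordinal n0)) 0).
  by rewrite !mxE => /eqP; rewrite oner_eq0.
have := H _ v0; rewrite -/(qf _ _) qfB.
rewrite [X in X - _](_ : _ = 0); last first.
  by rewrite /lyap_mx block_mx0 qf_block qf0 /qf !mulmx0 trmx0 !mul0mx !mxE !addr0.
have := (psd_gram Omega).2 v; rewrite -/(qf _ _).
by move: (qf _ _) => z; lra.
Qed.

Lemma H2_schur (Phi : 'M[R]_n) (Psi : 'M[R]_nz) (C : 'M[R]_(nz, n))
    (D : 'M[R]_(nz, m)) (K : 'M[R]_(m, n)) : posdefmx Phi -> Psi^T = Psi ->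
  let L := K *m Phi in
  posdefmx (block_mx Psi (C *m Phi + D *m L) (L^T *m D^T + Phi *m C^T) Phi) <->
  posdefmx (Psi - (C + D *m K) *m Phi *m (C + D *m K)^T).
Proof.
move=> pP sPsi L; have sP := pP.1; have uP := posdef_unit pP.
have XE : C *m Phi + D *m L = (C + D *m K) *m Phi by rewrite mulmxDl mulmxA.
have -> : L^T *m D^T + Phi *m C^T = (C *m Phi + D *m L)^T.
  by rewrite [(_ + _)^T]linearD/= !trmx_mul sP addrC.
rewrite posdef_schur// XE.
rewrite (_ : (C + D *m K) *m Phi *m invmx Phi = C + D *m K); last first.
  by rewrite -mulmxA mulmxV// mulmx1.
by rewrite trmx_mul sP mulmxA.
Qed.

End LMI.

(** * Equivalence of informativity and the matrix inequalities *)

Section Informativity.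
Context {R : realType}.
Variables (n m N nw nz : nat) (n_gt0 : (0 < n)%N).
Variables (tau : 'I_N -> R) (tau_gt0 : forall k, 0 < tau k).
Variables (Omega : 'M[R]_(n + (n + m), nw)) (C : 'M[R]_(nz, n)) (D : 'M[R]_(nz, m)).
Variables (x : 'I_N -> R -> 'cV[R]_n) (u : 'I_N -> R -> 'cV[R]_m).
Hypothesis xH1 : forall k, H1v 0 (tau k) (x k).
Hypothesis uL2 : forall k, L2v 0 (tau k) (u k).
Variable Theta : 'M[R]_(n + (n + m)).
Hypothesis Theta_psd : psdmx Theta.

(** Congruence with S = [I A B] preserves strictness since S^T is injective; adding alpha times the
    data inequality cancels the term with Z Z^* - Theta and leaves the Lyapunov inequality. *)
Lemma H2_LMI_consistent gamma Phi Psi L alpha : posdefmx Phi -> posdefmx Psi ->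
  0 < alpha -> H2_LMI tau Theta Omega C D x u gamma Phi Psi L alpha ->
  let K := L *m invmx Phi in
  forall A B, consistent tau Theta x u A B ->
  [/\ loewner_lt ((A + B *m K) *m Phi + Phi *m (A + B *m K)^T
             + BOmega Omega A B *m (BOmega Omega A B)^T) 0,
       loewner_lt 0 (Psi - (C + D *m K) *m Phi *m (C + D *m K)^T)
     & \tr Psi < gamma ^+ 2].
Proof.
move=> pP pPsi a0 [lmi1 lmi2 tr] K A B con; have sP := pP.1.
have uP := posdef_unit pP.
have KP : K *m Phi = L by rewrite /K -mulmxA mulVmx// mulmx1.
split => //; last first.
  by move: lmi2; rewrite !loewner_gt0 -KP => /(H2_schur _ _ _ pP pPsi.1).
move: lmi1; rewrite loewner_gt0 loewner_lt0 -/(lyap_mx _ _) => lmi1.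
pose S := row_mx 1%:M (row_mx A B) : 'M[R]_(n, n + (n + m)).
have Q := consistent_QMI tau_gt0 xH1 uL2 con; rewrite -/S in Q.
have P1 := posdef_congr (@row1_inj _ _ _ (row_mx A B)) lmi1; rewrite -/S in P1.
have := posdefD P1 (psdZ (ltW a0) Q).
rewrite mulmxDr mulmxDl -scalemxAr -scalemxAl -addrA -scalerDr -mulmxDl -mulmxDr.
rewrite [_ - Theta + _]addrC addrA subrK subrr mulmx0 mul0mx scaler0 addr0.
rewrite lyap_mx_congr// -KP.
rewrite (_ : A *m Phi + B *m (K *m Phi) = (A + B *m K) *m Phi).
  by rewrite trmx_mul sP.
by rewrite mulmxDl mulmxA.
Qed.

Hypothesis hyp_a : exists As Bs, consistent tau Theta x u As Bs.
Hypothesis hyp_b : loewner_lt (drsubmx Theta)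
     (\sum_k block_mx (gram (tau k) (x k) (x k)) (gram (tau k) (x k) (u k))
                      (gram (tau k) (u k) (x k)) (gram (tau k) (u k) (u k))).
Hypothesis hyp_c : loewner_lt 0 (ulsubmx Theta -
     ursubmx Theta *m mpinv (drsubmx Theta) *m (ursubmx Theta)^T).

Lemma informative_H2_LMI gamma :
  informative_H2 tau Theta Omega C D x u gamma ->
  exists (Phi : 'M[R]_n) (Psi : 'M[R]_nz) (L : 'M[R]_(m, n)) (alpha : R),
     [/\ posdefmx Phi, posdefmx Psi, 0 < alpha &
         H2_LMI tau Theta Omega C D x u gamma Phi Psi L alpha].
Proof.
move=> [Phi [Psi [K [pP pPsi H]]]]; pose L := K *m Phi; have sP := pP.1.
(* The inequalities on [Psi] do not involve (A, B) but are granted only for consistent pairs, so one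
   such pair is required; it also provides the centre for the S-lemma. *)
have [As [Bs con0]] := hyp_a; have [_ sch tr] := H _ _ con0.
have sZ : (ZZ tau x u)^T = ZZ tau x u.
  by rewrite ZZ_gramian//; have [] := gramian_psd tau_gt0 (data_L1 tau_gt0 xH1 uL2).
have sN : (Theta - ZZ tau x u)^T = Theta - ZZ tau x u.
  by rewrite linearB/= Theta_psd.1 sZ.
have sM : (lyap_mx Phi L - Omega *m Omega^T)^T = lyap_mx Phi L - Omega *m Omega^T.
  by rewrite linearB/= lyap_mx_sym// trmx_mul trmxK.
have pD : posdefmx (- drsubmx (Theta - ZZ tau x u)).
  rewrite (_ : - _ = drsubmx (ZZ tau x u) - drsubmx Theta); last first.
    by apply/matrixP => i j; rewrite !mxE opprB.
  by rewrite drsubmx_ZZ.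
have Q0 := consistent_QMI tau_gt0 xH1 uL2 con0.
have [|alpha a0 pA] := matrix_S_lemma sM sN pD Q0.
  move=> Y; rewrite -(hsubmxK Y) => QY.
  have /H[+ _ _] : consistent tau Theta x u (lsubmx Y) (rsubmx Y).
    apply: QMI_consistent => //; apply: posdef_row1_congr => //.
    by move: hyp_c; rewrite loewner_gt0.
  rewrite loewner_lt0 lyap_mx_congr//.
  rewrite (_ : lsubmx Y *m Phi + rsubmx Y *m L = (lsubmx Y + rsubmx Y *m K) *m Phi).
    by rewrite [(_ *m Phi)^T]trmx_mul sP.
  by rewrite mulmxDl /L mulmxA.
rewrite -scalerN opprB in pA.
exists Phi, Psi, L, alpha; split => //.
  exact: (lyap_mx_pos_alpha n_gt0 a0 pA).
split => //; rewrite loewner_gt0; first exact: pA.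
by move: sch; rewrite loewner_gt0 => /(H2_schur _ _ _ pP pPsi.1).
Qed.

End Informativity.

Theorem theorem3p5 (R : realType) (n m N nw nz : nat)
  (n_gt0 : (0 < n)%N) (m_gt0 : (0 < m)%N) (N_gt0 : (0 < N)%N)
  (nw_gt0 : (0 < nw)%N) (nz_gt0 : (0 < nz)%N)
  (tau : 'I_N -> R) (tau_gt0 : forall k, 0 < tau k)
  (Omega : 'M[R]_(n + (n + m), nw)) (C : 'M[R]_(nz, n)) (D : 'M[R]_(nz, m))
  (E : 'M[R]_(nz, nw)) (E0 : E = 0)
  (x : 'I_N -> R -> 'cV[R]_n) (u : 'I_N -> R -> 'cV[R]_m)
  (xH1 : forall k, H1v 0 (tau k) (x k))
  (uL2 : forall k, L2v 0 (tau k) (u k))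
  (Theta : 'M[R]_(n + (n + m))) (Theta_psd : psdmx Theta)
  (hyp_a : exists (As : 'M[R]_n) (Bs : 'M[R]_(n, m))
             (p q : 'I_N -> R -> 'cV[R]_n) (r : 'I_N -> R -> 'cV[R]_m),
     noise_class tau Theta p q r /\ noisy_system tau x u p q r As Bs)
  (hyp_b : loewner_lt (drsubmx Theta)
     (\sum_k block_mx (gram (tau k) (x k) (x k)) (gram (tau k) (x k) (u k))
                      (gram (tau k) (u k) (x k)) (gram (tau k) (u k) (u k))))
  (hyp_c : loewner_lt 0 (ulsubmx Theta -
     ursubmx Theta *m mpinv (drsubmx Theta) *m (ursubmx Theta)^T))
  (gamma : R) (gamma_gt0 : 0 < gamma) :
  (informative_H2 tau Theta Omega C D x u gamma <->
   exists (Phi : 'M[R]_n) (Psi : 'M[R]_nz) (L : 'M[R]_(m, n)) (alpha : R),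
     [/\ posdefmx Phi, posdefmx Psi, 0 < alpha &
         H2_LMI tau Theta Omega C D x u gamma Phi Psi L alpha]) /\
  (forall (Phi : 'M[R]_n) (Psi : 'M[R]_nz) (L : 'M[R]_(m, n)) (alpha : R),
     posdefmx Phi -> posdefmx Psi -> 0 < alpha ->
     H2_LMI tau Theta Omega C D x u gamma Phi Psi L alpha ->
     forall (A : 'M[R]_n) (B : 'M[R]_(n, m)), consistent tau Theta x u A B ->
       let K := L *m invmx Phi in
       hurwitz (A + B *m K) /\
       (H2norm (transfer Omega C D E A B K) < gamma%:E)%E).
Proof.
have fwd (Phi : 'M[R]_n) (Psi : 'M[R]_nz) (L : 'M[R]_(m, n)) (alpha : R)
    (pP : posdefmx Phi) (pPsi : posdefmx Psi) (a0 : 0 < alpha)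
    (lmi : H2_LMI tau Theta Omega C D x u gamma Phi Psi L alpha) :=
  H2_LMI_consistent tau_gt0 xH1 uL2 pP pPsi a0 lmi.
split; first split.
- exact: informative_H2_LMI.
- move=> [Phi [Psi [L [alpha [pP pPsi a0 lmi]]]]].
  by exists Phi, Psi, (L *m invmx Phi); split => // A B con; apply: fwd lmi _ _ con.
move=> Phi Psi L alpha pP pPsi a0 lmi A B con K.
have [] := fwd _ _ _ _ pP pPsi a0 lmi _ _ con; rewrite -/K loewner_lt0 loewner_gt0.
rewrite (_ : Phi *m (A + B *m K)^T = ((A + B *m K) *m Phi)^T); last first.
  by rewrite trmx_mul pP.1.
move=> lyap sch tr; split; first exact: lyapunov_hurwitz pP (lyap_posdef lyap).
have trC : \tr ((C + D *m K) *m Phi *m (C + D *m K)^T) < gamma ^+ 2.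
  apply: le_lt_trans tr; rewrite -subr_ge0 -linearB/=.
  exact/mxtrace_psd/posdef_psd.
rewrite (_ : transfer _ _ _ _ _ _ _ = fun s => complexmx (C + D *m K) *m
    invmx (s%:M - complexmx (A + B *m K)) *m complexmx (BOmega Omega A B)).
  exact: H2norm_lt pP lyap gamma_gt0 trC.
apply/funext => s; rewrite /transfer E0.
rewrite (_ : complexmx 0 = 0) ?addr0//.
by apply/matrixP => i j; rewrite !mxE.
Qed.
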